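(* Let $K$ be a number field with ring of integers $\mathcal{O}_K$, and let $\mathfrak{B}=\{\mathfrak{b}_\ell:\ell\ge 1\}$ be an Erdős family of ideals in $\mathcal{O}_K$. Then the $\mathfrak{B}$-free subshift $(X_{\mathfrak{B}},(S_a)_{a\in\mathcal{O}_K})$ is intrinsically ergodic: it has a unique measure of maximal entropy, namely $\kappa=\Phi_*(P\otimes\beta)$. Equivalently, conditioned on a Haar-random phase $g\in G$, the unique measure of maximal entropy places independent fair coins on the allowed positions $A_g$ and zeros elsewhere; that is, it equals $\int_G\kappa_g\,dP(g)$, where $\kappa_g$ is the law on $\{0,1\}^{\mathcal{O}_K}$ under which the coordinates $(x_a)_{a\in A_g}$ are independent and uniform on $\{0,1\}$ and $x_a=0$ for all $a\notin A_g$. In particular $$h_\kappa(S)=h_{\mathrm{top}}(X_{\mathfrak{B}})=\prod_{\ell\ge1}\Big(1-\frac{1}{N(\mathfrak{b}_\ell)}\Big),$$ and $\kappa$ is mutually singular with the (zero-entropy) Mirsky measure $\nu_\eta$.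
   Context: $\mathbf{Erdős\ family.}$ For a nonzero ideal $\mathfrak{b}\subseteq\mathcal{O}_K$ put $N(\mathfrak{b})=|\mathcal{O}_K/\mathfrak{b}|$. A family $\mathfrak{B}=\{\mathfrak{b}_\ell:\ell\ge1\}$ of proper nonzero ideals of $\mathcal{O}_K$ is Erdős if it is infinite, the $\mathfrak{b}_\ell$ are pairwise coprime ($\mathfrak{b}_\ell+\mathfrak{b}_m=\mathcal{O}_K$ for $\ell\ne m$), and $\sum_{\ell\ge1}1/N(\mathfrak{b}_\ell)<\infty$. $\mathbf{Subshift.}$ The additive group $\mathcal{O}_K\cong\mathbb{Z}^d$, $d=[K:\mathbb{Q}]$, acts on $\{0,1\}^{\mathcal{O}_K}$ (product topology) by $(S_ax)(b)=x(a+b)$; write $S=(S_a)_{a\in\mathcal{O}_K}$, $x_a=x(a)$, $\operatorname{supp}x=\{a:x_a=1\}$. For $A\subseteq\mathcal{O}_K$, $|A/\mathfrak{b}|$ is the number of residue classes modulo $\mathfrak{b}$ met by $A$. The $\mathfrak{B}$-free subshift $X_{\mathfrak{B}}$ is the closed shift-invariant set of all $x\in\{0,1\}^{\mathcal{O}_K}$ with $|\operatorname{supp}x/\mathfrak{b}_\ell|<N(\mathfrak{b}_\ell)$ for every $\ell\ge1$. $\mathbf{Phases\ and\ measures.}$ $G=\prod_{\ell\ge1}\mathcal{O}_K/\mathfrak{b}_\ell$ with Haar probability measure $P$ (the product of the normalised counting measures). The elements $g=(g_\ell)_\ell\in G$ are called phases; write $g_\ell+a$ for $g_\ell+(a\bmod\mathfrak{b}_\ell)$.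 Define $\varphi:G\to\{0,1\}^{\mathcal{O}_K}$ by $\varphi(g)(a)=1$ iff $g_\ell+a\ne0$ in $\mathcal{O}_K/\mathfrak{b}_\ell$ for every $\ell\ge1$, and $A_g=\operatorname{supp}\varphi(g)=\{a\in\mathcal{O}_K:a\not\equiv-g_\ell\ (\mathrm{mod}\ \mathfrak{b}_\ell)\ \text{for every }\ell\}$, the set of allowed positions for $g$. The Mirsky measure is $\nu_\eta=\varphi_*P$. Let $\beta$ be the uniform Bernoulli measure on $\{0,1\}^{\mathcal{O}_K}$ (independent fair coins), and let $\Phi:G\times\{0,1\}^{\mathcal{O}_K}\to X_{\mathfrak{B}}$, $\Phi(g,\omega)=\varphi(g)\cdot\omega$ (coordinatewise product). $\mathbf{Entropy.}$ All logarithms are base 2. $h_{\mathrm{top}}$ is the topological entropy of the $\mathcal{O}_K$-action $S$ and $h_\nu(S)$ is the Kolmogorov–Sinai entropy of an $S$-invariant Borel probability measure $\nu$ (both in the sense of actions of countable amenable groups). A measure of maximal entropy is an $S$-invariant Borel probability measure $\nu$ with $h_\nu(S)=h_{\mathrm{top}}(X_{\mathfrak{B}})$. *)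

(* Defs.v *)
From HB Require Import structures.
From mathcomp Require Import all_boot all_order all_algebra all_field.
From mathcomp Require Import generic_quotient ring_quotient finmap.
From mathcomp Require Import all_classical all_reals all_analysis measurable_realfun.

Set Implicit Arguments.
Unset Strict Implicit.
Unset Printing Implicit Defensive.

Import Order.TTheory GRing.Theory Num.Theory.
Import numFieldNormedType.Exports VectorInternalTheory.

Local Open Scope classical_set_scope.
Local Open Scope ring_scope.

(* A number field is a [K : fieldExtType rat], i.e. a finite extension of Q;
   its ring of integers is the integral closure of Z in K. *)
Definition algint (K : fieldExtType rat) : {pred K} :=
  fun x => `[< integralOver (intr : int -> K) x >].

Lemma algint_subring (K : fieldExtType rat) : subring_closed (@algint K).
Proof.
split=> [|x y|x y]; rewrite !unfold_in.
- by apply/asboolP; exact: integral1.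
- by move=> /asboolP ? /asboolP ?; apply/asboolP; exact: integral_sub.
- by move=> /asboolP ? /asboolP ?; apply/asboolP; exact: integral_mul.
Qed.

HB.instance Definition _ (K : fieldExtType rat) :=
  GRing.isSubringClosed.Build K (@algint K) (@algint_subring K).

Record integers (K : fieldExtType rat) : Type :=
  Integers { integers_val :> K; _ : integers_val \in @algint K }.

HB.instance Definition _ (K : fieldExtType rat) :=
  [isSub for @integers_val K].
HB.instance Definition _ (K : fieldExtType rat) :=
  [Choice of integers K by <:].
HB.instance Definition _ (K : fieldExtType rat) :=
  [SubChoice_isSubComNzRing of integers K by <:].

Lemma integers_pcan (K : fieldExtType rat) :
  pcancel (fun x : integers K => v2r (val x)) (fun v => insub (r2v v)).
Proof. by move=> x; rewrite v2rK valK. Qed.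

HB.instance Definition _ (K : fieldExtType rat) :=
  PCanIsCountable (@integers_pcan K).

HB.instance Definition _ (R : comNzRingType) (I : idealr R) :=
  isPointed.Build {ideal_quot I} 0.

Section ideals.
Variable A : comNzRingType.
Local Open Scope quotient_scope.

(* Cardinalities are natural numbers; [fset_set] sends an infinite set to the
   empty one, which is harmless as the quotients of interest are finite. *)
Definition ideal_norm (I : idealr A) : nat :=
  #|` fset_set [set: {ideal_quot I}] |.

Definition residues_met (I : idealr A) (B : set A) : nat :=
  #|` fset_set [set \pi_({ideal_quot I}) a | a in B] |.

Definition ideals_coprime (I J : idealr A) : Prop :=
  forall z : A, exists x y : A, [/\ x \in I, y \in J & z = x + y].

End ideals.

(* The type [idealr] consists of ideals that do not contain 1, so properness
   is built in. *)
Record erdos_family (R : realType) (A : comNzRingType) (b : nat -> idealr A) :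
    Prop := ErdosFamily {
  erdos_nonzero : forall l, exists2 x : A, x \in b l & x != 0;
  erdos_infinite : infinite_set (range (fun l => [set` b l]));
  erdos_coprime : forall l m, l != m -> ideals_coprime (b l) (b m);
  erdos_summable :
    (\sum_(0 <= l <oo) ((ideal_norm (b l))%:R^-1 : R)%:E < +oo)%E }.

Definition borel (T : ptopologicalType) := g_sigma_algebraType (@open T).

Definition discrete_product (I : Type) (E : I -> pointedType) : Type :=
  prod_topology (fun i => discrete_topology (E i)).

HB.instance Definition _ (I : Type) (E : I -> pointedType) :=
  Topological.copy (discrete_product E)
    (prod_topology (fun i => discrete_topology (E i))).
HB.instance Definition _ (I : Type) (E : I -> pointedType) :=
  isPointed.Build (discrete_product E) (fun=> point).

Lemma open_coordinate (I : choiceType) (E : I -> pointedType) i (B : set (E i)) :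
  open [set x : discrete_product E | B (x i)].
Proof.
rewrite openE => x Bx; rewrite /interior.
apply: (@proj_continuous I (fun i => discrete_topology (E i)) i x B).
by apply: open_nbhs_nbhs; split => //; exact: discrete_open.
Qed.

Section product_law.
Variables (R : realType) (I : choiceType) (E : I -> pointedType).
Variable m : forall i, E i -> R.
Let T := borel (discrete_product E).

Definition is_product_law (P : probability T R) : Prop :=
  forall (J : {fset I}) (e : forall i, E i),
    P [set x : T | forall i, i \in J -> x i = e i] =
    (\prod_(i <- J) m (e i))%:E.

(* The law of independent coordinates, the [i]-th having mass function [m i].
   For countable [I] the cylinders form a pi-system generating the Borel sets,
   so at most one probability satisfies [is_product_law]; one exists by
   Kolmogorov's theorem when each [m i] is a mass function on a finite [E i]. *)
Definition product_law : probability T R := get is_product_law.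

End product_law.

Section entropy.
Variables (R : realType) (A : zmodType).

Definition log2 (x : R) : R := ln x / ln 2.

Definition folner (F : nat -> {fset A}) : Prop :=
  (forall n, F n != fset0) /\
  forall a : A,
    let Fa n := [fset (a + c)%R | c in F n]%fset in
    (#|` (Fa n `\` F n) `|` (F n `\` Fa n) |%fset%:R / #|` F n|%:R : R)
      @[n --> \oo] --> (0 : R).

(* The common limit of [u] along all Folner sequences. For the two averages
   below it exists by the Ornstein-Weiss lemma. *)
Definition folner_lim (u : {fset A} -> R) : R :=
  get [set l : R | forall F, folner F -> u (F n) @[n --> \oo] --> l].

Section topological.
Variables (T : ptopologicalType) (S : A -> T -> T) (X : set T).

Definition open_cover k (U : 'I_k -> set T) : Prop :=
  (forall i, open (U i)) /\ X `<=` \bigcup_i U i.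

Definition cover_join k (U : 'I_k -> set T) (F : {fset A}) : set (set T) :=
  [set \bigcap_(a in [set` F]) (S a @^-1` U (p a)) | p in [set: A -> 'I_k]].

(* Minimal cardinality of a finite subfamily of [C] that covers [X]. *)
Definition cover_number (C : set (set T)) : R :=
  inf [set (#|` D|%:R : R) | D in [set D : {fset set T} |
    [set` D] `<=` C /\ X `<=` \bigcup_(V in [set` D]) V]].

(* Entropy of the restriction of the action to an invariant compact set [X];
   the relatively open covers of [X] are the traces of the families used. *)
Definition topological_entropy : \bar R :=
  ereal_sup [set h : \bar R | exists k, exists2 U : 'I_k -> set T,
    open_cover U &
    h = (folner_lim (fun F =>
           log2 (cover_number (cover_join U F)) / #|` F|%:R))%:E].

End topological.

Section measure_theoretic.
Variables (d : measure_display) (T : measurableType d) (S : A -> T -> T).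
Variable mu : probability T R.

(* A finite measurable partition is given by its labelling [xi], whose fibres
   are the (possibly empty) atoms. *)
Definition measurable_labelling k (xi : T -> 'I_k) : Prop :=
  forall i, measurable (xi @^-1` [set i]).

Definition join_entropy k (xi : T -> 'I_k) (F : {fset A}) : R :=
  - \sum_(p : {ffun F -> 'I_k})
      let q := fine (mu [set x | forall a : F, xi (S (val a) x) = p a]) in
      q * log2 q.

Definition ks_entropy : \bar R :=
  ereal_sup [set h : \bar R | exists k, exists2 xi : T -> 'I_k,
    measurable_labelling xi &
    h = (folner_lim (fun F => join_entropy xi F / #|` F|%:R))%:E].

Definition invariant_measure : Prop :=
  forall (a : A) (B : set T), measurable B -> mu (S a @^-1` B) = mu B.

End measure_theoretic.

(* Borel probabilities on [X] are those on the ambient space that give [X]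
   full mass. *)
Definition maximal_entropy (T : ptopologicalType) (S : A -> T -> T) (X : set T)
    (mu : probability (borel T) R) : Prop :=
  [/\ mu X = 1%E, invariant_measure (S : A -> borel T -> borel T) mu &
      ks_entropy (S : A -> borel T -> borel T) mu = topological_entropy S X].

End entropy.

Definition mutually_singular (R : realType) d (T : measurableType d)
    (mu nu : set T -> \bar R) : Prop :=
  exists B : set T, [/\ measurable B, mu B = 0%E & nu (~` B) = 0%E].

Section free_subshift.
Variables (R : realType) (K : fieldExtType rat).
Variable b : nat -> idealr (integers K).
Local Notation O := (integers K).
Local Open Scope quotient_scope.

Definition config : ptopologicalType := discrete_product (fun _ : O => bool).

Definition config_shift (a : O) (x : config) : config := fun c => x (a + c).

Definition config_supp (x : config) : set O := [set a | x a].

Definition free_shift : set config :=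
  [set x | forall l, (residues_met (b l) (config_supp x) < ideal_norm (b l))%N].

Definition phases : ptopologicalType :=
  discrete_product (fun l => {ideal_quot (b l)} : pointedType).

Definition phi (g : borel phases) : borel config :=
  fun a => `[< forall l,
    (g l : {ideal_quot (b l)}) + \pi_({ideal_quot (b l)}) a != 0 >].

Definition allowed (g : phases) : set O := config_supp (phi g).

Definition Phi (gw : borel phases * borel config) : borel config :=
  fun a => phi gw.1 a && gw.2 a.

Lemma open_cylinder (U : set config) (x : config) : open U -> U x ->
  exists J : {fset O}, forall y : config,
    (forall a, a \in J -> y a = x a) -> U y.
Proof.
move=> oU Ux.
pose F : set_system config := [set V | exists J : {fset O},
  forall y : config, (forall a, a \in J -> y a = x a) -> V y].
have FF : Filter F.
  split.
  - by exists fset0.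
  - move=> V W [J JV] [L LW]; exists (J `|` L)%fset => y yx; split.
      by apply: JV => a aJ; apply: yx; rewrite in_fsetU aJ.
    by apply: LW => a aL; apply: yx; rewrite in_fsetU aL orbT.
  - by move=> V W VW [J JV]; exists J => y /JV/VW.
suff cF : F --> x by apply: cF; exact: open_nbhs_nbhs.
apply/cvg_sup => a V; rewrite nbhsE => -[W [[B oB <-] Bx] BV].
exists [fset a]%fset => y yx; apply: BV => /=.
by rewrite yx ?inE.
Qed.

Lemma measurable_config d (T : measurableType d) (f : T -> borel config) :
  (forall a, measurable [set t | f t a]) -> measurable_fun setT f.
Proof.
move=> mf; apply: (@measurability _ _ T (borel config) setT f (@open config)) => //.
move=> _ [U oU <-]; rewrite setTI.
pose cyl (JD : {fset O} * {fset O}) :=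
  [set x : config | forall a, a \in JD.1 -> x a = (a \in JD.2)].
rewrite (_ : U = \bigcup_(JD in [set JD | cyl JD `<=` U]) cyl JD); last first.
  apply/seteqP; split=> [x Ux|x [JD JDU]]; last exact: JDU.
  have [J JU] := open_cylinder oU Ux.
  have xJ a : a \in J -> (a \in [fset c in J | x c]%fset) = x a.
    by rewrite !inE => ->.
  exists (J, [fset c in J | x c]%fset) => /=; last by move=> a /xJ.
  by move=> y yJ; apply: JU => a aJ; rewrite yJ//= xJ.
rewrite preimage_bigcup bigcup_mkcond.
apply: countable_bigcupT_measurable => [|JD]; first exact: countableP.
case: ifP => // _.
rewrite (_ : _ @^-1` _ =
  \bigcap_(a in [set` JD.1]) [set t | f t a = (a \in JD.2)]) //.
apply: fin_bigcap_measurable => // a _; case: (a \in JD.2); first exact: mf.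
rewrite (_ : [set _ | _] = ~` [set t | f t a]); first exact: measurableC.
by apply/seteqP; split=> t /=; [move=> ->|move/negP/negbTE].
Qed.

Lemma measurable_phase l (B : set {ideal_quot (b l)}) :
  measurable [set g : borel phases | B (g l)].
Proof. by apply: sub_sigma_algebra; exact: open_coordinate. Qed.

Lemma measurable_coin a : measurable [set w : borel config | w a].
Proof.
by apply: sub_sigma_algebra; exact: (open_coordinate [set v : bool | v]).
Qed.

Lemma measurable_phi : measurable_fun setT phi.
Proof.
apply: measurable_config => a.
pose B l := [set r : {ideal_quot (b l)} | r + \pi_({ideal_quot (b l)}) a != 0].
rewrite (_ : [set _ | _] =
    \bigcap_(l in [set: nat]) [set g : borel phases | B l (g l)]); last first.
  by apply/seteqP; split=> [g /asboolP gB l _|g gB]; [exact: gB|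
    apply/asboolP => l; exact: gB].
by apply: bigcap_measurableType => l _; exact: measurable_phase.
Qed.

Lemma measurable_Phi : measurable_fun setT Phi.
Proof.
apply: measurable_config => a.
rewrite (_ : [set _ | _] = [set g : borel phases | phi g a] `*`
    [set w : borel config | w a]); last first.
  by apply/seteqP; split=> [gw /andP[]|gw [/= ? ?]] //; apply/andP.
apply: measurableX; last exact: measurable_coin.
by have := measurable_phi measurableT (measurable_coin a); rewrite setTI.
Qed.

HB.instance Definition _ := @isMeasurableFun.Build _ _
  (borel phases) (borel config) phi measurable_phi.

HB.instance Definition _ := @isMeasurableFun.Build _ _
  (borel phases * borel config)%type (borel config) Phi measurable_Phi.

(* The Haar measure of the compact group of phases is the product of the
   normalised counting measures of the residue rings. *)
Definition haar : probability (borel phases) R :=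
  product_law (fun l _ => (ideal_norm (b l))%:R^-1).

Definition coins : probability (borel config) R :=
  product_law (fun _ _ => 2^-1).

Definition mirsky : probability (borel config) R :=
  distribution haar phi.

Definition kappa : probability (borel config) R :=
  distribution (haar \x coins)%E Phi.

(* Independent fair coins on the allowed positions, zeros elsewhere. *)
Definition kappa_phase (g : phases) : probability (borel config) R :=
  product_law (fun a (v : bool) =>
    if a \in allowed g then 2^-1 else (~~ v)%:R).

End free_subshift.

Arguments kappa_phase R {K} b g.

(* Main.v *)
(* For each L, the Chinese remainder theorem places the support of every point of the
   subshift inside a translate of the set V_L of integers avoiding b_0, ..., b_(L-1), and
   finitely many translates suffice.  On a Følner set F all these translates have density
   close to D_L, the L-th partial product of the density d.  Fix a finite set W.  Weight
   the 0-1 patterns below a translate of V_L by exp (theta * N_W), N_W counting the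
   occurrences of the all-ones pattern on W in F.  A bounded-difference estimate of the
   sum of the weights, followed by Gibbs' inequality, gives for every invariant measure
   nu on the subshift
     h_nu ln 2 + theta * nu(1 on W) <= d ln 2 + theta * kappa(1 on W) + O(theta^2).
   At theta = 0 this is h_nu <= d.  If h_nu = d, then letting theta tend to 0 from both
   sides gives nu(1 on W) = kappa(1 on W) for every W, and these numbers determine nu.
   The lower bound h_kappa >= d holds because kappa is a mixture over the phases of fair
   coins on the allowed positions.  Finally, under the Mirsky measure the frequency of
   ones on large Følner sets concentrates at d and under kappa at d / 2, by Chebyshev. *)
From HB Require Import structures.
Require Import Defs.
From mathcomp Require Import all_boot all_order all_algebra all_field.
From mathcomp Require Import ring_quotient finmap ring lra.
From mathcomp Require Import all_classical all_reals all_analysis measurable_realfun.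

Set Implicit Arguments.
Unset Strict Implicit.
Unset Printing Implicit Defensive.

Import Order.TTheory GRing.Theory Num.Theory.
Import numFieldNormedType.Exports.
Local Open Scope classical_set_scope.
Local Open Scope ring_scope.

(** * Residues modulo ideals *)

(** The weighted count is a pressure estimate. With [theta * N_W] as potential, the upper bound for
    the pressure has slope kappa(1 on W) at theta = 0, and a measure of maximal entropy is a tangent
    functional there, so it must have this slope. Two features of the definitions shape the rest.
    First, entropies are suprema of [folner_lim], a common limit over all Følner sequences that
    falls back to 0. An upper bound c >= 0 therefore needs one Følner sequence, whereas attaining
    the supremum needs a labelling or cover whose averages converge along all of them. The
    coordinate at 0 serves for both: it is squeezed between a lower bound exact on every finite F
    and the general upper bound. Positivity of d, which comes from the summability of 1/N, separates
    values near d from the fallback 0. Second, [haar], [coins] and [kappa_phase] are chosen by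
    [get], so a measure with each law has to be constructed before anything is known about them, and
    [ideal_norm] is meaningful only once the residue rings are known to be finite. *)

Section integer_ring.
Variable K : fieldExtType rat.
Local Notation O := (integers K).

Lemma val_intr (c : int) : val (c%:~R : O) = c%:~R :> K.
Proof. exact: (rmorph_int (val : {rmorphism O -> K}) c). Qed.

Lemma valM (u v : O) : val (u * v) = val u * val v :> K.
Proof. exact: (rmorphM (val : {rmorphism O -> K})). Qed.

Lemma integer_dependence n (x : 'I_n -> O) : (\dim {:K} < n)%N ->
  exists2 c : 'I_n -> int, (exists i, c i != 0) & \sum_i (c i)%:~R * x i = 0.
Proof.
move=> dn; pose X := [tuple val (x i) | i < n].
have nfX : ~~ free X.
  rewrite /free size_tuple neq_ltn; apply/orP; left.
  by apply: leq_ltn_trans dn; exact/dimvS/subvf.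
have [k k0 [i ki]] : exists2 k : 'I_n -> rat,
    \sum_i k i *: X`_i = 0 & exists i, k i != 0.
  apply: contrapT => H; move/negP: nfX; apply; apply/freeP => k k0 i.
  by apply: contrapT => /eqP ki; apply: H; exists k => //; exists i.
(* Clearing denominators: scaling [k] by the product of all [denq (k j)] gives the integers
   [numq (k j) * D j], since the factor [denq (k j)] cancels. *)
pose D i := \prod_(j | j != i) denq (k j).
have Dn i' : D i' != 0 by apply/prodf_neq0 => j _; exact: denq_neq0.
have cE j : (numq (k j) * D j)%:~R = (\prod_j denq (k j))%:~R * k j :> rat.
  by rewrite (bigD1 j)//= !intrM numqE; rewrite -/(D j); ring.
exists (fun j => numq (k j) * D j).
  by exists i; rewrite mulf_neq0 ?numq_eq0.
apply: val_inj; rewrite raddf_sum.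
transitivity ((\prod_j denq (k j))%:~R *: \sum_j k j *: X`_j); last first.
  by rewrite k0 scaler0 rmorph0.
rewrite scaler_sumr; apply: eq_bigr => j _.
rewrite scalerA -cE (nth_map j) ?size_enum_ord// nth_ord_enum.
by rewrite [LHS]valM val_intr scaler_int mulrzl.
Qed.

(** Descent on the sum of the absolute values: while [p] divides every coefficient, divide them all
    by [p]. The relation survives because [p] is nonzero in [K]. *)
Lemma primitive_dependence p n (x : 'I_n -> O) : prime p -> (\dim {:K} < n)%N ->
  exists2 c : 'I_n -> int, (exists i, ~~ (p %| c i)%Z) &
    \sum_i (c i)%:~R * x i = 0.
Proof.
move=> pp /(integer_dependence x)[c].
have [m] := ubnP (\sum_i `|c i|)%N.
elim: m c => // m IH c; rewrite ltnS => cm [i ci] c0.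
have [[j pj]|pall] := pselect (exists j, ~~ (p %| c j)%Z); first by exists c => //; exists j.
have pc j : (p %| c j)%Z by apply: contrapT => /negP pj; apply: pall; exists j.
have p0 : p%:Z != 0 by rewrite eqz_nat -lt0n prime_gt0.
pose c' j := (c j %/ p)%Z.
have cE j : c j = c' j * p by rewrite divzK.
apply: (IH c').
- apply: leq_trans cm; rewrite (bigD1 i)//= [ltnRHS](bigD1 i)//= -addSn.
  apply: leq_add.
    have : c' i != 0 by apply: contraNneq ci; rewrite cE => ->; rewrite mul0r.
    rewrite [in leqRHS]cE abszM -absz_gt0 => h.
    by rewrite -[ltnLHS]muln1 ltn_pmul2l// prime_gt1.
  by apply: leq_sum => j _; rewrite [in leqRHS]cE abszM leq_pmulr// prime_gt0.
- by exists i; apply: contraNneq ci; rewrite cE => ->; rewrite mul0r.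
- have : (p%:R : O) * (\sum_j (c' j)%:~R * x j) = 0.
    rewrite mulr_sumr -[RHS]c0; apply: eq_bigr => j _.
    by rewrite [in RHS]cE intrM -pmulrn; ring.
  move=> /(congr1 val); rewrite valM => /eqP.
  rewrite [X in _ == X]rmorph0 mulf_eq0 => /orP[|/eqP h]; last first.
    by apply: val_inj; rewrite h rmorph0.
  have -> : val (p%:R : O) = p%:R :> K.
    exact: (rmorph_nat (val : {rmorphism O -> K})).
  rewrite -(rmorph_nat (in_alg K)) fmorph_eq0 pnatr_eq0 => /eqP p00.
  by rewrite p00 in pp.
Qed.

(* No integral basis is needed: a family independent modulo p has at most dim K
   members, and a maximal one spans modulo p. *)
Lemma integers_mod_prime p : prime p ->
  exists s : seq O, forall z : O, exists2 r, r \in s & exists y, z = r + p%:R * y.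
Proof.
move=> pp.
pose ind k := `[< exists x : 'I_k -> O, forall (c : 'I_k -> int) (y : O),
  \sum_i (c i)%:~R * x i = p%:R * y -> forall i, (p %| c i)%Z >].
have ind0 : exists k, ind k by exists 0%N; apply/asboolP; exists (fun=> 0) => c y _ [].
have indM k : ind k -> (k <= \dim {:K})%N.
  move=> /asboolP[x xP]; rewrite leqNgt; apply/negP => /(primitive_dependence x pp).
  by case=> c [i /negP ci] c0; apply/ci/(xP c 0); rewrite c0 mulr0.
case: (ex_maxnP ind0 indM) => k /asboolP[x xP] kmax.
exists [seq \sum_i (f i)%:R * x i | f : {ffun 'I_k -> 'I_p}] => z.
pose x' (i : 'I_k.+1) := if unlift ord0 i is Some j then x j else z.
have sumE (c : 'I_k.+1 -> int) : \sum_i (c i)%:~R * x' i =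
    (c ord0)%:~R * z + \sum_i (c (lift ord0 i))%:~R * x i.
  rewrite big_ord_recl {1}/x' unlift_none; congr (_ + _).
  by apply: eq_bigr => i _; rewrite /x' liftK.
have [c [y [cy [i ci]]]] : exists c y, \sum_i (c i)%:~R * x' i = p%:R * y /\
    exists i, ~~ (p %| c i)%Z.
  apply: contrapT => H; suff /kmax : ind k.+1 by rewrite ltnn.
  apply/asboolP; exists x' => c y cy i; apply: contrapT => /negP ci.
  by apply: H; exists c, y; split => //; exists i.
have pN0 : p%:Z != 0 by rewrite eqz_nat -lt0n prime_gt0.
(* The coefficient of [z] is prime to [p] because the [x i] are independent modulo [p]; a Bezout
   relation then solves for [z] modulo [p]. *)
have pc0 : ~~ (p %| c ord0)%Z.
  apply/negP => /dvdzP[e ce]; move/negP: ci; apply.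
  case: (unliftP ord0 i) => [j|] ->; last by rewrite ce dvdz_mull.
  apply: (xP (fun j => c (lift ord0 j)) (y - e%:~R * z)).
  rewrite mulrBr -cy sumE ce intrM -pmulrn.
  by rewrite [_ * p%:R]mulrC mulrA addrAC subrr add0r.
have cop : coprimez (c ord0) p.
  by rewrite coprimezE coprime_sym prime_coprime.
have [[u v] /= uv] := coprimezP _ _ cop.
pose q i := ((- u * c (lift ord0 i)) %/ p)%Z.
pose r i := ((- u * c (lift ord0 i)) %% p)%Z.
have r0 i' : 0 <= r i' by rewrite modz_ge0.
have rp i' : (`|r i'| < p)%N by rewrite -ltz_nat gez0_abs// ltz_mod.
exists (\sum_i `|r i|%N%:R * x i).
  apply/mapP; exists [ffun i => Ordinal (rp i)]; rewrite ?mem_enum//.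
  by apply: eq_bigr => j _; rewrite ffunE.
exists (u%:~R * y + v%:~R * z + \sum_i (q i)%:~R * x i).
transitivity ((u * c ord0 + v * p)%:~R * z); first by rewrite uv mul1r.
have qr j : (`|r j|%N%:R : O) = (- u * c (lift ord0 j))%:~R - (q j)%:~R * p%:R.
  by rewrite pmulrn gez0_abs// /r /modz intrB intrM -pmulrn.
have -> : \sum_i `|r i|%N%:R * x i =
    - u%:~R * (p%:R * y - (c ord0)%:~R * z) - p%:R * \sum_i (q i)%:~R * x i.
  rewrite -cy sumE addrAC subrr add0r !mulr_sumr -sumrB; apply: eq_bigr => j _.
  by rewrite qr intrM rmorphN/=; ring.
by rewrite intrD !intrM -pmulrn; ring.
Qed.

(** Peel off one prime factor: write z = r + p y, then reduce y modulo n / p. *)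
Lemma integers_mod_finite n : (0 < n)%N ->
  exists s : seq O, forall z : O, exists2 r, r \in s & exists y, z = r + n%:R * y.
Proof.
elim/ltn_ind: n => n IH n0.
have [n1|n1] := leqP n 1.
  have -> : n = 1%N by apply/eqP; rewrite eqn_leq n1.
  exists [:: 0] => z; exists 0; rewrite ?inE//; exists z.
  by rewrite mul1r add0r.
have pp := pdiv_prime n1; have pn := pdiv_dvd n.
have m0 : (0 < n %/ pdiv n)%N by rewrite divn_gt0 ?pdiv_gt0// dvdn_leq.
have [|//|s sP] := IH (n %/ pdiv n)%N; first by rewrite ltn_Pdiv// prime_gt1.
have [s' s'P] := integers_mod_prime pp.
exists [seq r + (pdiv n)%:R * r' | r <- s', r' <- s] => z.
have [r rs [y zE]] := s'P z; have [r' r's [y' yE]] := sP y.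
exists (r + (pdiv n)%:R * r'); first by apply/allpairsP; exists (r, r').
exists y'; rewrite zE yE -[in n%:R](divnK pn) natrM; ring.
Qed.

(** The constant term of a monic integer equation for [x] is a multiple of [x], hence in [I]. If it
    vanishes, the equation is divided by ['X], which is legitimate because [x] is a nonzero element
    of a field. *)
Lemma nat_in_ideal (I : idealr O) x : x \in I -> x != 0 ->
  exists2 n, (0 < n)%N & n%:R \in I.
Proof.
move=> xI x0.
have /asboolP[p pmon] := valP x.
have [m] := ubnP (size p); elim: m p pmon => // m IH p pmon; rewrite ltnS => pm px.
have [p0|p0] := eqVneq p`_0 0.
  have /factor_theorem[q pE] : root p 0 by rewrite /root horner_coef0 p0.
  rewrite subr0 in pE.
  have qmon : q \is monic by move: pmon; rewrite pE monicMr ?monicX.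
  apply: (IH q) => //.
    by apply: leq_trans pm; rewrite pE size_mulX ?monic_neq0.
  move: px; rewrite pE rmorphM/= map_polyX /root hornerMX mulf_eq0 => /orP[//|].
  by move=> /eqP h; case/eqP: x0; apply: val_inj; rewrite rmorph0; exact: h.
exists `|(p`_0)%R|%N; first by rewrite absz_gt0.
suff h : (p`_0)%:~R \in I.
  by rewrite pmulrn abszE; case: ger0P => _ //; rewrite rmorphN/= rpredN.
have pE : p = (p`_0)%:P + (\poly_(i < size p) p`_i.+1) * 'X.
  apply/polyP => -[|i]; rewrite coefD coefC coefMX/=; first by rewrite addr0.
  rewrite add0r coef_poly; case: ltnP => // h.
  by rewrite nth_default// ltnW.
move: pE; set q := \poly_(_ < _) _ => pE.
have qx : map_poly (intr : int -> O) p = (p`_0)%:~R%:P + map_poly intr q * 'X.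
  by rewrite [in LHS]pE rmorphD rmorphM/= map_polyX map_polyC.
have : (map_poly (intr : int -> O) p).[x] = 0.
  apply: val_inj; rewrite -(horner_map (val : {rmorphism O -> K})) -map_poly_comp.
  rewrite rmorph0 -[RHS](eqP px); congr (_.[_]); apply: eq_map_poly => c.
  exact: val_intr.
rewrite qx hornerD hornerC hornerMX => /eqP; rewrite addr_eq0 => /eqP ->.
by rewrite rpredN idealMr.
Qed.

Local Open Scope quotient_scope.

Lemma ideal_quot_eq (I : idealr O) (x y : O) :
  (\pi_({ideal_quot I}) x == \pi_({ideal_quot I}) y) = (x - y \in I).
Proof. by rewrite Quotient.idealrBE. Qed.

Lemma finite_quotient (I : idealr O) : (exists2 x : O, x \in I & x != 0) ->
  finite_set [set: {ideal_quot I}].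
Proof.
case=> x xI x0; have [n n0 nI] := nat_in_ideal xI x0.
have [s sP] := integers_mod_finite n0.
apply: (@sub_finite_set _ _ [set \pi_({ideal_quot I}) r | r in [set` s]]).
  move=> z _; have [r rs [y zE]] := sP (repr z); exists r => //.
  rewrite -[RHS]reprK; apply/eqP; rewrite ideal_quot_eq zE opprD addrA subrr add0r.
  by rewrite rpredN mulrC idealMr.
exact/finite_image/finite_seq.
Qed.

End integer_ring.

(** * The Chinese remainder theorem *)

Section chinese_remainder.
Variables (A : comNzRingType) (b : nat -> idealr A).
Hypothesis cop : forall l m, l != m -> ideals_coprime (b l) (b m).
Local Open Scope quotient_scope.

(** [e] is a product of elements of the [b m] congruent to 1 modulo [b L], one for each m < L. *)
Lemma crt_idempotent L :
  exists e : A, (forall m, (m < L)%N -> e \in b m) /\ e - 1 \in b L.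
Proof.
suff: forall k, (k <= L)%N ->
    exists e : A, (forall m, (m < k)%N -> e \in b m) /\ e - 1 \in b L.
  exact.
elim=> [_|k IH kL]; first by exists 1; split => //; rewrite subrr rpred0.
have [e [eb eL]] := IH (ltnW kL).
have [x [y [xk yL xy]]] := cop (negbT (ltn_eqF kL)) 1.
exists (e * x); split=> [m|].
  by rewrite ltnS leq_eqVlt => /orP[/eqP ->|/eb ?]; [rewrite idealMr|rewrite mulrC idealMr].
have -> : e * x - 1 = x * (e - 1) - y by rewrite [in LHS]xy; ring.
by rewrite rpredB// idealMr.
Qed.

Hypothesis fin : forall l, finite_set [set: {ideal_quot (b l)}].

Lemma ideal_reps l : exists s : seq A, forall z, exists2 r, r \in s & r - z \in b l.
Proof.
exists [seq repr r | r <- fset_set [set: {ideal_quot (b l)}]] => z.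
exists (repr (\pi_({ideal_quot (b l)}) z)).
  by apply/mapP; exists (\pi z) => //; rewrite in_fset_set; [rewrite in_setT|exact: fin].
by rewrite Quotient.idealrBE reprK.
Qed.

(** The finite set is fixed before the residues: a multiple of the idempotent [e] corrects [t]
    modulo [b L] without touching the earlier residues. *)
Lemma phase_reps L : exists s : {fset A}, forall r : nat -> A,
  exists2 t, t \in s & forall l, (l < L)%N -> t - r l \in b l.
Proof.
elim: L => [|L [s sP]]; first by exists [fset 0]%fset => r; exists 0; rewrite ?inE.
have [e [eb eL]] := crt_idempotent L; have [s' s'P] := ideal_reps L.
exists [fset (t + e * r)%R | t in s, r in [fset r in s']]%fset => r.
have [t ts tr] := sP r; have [u us' ur] := s'P (r L - t).
exists (t + e * u); first by apply/imfset2P; exists t => //; exists u => //; rewrite !inE.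
move=> l; rewrite ltnS leq_eqVlt => /orP[/eqP ->|lL].
  have -> : t + e * u - r L = u * (e - 1) + (u - (r L - t)) by ring.
  by rewrite rpredD// idealMr.
have -> : t + e * u - r l = (t - r l) + u * e by ring.
by rewrite rpredD ?tr// idealMr// eb.
Qed.

End chinese_remainder.

(** * Følner sequences *)

Section folner_sets.
Variables (R : realType) (A : zmodType).
Implicit Types (F S : {fset A}) (a : A).

Definition translate a F : {fset A} := [fset (a + c)%R | c in F]%fset.

Definition boundary a F : {fset A} :=
  (translate a F `\` F `|` F `\` translate a F)%fset.

Lemma card_translate a F : #|` translate a F| = #|` F|.
Proof. by rewrite card_imfset//=; exact: addrI. Qed.

Lemma translateP a F c : (c \in translate a F) = (c - a \in F).
Proof.
apply/imfsetP/idP => [[x /= xF ->]|cF]; first by rewrite addrAC subrr add0r.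
by exists (c - a) => //; rewrite addrC subrK.
Qed.

Lemma card_translateD a F : #|` (F `\` translate a F)%fset| = #|` (translate a F `\` F)%fset|.
Proof.
apply/eqP; rewrite -(eqn_add2l #|` (F `&` translate a F)%fset|) cardfsID.
by rewrite fsetIC cardfsID card_translate.
Qed.

Lemma card_boundary a F : #|` boundary a F| = (#|` (translate a F `\` F)%fset|).*2.
Proof.
rewrite cardfsU card_translateD addnn.
suff -> : ((translate a F `\` F) `&` (F `\` translate a F))%fset = fset0.
  by rewrite cardfs0 subn0.
by apply/fsetP => c; rewrite !inE; case: (c \in F); rewrite ?andbF.
Qed.

Lemma sum_translate a F (f : A -> R) M : (forall c, `|f c| <= M) ->
  `|\sum_(c <- F) f (a + c) - \sum_(c <- F) f c| <= M * #|` boundary a F|%:R.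
Proof.
move=> fM.
have -> : \sum_(c <- F) f (a + c) = \sum_(c <- translate a F) f c.
  by rewrite (big_imfset _ _ _)//= => x y _ _; exact: addrI.
rewrite (big_fsetID _ (mem F) (translate a F))/= (big_fsetID _ (mem (translate a F)) F)/=.
have -> : [fset x in F | x \in translate a F]%fset = [fset x in translate a F | x \in F]%fset.
  by apply/fsetP => c; rewrite !inE andbC.
rewrite opprD addrACA subrr add0r.
apply: le_trans (ler_normB _ _) _.
have bnd (B : {fset A}) : `|\sum_(c <- B) f c| <= M * #|` B|%:R.
  apply: le_trans (ler_norm_sum _ _ _) _.
  rewrite mulr_natr -sum1_size -sumrMnr.
  by rewrite [leRHS]big_seq [leLHS]big_seq; apply: ler_sum => c _; rewrite mulr1n.
apply: le_trans (lerD (bnd _) (bnd _)) _.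
rewrite -mulrDr card_boundary -addnn natrD -{2}card_translateD.
suff H (B C : {fset A}) : [fset x in B | x \notin C]%fset = (B `\` C)%fset by rewrite !H.
by apply/fsetP => c; rewrite !inE andbC.
Qed.

Fixpoint sumset S k : {fset A} :=
  if k is k'.+1 then [fset (x + s)%R | x in sumset S k', s in (0%R |` S)]%fset
  else [fset 0%R]%fset.

Lemma sumsetS S k : (sumset S k `<=` sumset S k.+1)%fset.
Proof.
apply/fsubsetP => x xS; apply/imfset2P; exists x => //.
by exists 0; rewrite ?addr0// !inE eqxx.
Qed.

Lemma translate_sumset S k a : a \in S -> (translate a (sumset S k) `<=` sumset S k.+1)%fset.
Proof.
move=> aS; apply/fsubsetP => x /imfsetP[y /= yS ->].
by rewrite addrC; apply/imfset2P; exists y => //; exists a; rewrite ?inE ?aS ?orbT.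
Qed.

(** Polynomial growth: the group being commutative, a sum of at most k elements of [S] is determined
    by the multiplicities of its terms, which lie between 0 and k. *)
Lemma card_sumset S k : (0 < #|` sumset S k| <= k.+1 ^ #|` S|)%N.
Proof.
apply/andP; split.
  elim: k => [|k IH]; first by rewrite cardfs1.
  by apply: leq_trans IH _; exact/fsubset_leq_card/sumsetS.
pose g (f : {ffun S -> 'I_k.+1}) := \sum_(s : S) val s *+ f s.
apply: leq_trans (_ : #|` [fset g f | f in {ffun S -> 'I_k.+1}]%fset| <= _)%N; last first.
  apply: leq_trans (leq_imfset_card _ _ _) _.
  by rewrite /= -cardE card_ffun card_ord cardfE.
apply: fsubset_leq_card; apply/fsubsetP => x xS.
suff [f [fk ->]] : exists f : S -> nat, (forall s, f s <= k)%N /\ x = \sum_(s : S) val s *+ f s.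
  apply/imfsetP; exists [ffun s => inord (f s)] => //=.
  by apply: eq_bigr => s _; rewrite ffunE inordK// ltnS.
elim: k x xS {g} => [x|k IH x].
  rewrite inE => /eqP ->; exists (fun=> 0%N); split => //.
  by rewrite big1// => s _; rewrite mulr0n.
move=> /imfset2P[y /= /IH[f [fk ->]]] [s]; rewrite !inE => /predU1P[->|sS] ->.
  by exists f; split => [i|]; [exact: leqW|rewrite addr0].
exists (fun i => f i + (val i == s))%N; split => [i|].
  by rewrite -addn1 leq_add// leq_b1.
under [RHS]eq_bigr do rewrite mulrnDr.
rewrite big_split/=; congr (_ + _).
rewrite (bigD1 [` sS]%fset)//= eqxx big1 ?addr0// => i.
by rewrite -val_eqE/= => /negbTE ->.
Qed.

(** Squaring Bernoulli's inequality gives (1+e)^(2j) >= (j e)^2, quadratic in j and so above 2jm+1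
    for large j. The m-th power of this is the claim for k = 2jm. *)
Lemma power_dominates m (e : R) : 0 < e -> exists k, (k.+1 ^ m)%:R < (1 + e) ^+ k.
Proof.
move=> e0.
have bern j : 1 + j%:R * e <= (1 + e) ^+ j.
  elim: j => [|j IH]; first by rewrite mul0r addr0.
  rewrite exprS; apply: le_trans (ler_wpM2l _ IH); last by rewrite addr_ge0// ltW.
  have : 0 <= j%:R * e * e by rewrite !mulr_ge0// ltW.
  rewrite -natr1; nra.
have [j j1 jP] : exists2 j, (1 <= j%:R :> R) & (2 * m).+1%:R < j%:R * (e * e).
  exists (Num.truncn (((2 * m).+1)%:R / (e * e) : R)).+1; first by rewrite ler1n.
  by rewrite -ltr_pdivrMr ?mulr_gt0// truncnS_gt.
have jm : (2 * j * m).+1%:R < (1 + e) ^+ (2 * j).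
  rewrite [X in _ ^+ X]mulnC exprM; apply: lt_le_trans (_ : (j%:R * e) ^+ 2 <= _); last first.
    rewrite lerXn2r ?nnegrE ?mulr_ge0 ?exprn_ge0 ?addr_ge0 ?(ltW e0)//.
    by apply: le_trans (bern j); rewrite lerDr.
  move: jP; rewrite -(ltr_pM2l (lt_le_trans ltr01 j1)).
  rewrite -[(2 * m).+1]addn1 -[(2 * j * m).+1]addn1 !natrD !natrM expr2; nra.
case: m jP jm => [|m] _ jm.
  by exists 1%N; rewrite expn0 expr1 ltrDl.
exists (2 * j * m.+1)%N; rewrite exprM natrX ltrXn2r// nnegrE.
Qed.

(** If every sumset grew by the factor 1 + e/2, the cardinality would be exponential in k, against
    [card_sumset]. At a k where it does not, translates by [S] stay inside the next sumset, and a
    boundary is at most twice the excess, hence the halving of [e]. *)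
Lemma almost_invariant S (e : R) : 0 < e -> exists2 F, F != fset0 &
  forall a, a \in S -> #|` boundary a F|%:R <= e * #|` F|%:R.
Proof.
move=> e0; have e20 : 0 < e / 2 by rewrite divr_gt0.
have [k kP] : exists k, #|` sumset S k.+1|%:R < (1 + e / 2) * #|` sumset S k|%:R.
  apply: contrapT => H.
  have [k] := power_dominates #|` S| e20; rewrite ltNge => /negP; apply.
  have /andP[_] := card_sumset S k; rewrite -(ler_nat R); apply: le_trans.
  elim: k => [|k IH]; first by rewrite expr0 cardfs1.
  rewrite exprS; have [//|h] := leP _ (_ : R); exfalso; apply: H; exists k.
  by apply: lt_le_trans h _; rewrite ler_wpM2l// addr_ge0// ltW.
have /andP[c0 _] := card_sumset S k.
exists (sumset S k) => [|a aS]; first by rewrite -cardfs_gt0.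
rewrite card_boundary -muln2 natrM -ler_pdivlMr//.
have : #|` (translate a (sumset S k) `\` sumset S k)%fset|%:R + #|` sumset S k|%:R <= #|`
  sumset S k.+1|%:R :> R.
  rewrite -natrD ler_nat; have := fsubset_leq_card (_ : (translate a (sumset S k) `|` sumset S
    k `<=` sumset S k.+1)%fset).
  rewrite fsubUset translate_sumset// sumsetS => /(_ isT); apply: leq_trans.
  by rewrite -(cardfsID (sumset S k) (_ `|` _)%fset) addnC leq_add//; apply: fsubset_leq_card;
    apply/fsubsetP => x; rewrite !inE; [move=> ->; rewrite orbT|move=> /andP[-> ->]].
move: kP; lra.
Qed.

(** [F n] is taken 1/(n+1)-invariant under the elements of code below n. *)
Lemma folner_exists (f : A -> nat) (g : nat -> option A) : pcancel f g ->
  exists F : nat -> {fset A}, folner R F.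
Proof.
move=> fK.
pose S n := [fset a in pmap g (iota 0 n)]%fset.
have /choice[F FP] n : exists Fn : {fset A}, Fn != fset0 /\
    forall a, a \in S n -> #|` boundary a Fn|%:R <= n.+1%:R^-1 * #|` Fn|%:R :> R.
  by have [|Fn ? ?] := @almost_invariant (S n) n.+1%:R^-1; [rewrite invr_gt0|exists Fn].
exists F; split=> [n|a]; first exact: (FP n).1.
apply: (@squeeze_cvgr _ _ _ _ (fun=> 0) (fun n => n.+1%:R^-1)).
- exists (f a).+1 => // n /= an; rewrite mulr_ge0 ?invr_ge0//=.
  have c0 : 0 < #|` F n|%:R :> R by rewrite ltr0n cardfs_gt0 (FP n).1.
  rewrite ler_pdivrMr//; apply: (FP n).2.
  by rewrite inE mem_pmap; apply/mapP; exists (f a); rewrite ?mem_iota ?fK.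
- exact: cvg_cst.
- exact: cvg_harmonic.
Qed.

End folner_sets.

(** * Weighted entropy inequalities *)

Section gibbs.
Variable R : realType.

Lemma sum_gt0_of_mass (I : Type) (s : seq I) (J w : I -> R) :
  (forall i, 0 < w i) -> \sum_(i <- s) J i = 1 -> 0 < \sum_(i <- s) w i.
Proof.
move=> w0; case: s => [|i s]; first by rewrite big_nil => /esym/eqP; rewrite oner_eq0.
by rewrite !big_cons => _; rewrite ltr_pwDl// sumr_ge0// => j _; exact/ltW.
Qed.

(** [J] stands for joint masses of a label and a pattern, [Q] for the marginal mass of the label; J
    <= Q lets the label entropy, written with [ln Q], be bounded through the joint one. The rest is
    ln x <= x - 1 at x = w / (Z J). *)
Lemma gibbs_inequality (I : Type) (s : seq I) (J Q w : I -> R) :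
  (forall i, 0 <= J i <= Q i) -> (forall i, 0 < w i) ->
  \sum_(i <- s) J i = 1 ->
  \sum_(i <- s) J i * (ln (w i) - ln (Q i)) <= ln (\sum_(i <- s) w i).
Proof.
move=> JQ w0 J1; set Z := \sum_(i <- s) w i.
have Z0 : 0 < Z := sum_gt0_of_mass w0 J1.
rewrite -subr_le0 -[ln Z]mul1r -J1 mulr_suml -sumrB.
apply: (@le_trans _ _ (\sum_(i <- s) (w i / Z - J i))); last first.
  by rewrite sumrB -mulr_suml J1 divff ?gt_eqF// subrr.
apply: ler_sum => i _; have /andP[J0 JQi] := JQ i.
move: J0; rewrite le_eqVlt => /orP[/eqP <-|J0].
  by rewrite !mul0r subrr subr0 divr_ge0// ltW.
apply: (@le_trans _ _ (J i * (ln (w i) - ln (J i) - ln Z))).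
  rewrite -mulrBr ler_wpM2l ?(ltW J0)// lerD2r lerD2l lerN2 ler_ln ?posrE//.
  exact: lt_le_trans J0 JQi.
have q0 : 0 < w i / Z / J i by rewrite !divr_gt0.
rewrite addrAC -!lnV ?posrE// -!lnM ?posrE ?mulr_gt0 ?invr_gt0//.
have -> : w i / Z - J i = J i * (w i / Z / J i - 1).
  by rewrite mulrBr mulr1 [J i * _]mulrC divfK// gt_eqF.
rewrite ler_wpM2l ?(ltW J0)//.
have := @le_ln1Dx R (w i / Z / J i - 1); rewrite [1 + _]addrC subrK; apply.
by rewrite ltrBrDl subrr.
Qed.

(** Concavity of entropy: the difference of the two sides is the [w]-mean of the relative entropies
    of [r i] with respect to [q], which are nonnegative by ln x <= x - 1. *)
Lemma mixture_entropy (I : eqType) (T : Type) (s : seq I) (t : seq T)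
    (w : I -> R) (r : I -> T -> R) (q : T -> R) :
  (forall i, 0 <= w i) -> (forall i p, 0 <= r i p) ->
  \sum_(i <- s) w i = 1 -> (forall i, \sum_(p <- t) r i p = 1) ->
  (forall p, q p = \sum_(i <- s) w i * r i p) ->
  \sum_(p <- t) q p * ln (q p) <=
    \sum_(i <- s) w i * \sum_(p <- t) r i p * ln (r i p).
Proof.
move=> w0 r0 w1 r1 qE.
have wrq i p : i \in s -> w i * r i p <= q p.
  move=> si; rewrite qE (big_rem i)//= lerDl sumr_ge0// => j _.
  by rewrite mulr_ge0.
have q1 : \sum_(p <- t) q p = 1.
  under eq_bigr do rewrite qE.
  rewrite exchange_big -[RHS]w1; apply: eq_bigr => i _.
  by rewrite -mulr_sumr r1 mulr1.
have -> : \sum_(p <- t) q p * ln (q p) =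
    \sum_(i <- s) w i * \sum_(p <- t) r i p * ln (q p).
  under [RHS]eq_bigr do rewrite mulr_sumr.
  rewrite exchange_big/=; apply: eq_bigr => p _.
  by rewrite {1}qE mulr_suml; apply: eq_bigr => i _; rewrite mulrA.
rewrite -subr_ge0 -sumrB.
have E0 : \sum_(i <- s) w i * (\sum_(p <- t) (r i p - q p)) = 0.
  by rewrite big1// => i _; rewrite sumrB q1 r1 subrr mulr0.
rewrite -[leLHS]E0 big_seq [leRHS]big_seq; apply: ler_sum => i si.
rewrite -mulrBr -sumrB !mulr_sumr; apply: ler_sum => p _.
have [->|wi0] := eqVneq (w i) 0; first by rewrite !mul0r.
rewrite ler_wpM2l// -mulrBr.
have [->|ri0] := eqVneq (r i p) 0.
  by rewrite mul0r sub0r oppr_le0; apply: le_trans (wrq i p si); rewrite mulr_ge0.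
have rp : 0 < r i p by rewrite lt_neqAle eq_sym ri0 r0.
have wp : 0 < w i by rewrite lt_neqAle eq_sym wi0 w0.
have qp : 0 < q p by apply: lt_le_trans (wrq i p si); rewrite mulr_gt0.
have -> : r i p - q p = r i p * (1 - q p / r i p).
  by rewrite mulrBr mulr1 mulrCA divff// mulr1.
rewrite ler_wpM2l// -lerN2 !opprB -ln_div ?posrE//.
have := @le_ln1Dx R (q p / r i p - 1); rewrite [1 + _]addrC subrK; apply.
by rewrite ltrBrDl subrr divr_gt0.
Qed.

(* Gibbs' inequality with weight exp (h p - g * #{a | q a <> eta p a}) on the pairs
   (q, p): penalising disagreement between a labelling and its local approximation eta
   replaces any use of conditional entropy. *)
Lemma label_entropy_bound (F : finType) k (T : Type) (s : seq T)
    (J : {ffun F -> 'I_k} -> T -> R) (eta : T -> F -> 'I_k) (h : T -> R)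
    (e g : R) :
  (forall q p, 0 <= J q p) -> \sum_q \sum_(p <- s) J q p = 1 ->
  0 <= g ->
  (forall a, \sum_q \sum_(p <- s) J q p * (q a != eta p a)%:R <= e) ->
  (forall q p, J q p <= \sum_(p <- s) J q p) ->
  - \sum_q (\sum_(p <- s) J q p) * ln (\sum_(p <- s) J q p) +
    \sum_q \sum_(p <- s) J q p * h p <=
  ln (\sum_(p <- s) expR (h p)) + #|F|%:R * (g * e + k%:R * expR (- g)).
Proof.
move=> J0 J1 g0 Je JQ; set Q := fun q => \sum_(p <- s) J q p.
have S0 : 0 < \sum_(p <- s) expR (h p).
  apply: (sum_gt0_of_mass (J := fun p => \sum_q J q p)) => [p|].
    exact: expR_gt0.
  by rewrite exchange_big.
pose n (q : {ffun F -> 'I_k}) p : R := \sum_a (q a != eta p a)%:R.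
pose w (i : {ffun F -> 'I_k} * T) := expR (h i.2 - g * n i.1 i.2).
pose st := [seq (q, p) | q <- index_enum {ffun F -> 'I_k}, p <- s].
have bigst (f : {ffun F -> 'I_k} -> T -> R) :
    \sum_(i <- st) f i.1 i.2 = \sum_q \sum_(p <- s) f q p.
  by rewrite big_allpairs.
have H : \sum_q \sum_(p <- s) J q p * (ln (w (q, p)) - ln (Q q)) <=
    ln (\sum_(i <- st) w i).
  rewrite -(bigst (fun q p => J q p * (ln (w (q, p)) - ln (Q q)))).
  under eq_bigr => i _ do rewrite -surjective_pairing.
  apply: (@gibbs_inequality _ st (fun i => J i.1 i.2) (fun i => Q i.1) w) => [i|i|].
  - by rewrite J0 JQ.
  - exact: expR_gt0.
  - by rewrite bigst.
have Jn : \sum_q \sum_(p <- s) J q p * n q p <= #|F|%:R * e.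
  under eq_bigr do under eq_bigr do rewrite /n mulr_sumr.
  under eq_bigr do rewrite exchange_big.
  rewrite exchange_big/= -sum1_card natr_sum mulr_suml; apply: ler_sum => a _.
  by rewrite mul1r.
have JE : - \sum_q Q q * ln (Q q) + \sum_q \sum_(p <- s) J q p * h p =
   \sum_q \sum_(p <- s) J q p * (ln (w (q, p)) - ln (Q q)) +
   g * \sum_q \sum_(p <- s) J q p * n q p.
  rewrite -sumrN mulr_sumr -!big_split; apply: eq_bigr => q _ /=.
  rewrite {1}/Q mulr_suml -sumrN mulr_sumr -!big_split; apply: eq_bigr => p _ /=.
  by rewrite expRK; ring.
rewrite JE; apply: (@le_trans _ _ (ln (\sum_(i <- st) w i) + g * (#|F|%:R * e))).
  by rewrite lerD// ler_wpM2l.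
rewrite mulrDr addrA addrAC [g * (_ * _)]mulrCA lerD2r.
(* The sum over labellings [q] factors over the positions in F; at each one the label agreeing with
   [eta] contributes 1 and all others together at most k expR (- g). *)
have WE : \sum_(i <- st) w i <= (\sum_(p <- s) expR (h p)) * (1 + k%:R * expR (- g)) ^+ #|F|.
  rewrite (bigst (fun q p => w (q, p))) exchange_big mulr_suml; apply: ler_sum => p _.
  under eq_bigr do rewrite /w expRD/=.
  rewrite -mulr_sumr ler_wpM2l ?expR_ge0//=.
  under eq_bigr do rewrite -mulNr mulr_sumr expR_sum.
  rewrite -(bigA_distr_bigA (fun a j => expR (- g * (j != eta p a)%:R))).
  rewrite -prodr_const; apply: ler_prod => a _; rewrite sumr_ge0/=; last first.
    by move=> j _; exact: expR_ge0.
  rewrite (bigD1 (eta p a))//= eqxx mulr0 expR0 lerD2l.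
  apply: (@le_trans _ _ (\sum_(j : 'I_k) expR (- g))); last first.
    by rewrite sumr_const card_ord mulr_natl.
  rewrite [leRHS](bigD1 (eta p a))//= -[leLHS]add0r lerD ?expR_ge0//.
  by apply: ler_sum => j ->; rewrite mulr1.
have ke : 0 <= k%:R * expR (- g) :> R by rewrite mulr_ge0// expR_ge0.
apply: le_trans (_ : ln ((\sum_(p <- s) expR (h p)) * (1 + k%:R * expR (- g)) ^+ #|F|) <= _).
  rewrite ler_ln// posrE; last by rewrite mulr_gt0// exprn_gt0// ltr_pwDl.
  apply: (sum_gt0_of_mass (J := fun i => J i.1 i.2)) => [i|].
    exact: expR_gt0.
  by rewrite bigst.
rewrite lnM ?posrE ?exprn_gt0 ?ltr_pwDl// lerD2l lnXn ?ltr_pwDl// -[_ *+ #|F|]mulr_natl.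
by rewrite ler_wpM2l// le_ln1Dx// (lt_le_trans _ ke)// ltrN10.
Qed.

Lemma powerset_sumU1 (T : choiceType) (a : T) (A : {fset T}) (F : {fset T} -> R) :
  a \notin A -> \sum_(p <- fpowerset (a |` A)%fset) F p =
  \sum_(p <- fpowerset A) (F p + F (a |` p)%fset).
Proof.
move=> aA; rewrite (big_fsetID _ (fun p : {fset T} => a \notin p))/= big_split/=.
have notin p : (p `<=` A)%fset -> a \notin p.
  by move=> /fsubsetP pA; apply: contra aA; exact: pA.
congr (_ + _).
  apply: perm_big; apply: uniq_perm; rewrite ?fset_uniq// => p; rewrite !inE/= !fpowersetE.
  apply/andP/idP => [[/fsubsetP pA ap]|pA]; last first.
    by split; [exact: fsubset_trans pA (fsubsetU1 _ _)|exact: notin].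
  apply/fsubsetP => x xp; have := pA x xp; rewrite !inE => /predU1P[xa|//].
  by rewrite -xa xp in ap.
transitivity (\sum_(p <- [fset (a |` p)%fset | p in fpowerset A]%fset) F p); last first.
  rewrite big_imfset//= => p p' /=; rewrite !fpowersetE => /notin ap /notin ap' pp'.
  by rewrite -(fsetU1K ap) pp' fsetU1K.
  apply: perm_big; apply: uniq_perm; rewrite ?fset_uniq// => p; rewrite !inE/= !fpowersetE negbK.
  apply/andP/imfsetP => [[/fsubsetP pA ap]|[p' /= p'A ->]].
    exists (p `\ a)%fset; last by rewrite fsetD1K.
    rewrite /= fpowersetE; apply/fsubsetP => x; rewrite !inE => /andP[xa /pA].
    by rewrite !inE (negbTE xa).
  by rewrite fsetUS -?fpowersetE// !inE eqxx.
Qed.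

(** Expectation for fair coins on [A]: the finite form of [kappa_phase], with [A] as allowed set. *)
Definition powerset_mean (T : choiceType) (A : {fset T}) (h : {fset T} -> R) : R :=
  (\sum_(p <- fpowerset A) h p) / 2 ^+ #|` A|.

Lemma powerset_mean_incl (T : choiceType) (A S : {fset T}) :
  powerset_mean A (fun p => (S `<=` p)%fset%:R) =
  (S `<=` A)%fset%:R / 2 ^+ #|` S|.
Proof.
rewrite /powerset_mean.
elim/fset1U_rect: A S => [|a A' aA' IH] S.
  rewrite fpowerset0 cardfs0 expr0 divr1 big_seq_fset1/= fsubset0.
  by have [->|_] := eqVneq S fset0; rewrite ?cardfs0 ?expr0 ?divr1 ?mul0r.
rewrite powerset_sumU1// cardfsU1 aA' add1n exprS.
have [aS|aS] := boolP (a \in S).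
  have SE : S = (a |` (S `\ a))%fset by rewrite fsetD1K.
  rewrite (eq_big_seq (fun p => (S `\ a `<=` p)%fset%:R)); last first.
    move=> p; rewrite fpowersetE => /fsubsetP pA'.
    have ap : a \notin p by apply: contra aA'; exact: pA'.
    have -> : (S `<=` p)%fset = false.
      by apply/negbTE/negP => /fsubsetP/(_ a aS); rewrite (negbTE ap).
    rewrite add0r; congr (_%:R); congr nat_of_bool.
    apply/fsubsetP/fsubsetP => h x xS.
      have := h x; rewrite !inE in xS *; case/andP: xS => /negbTE -> xS.
      by apply.
    by have := h x; rewrite !inE xS; case: eqVneq => //= _; apply.
  rewrite invfM [2^-1 * _]mulrC mulrA IH.
  have -> : (S `\ a `<=` A')%fset = (S `<=` a |` A')%fset.
    apply/fsubsetP/fsubsetP => h x xS.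
      by have := h x; rewrite !inE xS; case: eqVneq => //= _; apply.
    by move: xS; rewrite !inE => /andP[xa /h]; rewrite !inE (negbTE xa).
  have -> : #|` S| = #|` (S `\ a)%fset|.+1 by rewrite (cardfsD1 a) aS.
  by rewrite exprSr invfM mulrA.
rewrite (eq_big_seq (fun p => 2 * (S `<=` p)%fset%:R)); last first.
  move=> p _; have -> : (S `<=` a |` p)%fset = (S `<=` p)%fset.
    apply/fsubsetP/fsubsetP => h x xS; have := h x xS; rewrite !inE.
      by case: eqVneq => // xa; rewrite -xa xS in aS.
    by move=> ->; rewrite orbT.
  by rewrite -mulr2n mulr_natl.
rewrite -mulr_sumr invfM mulrACA divff ?pnatr_eq0// mul1r IH.
congr (_%:R / _); congr nat_of_bool.
apply/fsubsetP/fsubsetP => h x xS; have := h x xS; rewrite !inE.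
  by move=> ->; rewrite orbT.
by case: eqVneq => // xa; rewrite -xa xS in aS.
Qed.

(* The next two bounds are McDiarmid's argument: the coordinates are averaged out one
   at a time, each costing delta ^+ 2. *)
Lemma two_point_mgf (u v delta : R) : `|u - v| <= delta -> delta <= 1 ->
  expR u + expR v <= 2 * expR ((u + v) / 2 + delta ^+ 2).
Proof.
move=> uv d1; set m := (u + v) / 2; set x := (u - v) / 2.
have xd : `|x| <= delta / 2 by rewrite normrM (@ger0_norm _ 2^-1)// ler_pM2r.
have uE : u = m + x by rewrite /x /m; lra.
have vE : v = m - x by rewrite /x /m; lra.
have xx : x ^+ 2 <= delta ^+ 2 / 4.
  have -> : delta ^+ 2 / 4 = (delta / 2) ^+ 2 by rewrite expr_div_n; congr (_ / _); lra.
  by rewrite -(real_normK (num_real x)) lerXn2r// nnegrE; apply: le_trans xd.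
have d0 : 0 <= delta by apply: le_trans uv.
have x12 : `|x| <= 2^-1 by apply: le_trans xd _; rewrite ler_pdivrMr//; lra.
have [xl xu] : - 2^-1 <= x /\ x <= 2^-1 by move: x12; rewrite ler_norml => /andP.
(* 1 - y <= expR (- y) gives expR y <= 1 / (1 - y), which is at most 1 + y + 2 y^2 for |y| <= 1/2.
   The linear terms of x and - x then cancel. *)
have bnd (y : R) : - 2^-1 <= y -> y <= 2^-1 -> expR y <= 1 + y + 2 * y ^+ 2.
  move=> yl yu; rewrite -[y in expR y]opprK expRN.
  have h : 0 < 1 - y by lra.
  apply: (@le_trans _ _ (1 - y)^-1); last by rewrite -div1r ler_pdivrMr// expr2; nra.
  by rewrite lef_pV2 ?posrE ?expR_gt0// expR_ge1Dx.
rewrite {1}uE {1}vE !expRD -mulrDr mulrCA ler_wpM2l ?expR_ge0//.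
apply: le_trans (_ : 2 * (1 + delta ^+ 2) <= _); last by rewrite ler_wpM2l// expR_ge1Dx.
have h1 := bnd _ xl xu; have h2 : expR (- x) <= 1 - x + 2 * x ^+ 2.
  by have := bnd (- x); rewrite sqrrN; apply; lra.
by have := sqr_ge0 delta; lra.
Qed.

Lemma powerset_mgf (T : choiceType) (A : {fset T}) (h : {fset T} -> R) delta :
  delta <= 1 -> (forall a p, `|h p - h (a |` p)%fset| <= delta) ->
  \sum_(p <- fpowerset A) expR (h p) <=
  2 ^+ #|` A| * expR (powerset_mean A h + #|` A|%:R * delta ^+ 2).
Proof.
move=> d1; elim/fset1U_rect: A h => [|a A' aA' IH] h hd.
  rewrite /powerset_mean fpowerset0 cardfs0 expr0 divr1 !big_seq_fset1/= mul0r addr0 mul1r.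
  exact: lexx.
pose m p := (h p + h (a |` p)%fset) / 2.
have md b p : `|m p - m (b |` p)%fset| <= delta.
  rewrite /m fsetUCA -mulrBl opprD addrACA normrM (@ger0_norm _ 2^-1)//.
  rewrite ler_pdivrMr// mulr_natr mulr2n; apply: le_trans (ler_normD _ _) _.
  exact: lerD.
rewrite powerset_sumU1// cardfsU1 aA' add1n.
apply: le_trans (_ : \sum_(p <- fpowerset A') 2 * (expR (delta ^+ 2) * expR (m p)) <= _).
  apply: ler_sum => p _; rewrite -expRD [delta ^+ 2 + _]addrC.
  by apply: (@two_point_mgf (h p) (h (a |` p)%fset) delta).
rewrite -!mulr_sumr [2 ^+ _.+1]exprS -mulrA ler_wpM2l//.
apply: le_trans (ler_wpM2l _ (IH _ md)) _; first exact: expR_ge0.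
rewrite mulrCA ler_wpM2l// -expRD ler_expR -natr1 mulrDl mul1r.
suff -> : powerset_mean (a |` A')%fset h = powerset_mean A' m by lra.
rewrite /powerset_mean powerset_sumU1// cardfsU1 aA' add1n exprS /m -mulr_suml.
by rewrite invfM mulrA.
Qed.

End gibbs.

(** * Probabilities on countable products *)

Section discrete_product.
Variables (R : realType) (I : countType) (E : I -> pointedType).
Local Notation T := (discrete_product E).
Implicit Types (J : {fset I}) (x y : T).

Definition agree J x y := forall i, i \in J -> x i = y i.

Definition determined J (C : set T) := forall x y, agree J x y -> C x -> C y.

Lemma agree_sym J x y : agree J x y -> agree J y x.
Proof. by move=> xy i /xy. Qed.

Lemma agreeW J J' x y : (J `<=` J')%fset -> agree J' x y -> agree J x y.
Proof. by move=> /fsubsetP JJ' xy i /JJ' /xy. Qed.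

Lemma open_agree (U : set T) x : open U -> U x ->
  exists J, forall y, agree J x y -> U y.
Proof.
move=> oU Ux.
pose F : set_system T := [set V | exists J, forall y, agree J x y -> V y].
have FF : Filter F.
  split.
  - by exists fset0.
  - move=> V W [J JV] [L LW]; exists (J `|` L)%fset => y yx; split.
      by apply: JV => a aJ; apply: yx; rewrite in_fsetU aJ.
    by apply: LW => a aL; apply: yx; rewrite in_fsetU aL orbT.
  - by move=> V W VW [J JV]; exists J => y /JV/VW.
suff cF : F --> x by apply: cF; exact: open_nbhs_nbhs.
apply/cvg_sup => a V; rewrite nbhsE => -[W [[B oB <-] Bx] BV].
exists [fset a]%fset => y yx; apply: BV => /=.
by rewrite -yx ?inE.
Qed.

Hypothesis cE : forall i, countable [set: E i].

(** Induction on [J]: fixing the value at one coordinate [a] leaves a set determined by the others,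
    and there are countably many values to unite over. *)
Lemma determined_measurable d (S : measurableType d) (f : S -> T) J (C : set T) :
  (forall i e, measurable [set t | f t i = e]) -> determined J C ->
  measurable (f @^-1` C).
Proof.
move=> mf; elim/fset1U_rect: J C => [C dC|a J aJ IH C dC].
  have [[x Cx]|nC] := pselect (exists x, C x).
    by rewrite (_ : _ @^-1` _ = setT)//; apply/seteqP; split => // t _; exact: dC Cx.
  by rewrite (_ : _ @^-1` _ = set0)//; apply/seteqP; split => // t Ct; apply: nC; exists (f t).
rewrite (_ : _ @^-1` _ = \bigcup_(e : E a)
   ([set t | f t a = e] `&` f @^-1` [set y | C (dfwith y a e)])); last first.
  apply/seteqP; split=> t /=.
    move=> Ct; exists (f t a) => //; split => //; apply: dC Ct => i _.
    by have [<-|ai] := eqVneq a i; rewrite ?dfwithin ?dfwithout.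
  move=> [_ _ [<- /=]]; apply: dC => i _.
  by have [<-|ai] := eqVneq a i; rewrite ?dfwithin ?dfwithout.
apply: countable_bigcupT_measurable => // e; apply: measurableI; first exact: mf.
apply: IH => x y xy /=; apply: dC => i.
have [<-|ai] := eqVneq a i; first by rewrite !dfwithin.
by rewrite !dfwithout// !inE eq_sym (negbTE ai)/= => /xy.
Qed.

Lemma measurable_product d (S : measurableType d) (f : S -> borel T) :
  (forall i e, measurable [set t | f t i = e]) -> measurable_fun setT f.
Proof.
move=> mf; apply: (@measurability _ _ S (borel T) setT f (@open T)) => //.
move=> _ [U oU <-]; rewrite setTI.
pose UJ J := [set x : T | forall y, agree J x y -> U y].
rewrite (_ : U = \bigcup_J UJ J); last first.
  apply/seteqP; split=> [x Ux|x [J _]]; last exact.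
  by have [J JU] := open_agree oU Ux; exists J.
rewrite preimage_bigcup; apply: countable_bigcupT_measurable => [|J].
  exact: countableP.
apply: (determined_measurable (J := J)) => // x y xy Ux z yz.
by apply: Ux => i iJ; rewrite xy// yz.
Qed.

Lemma measurable_coordinate i (B : set (E i)) : measurable [set x : borel T | B (x i)].
Proof. by apply: sub_sigma_algebra; exact: open_coordinate. Qed.

Lemma measurable_determined J C : determined J C -> measurable (C : set (borel T)).
Proof.
move=> dC; apply: (@determined_measurable _ (borel T) id J) => // i e.
exact: (@measurable_coordinate i [set e]).
Qed.

(** Uniqueness on a pi-system. It is enough that [G] generates the events on one coordinate: the
    identity is then measurable from the sigma-algebra of [G] to the Borel sets. *)
Lemma product_measure_unique (G : set (set T)) (m1 m2 : probability (borel T) R) :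
  setI_closed G -> G setT -> (forall A, G A -> measurable (A : set (borel T))) ->
  (forall i e, <<s G >> [set x : T | x i = e]) ->
  (forall A, G A -> m1 A = m2 A) ->
  forall B, measurable B -> m1 B = m2 B.
Proof.
move=> GI GT Gm Gs m12 B mB.
have mG : @measurable _ (borel T) = <<s G >>.
  apply/seteqP; split=> [A mA|A]; last first.
    by apply: smallest_sub => //; exact: sigma_algebra_measurable.
  have := @measurable_product _ (g_sigma_algebraType G) id.
  move=> /(_ Gs measurableT A mA); rewrite setTI; exact.
apply: (@measure_unique _ R (borel T) G (fun=> setT) mG _ _ _ m1 m2) => //; last first.
  by move=> _; apply: le_lt_trans (probability_le1 m1 measurableT) (ltry 1).
by apply/seteqP; split => // x _; exists 0%N.
Qed.

Definition cylinder J x : set T := [set y | agree J y x].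

Lemma measurable_cylinder J x : measurable (cylinder J x : set (borel T)).
Proof.
apply: (measurable_determined (J := J)) => y z yz yx i iJ.
by rewrite -yz// yx.
Qed.

Lemma product_law_unique (m : forall i, E i -> R) (m1 m2 : probability (borel T) R) :
  is_product_law m m1 -> is_product_law m m2 ->
  forall B, measurable B -> m1 B = m2 B.
Proof.
move=> l1 l2.
(* [set0] is added because incompatible cylinders have empty intersection. *)
apply: (@product_measure_unique [set A | A = set0 \/ exists J x, A = cylinder J x]).
- move=> A1 A2 [->|[J [x ->]]]; first by left; rewrite set0I.
  case=> [->|[L [y ->]]]; first by left; rewrite setI0.
  have [[z [zx zy]]|] := pselect (exists z, agree J z x /\ agree L z y).
    right; exists (J `|` L)%fset, z; apply/seteqP; split=> [t [tx ty]|t tz].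
      move=> i; rewrite inE => /orP[] iJ; first by rewrite tx// -zx.
      by rewrite ty// -zy.
    split=> i iJ; rewrite tz ?inE ?iJ ?orbT//; [exact: zx|exact: zy].
  by move=> H; left; apply/seteqP; split => // z [zx zy]; apply: H; exists z.
- by right; exists fset0, point; apply/seteqP; split.
- by move=> _ [->|[J [x ->]]]; [exact: measurable0|exact: measurable_cylinder].
- move=> i e; apply: sub_sigma_algebra; right; exists [fset i]%fset, (dfwith point i e).
  apply/seteqP; split=> [x /= xi j|x /= /(_ i)]; last by rewrite inE eqxx dfwithin; exact.
  by rewrite inE => /eqP ->; rewrite dfwithin.
- by move=> _ [->|[J [x ->]]]; rewrite ?measure0// [LHS]l1 [RHS]l2.
Qed.

End discrete_product.

Section real_probability.
Context d (T : measurableType d) (R : realType) (m : probability T R).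
Implicit Types A B : set T.

Definition pr A : R := fine (m A).

Lemma prE A : measurable A -> m A = (pr A)%:E.
Proof. by move=> mA; rewrite /pr fineK// fin_num_measure. Qed.

Lemma pr_ge0 A : 0 <= pr A.
Proof. by rewrite /pr fine_ge0. Qed.

Lemma pr0 : pr set0 = 0.
Proof. by rewrite /pr measure0. Qed.

Lemma prT : pr setT = 1.
Proof. by rewrite /pr probability_setT. Qed.

Lemma le_pr A B : measurable A -> measurable B -> A `<=` B -> pr A <= pr B.
Proof. by move=> mA mB AB; rewrite -lee_fin -!prE// le_measure ?inE. Qed.

Lemma pr_le1 A : measurable A -> pr A <= 1.
Proof. by move=> mA; rewrite -prT le_pr. Qed.

Lemma prU A B : measurable A -> measurable B -> A `&` B = set0 ->
  pr (A `|` B) = pr A + pr B.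
Proof.
move=> mA mB AB; apply: EFin_inj; rewrite EFinD -!prE//; last exact: measurableU.
exact: measureU.
Qed.

Lemma prC A : measurable A -> pr (~` A) = 1 - pr A.
Proof.
move=> mA; rewrite -prT -(setvU A) prU ?setICl//; first by rewrite addrK.
exact: measurableC.
Qed.

Lemma pr_split A B : measurable A -> measurable B ->
  pr A = pr (A `&` B) + pr (A `\` B).
Proof.
move=> mA mB; rewrite -prU ?setUIDK//; [exact: measurableI|exact: measurableD|].
by apply/seteqP; split => // x [[_ ?] [_]].
Qed.

Lemma prU_le A B : measurable A -> measurable B -> pr (A `|` B) <= pr A + pr B.
Proof.
move=> mA mB; have -> : A `|` B = A `|` (B `\` A).
  by apply/seteqP; split=> x /=; have [?|?] := pselect (A x); tauto.
rewrite prU//; [|exact: measurableD|].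
  by rewrite lerD2l le_pr//; exact: measurableD.
by apply/seteqP; split => // x [? [_]].
Qed.

Lemma pr_union_le (J : eqType) (s : seq J) (A : J -> set T) :
  (forall j, measurable (A j)) ->
  pr [set x | exists2 j, j \in s & A j x] <= \sum_(j <- s) pr (A j) /\
  measurable [set x | exists2 j, j \in s & A j x].
Proof.
move=> mA; elim: s => [|j s [IH mIH]].
  rewrite big_nil (_ : [set _ | _] = set0) ?pr0//; apply/seteqP; split=> // x [j].
  by rewrite in_nil.
have -> : [set x | exists2 i, i \in j :: s & A i x] =
    A j `|` [set x | exists2 i, i \in s & A i x].
  apply/seteqP; split=> x /=; first by move=> [i]; rewrite inE => /predU1P[->|]; [left|right;
    exists i].
  by case=> [|[i si]] Ax; [exists j|exists i] => //; rewrite inE ?eqxx ?si ?orbT.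
split; last exact: measurableU.
by rewrite big_cons; apply: le_trans (prU_le _ _) _ => //; rewrite lerD2l.
Qed.

Lemma pr_partition (T2 : eqType) (Y : T -> T2) (s : seq T2) A : uniq s ->
  (forall p, measurable [set x | Y x = p]) -> measurable A ->
  (forall x, A x -> Y x \in s) ->
  pr A = \sum_(p <- s) pr (A `&` [set x | Y x = p]).
Proof.
move=> us mY; elim: s us A => [_|p s IH /= /andP[ps us]] A mA As.
  by rewrite big_nil (_ : A = set0) ?pr0//; apply/seteqP; split => // x /As.
rewrite big_cons (pr_split mA (mY p)); congr (_ + _).
rewrite (IH us); [|exact: measurableD|]; last first.
  by move=> x [/As]; rewrite inE => /predU1P[].
apply: eq_big_seq => q qs; congr pr; apply/seteqP; split=> x [].
  by move=> [].
by move=> Ax Yq; do 2!split => //; move=> Yp; rewrite -Yp Yq qs in ps.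
Qed.

Lemma pr_cvg_decr (A : nat -> set T) : (forall n, measurable (A n)) ->
  (forall n p, (n <= p)%N -> A p `<=` A n) ->
  pr (A n) @[n --> \oo] --> pr (\bigcap_n A n).
Proof.
move=> mA dA.
have mI : measurable (\bigcap_n A n) by exact: bigcap_measurableType.
apply: fine_cvg; rewrite -prE//; apply: nonincreasing_cvg_mu => //.
  by apply: le_lt_trans (probability_le1 m (mA 0%N)) (ltry 1).
by move=> n p np; apply/subsetPset; exact: dA.
Qed.

Lemma pr_cvg_incr (A : nat -> set T) : (forall n, measurable (A n)) ->
  (forall n p, (n <= p)%N -> A n `<=` A p) ->
  pr (A n) @[n --> \oo] --> pr (\bigcup_n A n).
Proof.
move=> mA dA.
have mI : measurable (\bigcup_n A n) by exact: bigcup_measurable.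
apply: fine_cvg; rewrite -prE//; apply: nondecreasing_cvg_mu => //.
by move=> n p np; apply/subsetPset; exact: dA.
Qed.

End real_probability.

(** * Approximation by sets that depend on finitely many coordinates *)

Section approximation.
Variables (R : realType) (I : countType) (E : I -> pointedType).
Hypothesis cE : forall i, countable [set: E i].
Local Notation T := (discrete_product E).
Variable m : probability (borel T) R.

Definition symdiff (A C : set T) : set (borel T) := (A `\` C) `|` (C `\` A).

Lemma measurable_symdiff J A C : measurable (A : set (borel T)) -> determined J C ->
  measurable (symdiff A C).
Proof.
by move=> mA dC; apply: measurableU; apply: measurableD => //; exact: measurable_determined dC.
Qed.

Definition approximable (A : set (borel T)) := measurable A /\
  forall e, 0 < e -> exists J C, determined J C /\ pr m (symdiff A C) <= e.

Lemma determinedW (J J' : {fset I}) (C : set T) : (J `<=` J')%fset -> determined J C ->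
  determined J' C.
Proof. by move=> JJ' dC x y /(agreeW JJ'); exact: dC. Qed.

Lemma determined_approximable J C : determined J C -> approximable C.
Proof.
move=> dC; split; first exact: measurable_determined dC.
move=> e e0; exists J, C; split=> //.
by rewrite /symdiff setDv setU0 pr0 ltW.
Qed.

Lemma approximableU A B : approximable A -> approximable B -> approximable (A `|` B).
Proof.
move=> [mA aA] [mB aB]; split; first exact: measurableU.
move=> e e0; have e2 : 0 < e / 2 by rewrite divr_gt0.
have [J [C [dC AC]]] := aA _ e2; have [L [D [dD BD]]] := aB _ e2.
have dCD : determined (J `|` L)%fset (C `|` D).
  move=> x y xy [Cx|Dx]; [left; apply: dC Cx|right; apply: dD Dx].
    by apply: agreeW xy; exact: fsubsetUl.
  by apply: agreeW xy; exact: fsubsetUr.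
exists (J `|` L)%fset, (C `|` D); split => //.
have mS1 := measurable_symdiff mA dC; have mS2 := measurable_symdiff mB dD.
apply: (@le_trans _ _ (pr m (symdiff A C `|` symdiff B D))).
  apply: le_pr; [|exact: measurableU|].
    by apply: measurable_symdiff dCD; exact: measurableU.
  move=> x; rewrite /symdiff/= => -[[[Ax|Bx] /not_orP[nC nD]]|[[Cx|Dx] /not_orP[nA nB]]]; tauto.
by apply: le_trans (prU_le _ mS1 mS2) _; rewrite [leRHS]splitr lerD.
Qed.

Lemma approximable_bigcup (A : nat -> set (borel T)) :
  (forall n, approximable (A n)) -> approximable (\bigcup_n A n).
Proof.
move=> aA; have mA n := (aA n).1.
have mU : measurable (\bigcup_n A n) by exact: bigcup_measurable.
split => // e e0; have e2 : 0 < e / 2 by rewrite divr_gt0.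
pose B n := \bigcup_(i < n) A i.
have aB n : approximable (B n).
  elim: n => [|n IH].
    rewrite /B bigcup_mkord big_ord0; apply: (@determined_approximable fset0).
    by move=> x y _.
  by rewrite /B bigcup_mkord big_ord_recr/= -bigcup_mkord; exact: approximableU.
have BA : \bigcup_n B n = \bigcup_n A n.
  apply/seteqP; split=> x [n _]; first by move=> [i _ Ax]; exists i.
  by move=> Ax; exists n.+1 => //; exists n => /=.
have [n nP] : exists n, pr m (\bigcup_n A n) - pr m (B n) <= e / 2.
  have Bmono n p : (n <= p)%N -> B n `<=` B p.
    by move=> np x [i /= ni Ax]; exists i => //=; exact: leq_trans ni np.
  have := @pr_cvg_incr _ _ _ m B (fun n => (aB n).1) Bmono.
  rewrite BA => /cvgrPdist_le/(_ _ e2)[N _ /(_ N (leqnn N))] h; exists N.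
  by apply: le_trans h; exact: ler_norm.
have [J [C [dC BC]]] := (aB n).2 _ e2; exists J, C; split => //.
have mS := measurable_symdiff (aB n).1 dC.
have BnA : B n `<=` \bigcup_n A n by rewrite -BA; exact: bigcup_sup.
apply: (@le_trans _ _ (pr m ((\bigcup_n A n `\` B n) `|` symdiff (B n) C))).
  apply: le_pr; [exact: measurable_symdiff dC| |].
    by apply: measurableU => //; apply: measurableD => //; exact: (aB n).1.
  move=> x; rewrite /symdiff/= => -[[Ax nC]|[Cx nA]].
    by have [?|?] := pselect (B n x); tauto.
  by right; right; split => // /BnA.
apply: le_trans (prU_le _ _ mS) _; first by apply: measurableD => //; exact: (aB n).1.
rewrite [leRHS]splitr lerD//.
have := pr_split m mU (aB n).1; rewrite (setIidr BnA); move: nP; lra.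
Qed.

(** Approximable sets form a sigma-algebra, and an open set is the countable union, over finite [J],
    of the sets of points whose [J]-cylinder lies inside it. *)
Lemma measurable_approximable A : measurable A -> approximable A.
Proof.
have sA : sigma_algebra setT approximable.
  split=> [|B [mB aB]|]; last exact: approximable_bigcup.
    by apply: (@determined_approximable fset0) => x y.
  rewrite setTD; split=> [|e /aB[J [C [dC BC]]]]; first exact: measurableC.
  exists J, (~` C); split=> [x y xy nC Cy|]; first by apply: nC; apply: dC Cy; exact: agree_sym.
  suff -> : symdiff (~` B) (~` C) = symdiff B C by [].
  by rewrite /symdiff !setDE !setCK setUC [C `&` _]setIC [B `&` _]setIC.
move=> mA; apply: (smallest_sub sA) mA => U oU.
pose UJ J := [set x : T | forall y, agree J x y -> U y].
pose V (o : option {fset I}) := if o is Some J then UJ J else set0.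
rewrite (_ : U = \bigcup_n V (choice.unpickle n)).
  apply: approximable_bigcup => n; case: choice.unpickle => [J|].
    apply: (@determined_approximable J) => x y xy Ux z yz.
    by apply: Ux => i iJ; rewrite xy// yz.
  by apply: (@determined_approximable fset0) => x y.
apply/seteqP; split=> [x Ux|x [n _]].
  by have [J JU] := open_agree oU Ux; exists (choice.pickle J) => //; rewrite choice.pickleK.
by case: choice.unpickle => // J; exact.
Qed.

Lemma labelling_approx k (xi : borel T -> 'I_k) e :
  measurable_labelling xi -> 0 < e ->
  exists J (eta : borel T -> 'I_k), (forall x y, agree J x y -> eta x = eta y) /\
    measurable [set x | xi x != eta x] /\ pr m [set x | xi x != eta x] <= e.
Proof.
move=> mxi e0; have k0 : (0 < k)%N by apply: leq_ltn_trans (ltn_ord (xi point)).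
have ek : 0 < e / k%:R by rewrite divr_gt0 ?ltr0n.
have /choice[JC JCP] j : exists JC : {fset I} * set T, determined JC.1 JC.2 /\
    pr m (symdiff (xi @^-1` [set j]) JC.2) <= e / k%:R.
  by have [_ /(_ _ ek)[J [C ?]]] := measurable_approximable (mxi j); exists (J, C).
pose J := (\bigcup_(j in 'I_k) (JC j).1)%fset.
have dJ j : determined J (JC j).2.
  apply: determinedW (JCP j).1; apply/fsubsetP => i iJ.
  by apply/bigfcupP; exists j => //; rewrite mem_index_enum.
(* A label whose approximating set contains [x], or a fixed one if there is none; either way a wrong
   label puts [x] in one of the k symmetric differences, each of mass at most e / k. *)
pose eta (x : T) := odflt (xi point) [pick j | `[< (JC j).2 x >]].
have etaJ x y : agree J x y -> eta x = eta y.
  move=> xy; rewrite /eta; congr odflt; apply: eq_pick => j.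
  by apply/asboolP/asboolP; apply: dJ => //; exact: agree_sym.
exists J, eta; split => //.
have mE : measurable [set x : borel T | xi x != eta x].
  rewrite (_ : [set _ | _] = [set x | exists2 j, j \in enum 'I_k &
      (xi @^-1` [set j] `&` [set x | eta x != j]) x]).
    apply: (pr_union_le m _ _).2 => j; apply: measurableI; first exact: mxi.
    by apply: (measurable_determined cE (J := J)) => x y /etaJ /= ->.
  apply/seteqP; split=> x /=; last by move=> [j _ [-> ]]; rewrite eq_sym.
  by rewrite eq_sym => h; exists (xi x); rewrite ?mem_enum.
split => //.
have [US mUS] := @pr_union_le _ _ _ m _ (enum 'I_k)
  (fun j => symdiff (xi @^-1` [set j]) (JC j).2) (fun j => measurable_symdiff (mxi j) (dJ j)).
apply: le_trans (le_pr m mE mUS _) (le_trans US _).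
  move=> x /=; rewrite /eta; case: pickP => [j /asboolP Cj /= xj|nC _].
    by exists j; rewrite ?mem_enum//; right; split => //= xij; rewrite xij eqxx in xj.
  exists (xi x); rewrite ?mem_enum//; left; split => // Cx.
  by have /asboolP := nC (xi x).
apply: le_trans (_ : \sum_(j <- enum 'I_k) e / k%:R <= _).
  by apply: ler_sum => j _; exact: (JCP j).2.
by rewrite big_enum/= sumr_const card_ord -[_ *+ _]mulr_natr divfK// pnatr_eq0 -lt0n.
Qed.

End approximation.

(** * Existence of uniform product laws *)

Section uniform_digits.
Variable R : realType.

Lemma uniform_interval_exists : exists U : probability (measurableTypeR R) R,
  forall a b : R, 0 <= a -> a <= b -> b <= 1 -> U `[a, b[%classic = (b - a)%:E.
Proof.
have [mu muE] : exists mu : {measure set (measurableTypeR R) -> \bar R},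
    forall A, mu A = lebesgue_measure (A `&` `[0, 1[%classic).
  by exists (mrestr (@lebesgue_measure R) (measurable_itv `[0, 1[)).
have mu1 : mu [set: measurableTypeR R] = 1%E.
  by rewrite muE setTI lebesgue_measure_itv/= lte_fin ltr01 oppr0 adde0.
have c : ((mu setT == 0) || (mu setT == +oo))%E = false by rewrite mu1 onee_eq0.
(* The total mass is already 1: [mnormalize] only supplies the probability structure. *)
exists (mnormalize mu (dirac point)) => a b a0 ab b1.
transitivity (mu `[a, b[%classic).
  by rewrite /= /mnormalize c mu1 invr1 mule1.
rewrite muE setIidl.
  rewrite lebesgue_measure_itv/= lte_fin; have [->|aNb] := eqVneq a b.
    by rewrite ltxx subrr.
  by rewrite lt_neqAle aNb ab.
by move=> x /=; rewrite !in_itv/= => /andP[ax xb]; rewrite (le_trans a0 ax) (lt_le_trans xb b1).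
Qed.

Variable N : nat -> nat.
Hypothesis N0 : forall i, (0 < N i)%N.
Variable U : probability (measurableTypeR R) R.
Hypothesis UE : forall a b : R, 0 <= a -> a <= b -> b <= 1 ->
  U `[a, b[%classic = (b - a)%:E.

Definition radix n := \prod_(i < n) N i.

Lemma radix_gt0 n : (0 < radix n)%N.
Proof. by rewrite prodn_gt0. Qed.

(** The first n digits of [t] in the mixed radix N 0, N 1, ..., read as one integer; [digit i] is
    the last digit of the prefix of length i + 1. *)
Definition prefix_digits n (t : R) := Num.truncn (t * (radix n)%:R).

Definition digit i t := (prefix_digits i.+1 t %% N i)%N.

Lemma measurable_prefix n k :
  measurable [set t : measurableTypeR R | prefix_digits n t = k].
Proof.
have P0 : 0 < (radix n)%:R :> R by rewrite ltr0n radix_gt0.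
have mle j : measurable [set t : measurableTypeR R | (prefix_digits n t <= j)%N].
  rewrite (_ : [set _ | _] = `]-oo, (j.+1%:R / (radix n)%:R)[%classic); last first.
    apply/seteqP; split=> t /=; rewrite in_itv/= truncn_le_nat ltr_pdivlMr//.
  exact: measurable_itv.
case: k => [|k].
  rewrite (_ : [set _ | _] = [set t | (prefix_digits n t <= 0)%N])//.
  by apply/seteqP; split=> t /=; rewrite leqn0 => /eqP.
rewrite (_ : [set _ | _] = [set t | (prefix_digits n t <= k.+1)%N] `\`
   [set t | (prefix_digits n t <= k)%N]); first exact: measurableD.
apply/seteqP; split=> t /=; first by move=> ->; rewrite ltnn.
by case=> h /negP; rewrite -ltnNge => h'; apply/eqP; rewrite eqn_leq h.
Qed.

Lemma measurable_prefix_pred n (Q : pred nat) :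
  measurable [set t : measurableTypeR R | Q (prefix_digits n t)].
Proof.
rewrite (_ : [set _ | _] = \bigcup_(k in [set k | Q k]) [set t | prefix_digits n t = k]).
  by apply: bigcup_measurable => k _; exact: measurable_prefix.
by apply/seteqP; split=> t /=; [move=> ?; exists (prefix_digits n t)|case=> k ? ->].
Qed.

Lemma prefix_lt n t : 0 <= t < 1 -> (prefix_digits n t < radix n)%N.
Proof.
move=> /andP[t0 t1]; rewrite truncn_lt_nat ?mulr_ge0//.
by rewrite gtr_pMl// ltr0n radix_gt0.
Qed.

Lemma prefixS n t : 0 <= t -> (prefix_digits n.+1 t %/ N n)%N = prefix_digits n t.
Proof.
move=> t0; set j := prefix_digits n t; set k := prefix_digits n.+1 t.
have Nn0 : 0 < (N n)%:R :> R by rewrite ltr0n.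
have /andP[j1 j2] : j%:R <= t * (radix n)%:R < j.+1%:R by rewrite truncn_itv// mulr_ge0.
have kE : k = Num.truncn (t * (radix n)%:R * (N n)%:R).
  by rewrite /k /prefix_digits /radix big_ord_recr natrM mulrA.
apply/eqP; rewrite eqn_leq; apply/andP; split.
  rewrite -ltnS ltn_divLR// kE truncn_lt_nat ?mulr_ge0//.
  by rewrite natrM ltr_pM2r.
by rewrite leq_divRL// kE truncn_ge_nat ?mulr_ge0// natrM ler_pM2r.
Qed.

Variable B : nat -> pred nat.

Fixpoint digit_test n (k : nat) :=
  if n is n'.+1 then digit_test n' (k %/ N n')%N && B n' (k %% N n')%N else true.

Lemma digit_testP n t : 0 <= t ->
  digit_test n (prefix_digits n t) <-> forall i, (i < n)%N -> B i (digit i t).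
Proof.
move=> t0; elim: n => [//|n IH] /=; rewrite prefixS//; split.
  move=> /andP[/IH h Bn] i; rewrite ltnS leq_eqVlt => /predU1P[->//|].
  exact: h.
move=> h; apply/andP; split; last exact: h.
by apply/IH => i ni; apply: h; rewrite ltnS ltnW.
Qed.

Lemma digit_test_count n :
  (\sum_(0 <= k < radix n) digit_test n k =
   \prod_(i < n) \sum_(0 <= r < N i) B i r)%N.
Proof.
elim: n => [|n IH]; first by rewrite /radix !big_ord0 big_nat1.
rewrite /radix big_ord_recr/= -/(radix n) big_nat_mul big_ord_recr/= -IH big_distrl/=.
apply: eq_bigr => j _.
rewrite -{1}[(j * N n)%N]add0n big_addn mulSn addnK big_distrr/=.
rewrite big_nat [RHS]big_nat; apply: eq_bigr => r /= rN.
by rewrite ![(r + _)%N]addnC divnMDl// divn_small// addn0 modnMDl modn_small// mulnb.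
Qed.

(** Each value of the prefix occupies an interval of length 1 / radix n, so the mass is a count of
    admissible prefixes, and that count is a product over the digits. *)
Lemma pr_digits n :
  pr U [set t : measurableTypeR R | 0 <= t < 1 /\ forall i, (i < n)%N -> B i (digit i t)] =
  \prod_(i < n) ((\sum_(0 <= r < N i) B i r)%N%:R / (N i)%:R).
Proof.
have P0 : 0 < (radix n)%:R :> R by rewrite ltr0n radix_gt0.
rewrite (_ : [set _ | _] = [set t | 0 <= t < 1] `&` [set t | digit_test n (prefix_digits n t)]);
  last first.
  by apply/seteqP; split=> t /= [/[dup] + /andP[t0 _]] => ? h; split => //; apply/digit_testP.
have mI : measurable ([set t | 0 <= t < 1] : set (measurableTypeR R)).
  rewrite (_ : [set _ | _] = `[0, 1[%classic); first exact: measurable_itv.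
  by apply/seteqP; split=> t /=; rewrite in_itv.
rewrite (@pr_partition _ _ _ U _ (prefix_digits n) (index_iota 0 (radix n))) ?iota_uniq//;
  last first.
- by move=> t [t01 _]; rewrite mem_index_iota prefix_lt.
- by apply: measurableI => //; exact: measurable_prefix_pred.
- exact: measurable_prefix.
rewrite big_split/= prodfV -!natr_prod -digit_test_count -/(radix n) natr_sum mulr_suml.
rewrite big_nat [RHS]big_nat; apply: eq_bigr => k /= kP.
have [Qk|Qk] := boolP (digit_test n k); last first.
  rewrite mul0r (_ : _ `&` _ = set0) ?pr0//; apply/seteqP; split => // t [[_ /=]].
  by move=> + kE; rewrite kE (negbTE Qk).
rewrite (_ : _ `&` _ = `[k%:R / (radix n)%:R, k.+1%:R / (radix n)%:R[%classic).
  rewrite /pr UE/= ?divr_ge0//; first by rewrite -mulrBl -natrB// subSnn mul1r.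
    by rewrite ler_pM2r ?invr_gt0// ler_nat.
  by rewrite ler_pdivrMr// mul1r ler_nat.
apply/seteqP; split=> t /=; rewrite in_itv/= ler_pdivrMr// ltr_pdivlMr//.
  by move=> [[/andP[t0 _] _] /eqP]; rewrite truncn_eq// mulr_ge0.
move=> /[dup] h /andP[h1 h2].
have t0 : 0 <= t by rewrite -(pmulr_lge0 _ P0); apply: le_trans h1.
have t1 : t < 1.
  by rewrite -(ltr_pM2r P0) mul1r; apply: lt_le_trans h2 _; rewrite ler_nat.
have -> : prefix_digits n t = k by apply: truncn_def.
by rewrite t0 t1.
Qed.

End uniform_digits.

Section uniform_product_law.
Variables (R : realType) (I : countType) (E : I -> pointedType).
Hypothesis fE : forall i, finite_set [set: E i].
Local Notation T := (discrete_product E).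
Local Notation c i := (#|` fset_set [set: E i]|).

(* The mixed-radix digits of a uniform point of [0, 1[ are independent and uniform. *)
Lemma uniform_product_law_exists :
  exists P : probability (borel T) R, is_product_law (fun i _ => (c i)%:R^-1) P.
Proof.
have cE i : countable [set: E i] by exact: finite_set_countable.
have inE' i (e : E i) : e \in fset_set [set: E i] by rewrite in_fset_set;
  [rewrite in_setT|exact: fE].
have c0 i : (0 < c i)%N by rewrite cardfs_gt0; apply/fset0Pn; exists point; exact: inE'.
(* Radix 1 at integers that encode no index: the digit there is 0 and contributes the factor 1. *)
pose N n := if (choice.pickle_inv n : option I) is Some i then c i else 1%N.
have N0 n : (0 < N n)%N by rewrite /N; case: choice.pickle_inv.
have [U UE] := uniform_interval_exists R.
pose X (t : measurableTypeR R) : T := fun i => nth point (fset_set [set: E i]) (digit N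
  (choice.pickle i) t).
have mX : measurable_fun setT (X : _ -> borel T).
  apply: measurable_product => // i e.
  pose Q k := nth point (fset_set [set: E i]) (k %% N (choice.pickle i))%N == e.
  rewrite (_ : [set _ | _] = [set t | Q (prefix_digits N (choice.pickle i).+1 t)]).
    exact: measurable_prefix_pred.
  by apply/seteqP; split=> t /eqP.
pose mfX := isMeasurableFun.Build _ _ (measurableTypeR R) (borel T) X mX.
pose X' : {mfun measurableTypeR R >-> borel T} := HB.pack X mfX.
exists (distribution U X') => J e.
pose B n : pred nat := if (choice.pickle_inv n : option I) is Some i
  then fun k => (i \notin J) || (nth point (fset_set [set: E i]) k == e i) else predT.
have [M MP] : exists M, forall i, i \in J -> (choice.pickle i < M)%N.
  exists (\max_(i <- J) choice.pickle i).+1 => i iJ; rewrite ltnS.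
  by rewrite (bigD1_seq i)//= leq_maxl.
have m01 : measurable ([set t | 0 <= t < 1] : set (measurableTypeR R)).
  rewrite (_ : [set _ | _] = `[0, 1[%classic); first exact: measurable_itv.
  by apply/seteqP; split=> t /=; rewrite in_itv.
have mA : measurable [set x : borel T | forall i, i \in J -> x i = e i].
  exact: (measurable_cylinder cE J e).
rewrite prE//; congr (_%:E).
have mXA := mX measurableT _ mA; rewrite setTI in mXA.
have N_pickle i : N (choice.pickle i) = c i by rewrite /N choice.pickleK_inv.
have B_pickle i k : B (choice.pickle i) k = (i \notin J) || (nth point (fset_set [set: E i]) k
  == e i).
  by rewrite /B choice.pickleK_inv.
have U01 : pr U (~` [set t | 0 <= t < 1]) = 0.
  have I01 : [set t | 0 <= t < 1] = `[0, 1[%classic :> set (measurableTypeR R).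
    by apply/seteqP; split=> t /=; rewrite in_itv.
  by rewrite prC// I01 /pr UE//= subr0 subrr.
transitivity (pr U (X @^-1` [set x | forall i, i \in J -> x i = e i] `&` [set t | 0 <= t < 1])).
  rewrite [LHS](pr_split U mXA m01) -[RHS]addr0; congr (_ + _).
  apply/eqP; rewrite eq_le pr_ge0 andbT -[leRHS]U01; apply: le_pr.
  - exact: measurableD.
  - exact: measurableC.
  - by move=> x [].
rewrite (_ : _ `&` _ = [set t : measurableTypeR R | 0 <= t < 1 /\ forall i, (i < M)%N -> B i
  (digit N i t)]); last first.
  apply/seteqP; split=> [t [/= h t01]|t [t01 h]]; split => //=.
    move=> n _; rewrite /B; case En : ((choice.pickle_inv n : option I)) => [i|//].
    have nE : n = choice.pickle i by have := @choice.pickle_invK I n; rewrite En.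
    by case: (boolP (i \in J)) => //= /h <-; rewrite nE.
  by move=> i iJ; have := h _ (MP _ iJ); rewrite B_pickle iJ => /eqP.
rewrite (pr_digits N0 UE).
pose g n : R := if (choice.pickle_inv n : option I) is Some i then if i \in J then (c i)%:R^-1
  else 1 else 1.
have gE n : (\sum_(0 <= r < N n) B n r)%N%:R / (N n)%:R = g n.
  have full : (\sum_(0 <= r < N n) 1)%N%:R / (N n)%:R = 1 :> R.
    by rewrite sum_nat_const_nat subn0 muln1 divff// pnatr_eq0 -lt0n.
  rewrite /g /B; case En : ((choice.pickle_inv n : option I)) => [i|//].
  case: (boolP (i \in J)) => //= iJ.
  have -> : N n = c i by rewrite /N En.
  rewrite -[RHS]mul1r; congr (_ / _).
  have ei := inE' i (e i); set s := fset_set _ in ei *.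
  rewrite (bigD1_seq (index (e i) s)) ?iota_uniq ?mem_index_iota ?index_mem//=.
  rewrite nth_index// eqxx big1_seq// => r; rewrite mem_index_iota => /andP[ri /= rs].
  by apply/eqP; rewrite eqb0; apply: contraNneq ri => <-; rewrite index_uniq// fset_uniq.
rewrite (eq_bigr (fun i : 'I_M => g i)) => [|i _]; last exact: gE.
rewrite -(big_mkord xpredT g) (bigID (mem [seq choice.pickle i | i <- J]))/=.
rewrite [X in _ * X]big1 ?mulr1; last first.
  move=> n nJ; rewrite /g; case En : ((choice.pickle_inv n : option I)) => [i|//].
  have nE : n = choice.pickle i by have := @choice.pickle_invK I n; rewrite En.
  by case: ifP => // iJ; case/mapP: nJ; exists i.
rewrite -big_filter (perm_big [seq choice.pickle i | i <- J]).
  by rewrite big_map; apply: eq_big_seq => i iJ; rewrite /g choice.pickleK_inv iJ.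
apply: uniq_perm.
- by rewrite filter_uniq// iota_uniq.
- by rewrite map_inj_uniq ?fset_uniq//; exact: (pcan_inj (@choice.pickleK I)).
move=> n; rewrite mem_filter mem_index_iota /=; apply/andb_idr.
by move=> /mapP[i iJ ->]; exact: MP.
Qed.

End uniform_product_law.

Section join_entropy_bound.
Context d (T : measurableType d) (R : realType) (m : probability T R).

Lemma pr_full (D A : set T) : measurable D -> pr m D = 1 -> measurable A ->
  pr m (D `&` A) = pr m A.
Proof.
move=> mD D1 mA; rewrite [RHS](pr_split m mA mD) setIC -[LHS]addr0; congr (_ + _).
apply/esym/eqP; rewrite eq_le pr_ge0 andbT.
apply: (@le_trans _ _ (pr m (~` D))); last by rewrite prC// D1 subrr.
apply: le_pr; [exact: measurableD|exact: measurableC|by move=> x []].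
Qed.

(** [Y] is the finite datum, a pattern or a residue representative, from which [eta] reads
    approximate labels. The set [D] of full measure lets [s] list only the values of [Y] on it, such
    as the realized patterns. *)
Lemma join_entropy_bound (F : finType) k (lab : F -> T -> 'I_k) (T2 : eqType)
    (Y : T -> T2) (s : seq T2) (D : set T) (eta : T2 -> F -> 'I_k) (h : T2 -> R)
    (g e : R) :
  (forall a, measurable_labelling (lab a)) ->
  (forall p, measurable [set x | Y x = p]) ->
  measurable D -> pr m D = 1 -> uniq s -> (forall x, D x -> Y x \in s) ->
  0 <= g ->
  (forall a, measurable [set x | lab a x != eta (Y x) a] /\
     pr m [set x | lab a x != eta (Y x) a] <= e) ->
  - \sum_(q : {ffun F -> 'I_k}) pr m [set x | forall a, lab a x = q a] *
      ln (pr m [set x | forall a, lab a x = q a]) + \sum_(p <- s) pr m [set x | Y x = p] * h p <=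
  ln (\sum_(p <- s) expR (h p)) + #|F|%:R * (g * e + k%:R * expR (- g)).
Proof.
move=> mlab mY mD D1 us DY g0 lab_eta.
pose Q (q : {ffun F -> 'I_k}) := pr m [set x | forall a, lab a x = q a].
pose X x : {ffun F -> 'I_k} := [ffun a => lab a x].
have XE (q : {ffun F -> 'I_k}) : [set x | forall a, lab a x = q a] = [set x | X x = q].
  apply/seteqP; split=> x /= h'; first by apply/ffunP => a; rewrite ffunE h'.
  by move=> a; rewrite -h' ffunE.
have mX q : measurable [set x | X x = q].
  rewrite -XE (_ : [set _ | _] = \bigcap_(a in [set: F]) (lab a @^-1` [set q a])).
    by apply: fin_bigcap_measurable => // a _; exact: mlab.
  by apply/seteqP; split=> x /= h'; [move=> a _; exact: h'|move=> a; exact: h'].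
pose J q p := pr m (D `&` [set x | X x = q] `&` [set x | Y x = p]).
have mDX q : measurable (D `&` [set x | X x = q]) by exact: measurableI.
have mJ q p : measurable (D `&` [set x | X x = q] `&` [set x | Y x = p]) by exact: measurableI.
have QJ q : Q q = \sum_(p <- s) J q p.
  by rewrite /Q XE -(pr_full mD D1)// (pr_partition m us mY)// => x [/DY].
have partX A : measurable A -> pr m A = \sum_q pr m (A `&` [set x | X x = q]).
  move=> mA; apply: pr_partition => //; exact: index_enum_uniq.
have J0 q p : 0 <= J q p by exact: pr_ge0.
have J1 : \sum_q \sum_(p <- s) J q p = 1.
  under eq_bigr do rewrite -QJ.
  by rewrite -(prT m) (partX _ measurableT); apply: eq_bigr => q _; rewrite setTI /Q XE.
have JQ q p : J q p <= \sum_(p <- s) J q p.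
  have [ps|ps] := boolP (p \in s); first by rewrite (big_rem p)//= lerDl sumr_ge0.
  rewrite {1}/J (_ : _ `&` _ = set0) ?pr0 ?sumr_ge0//.
  by apply/seteqP; split => // x [[/DY Ys _] Yp]; move: ps; rewrite -Yp Ys.
have Jlab a : \sum_q \sum_(p <- s) J q p * (q a != eta p a)%:R <= e.
  have [mb be] := lab_eta a; apply: le_trans be.
  set A := [set x | _] in mb *.
  rewrite -(pr_full mD D1 mb) (partX _ (measurableI _ _ mD mb)); apply: ler_sum => q _.
  have mDA : measurable (D `&` A `&` [set x | X x = q]).
    by apply: measurableI => //; exact: measurableI.
  rewrite (pr_partition m us mY mDA); last by move=> x [[/DY]].
  apply: ler_sum => p _; have [qp|qp] := eqVneq (q a) (eta p a).
    by rewrite mulr0 pr_ge0.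
  rewrite mulr1; apply: le_pr => //; first exact: measurableI.
  move=> x [[Dx Xq] Yp]; do 3!split => //; rewrite /A /=.
  by rewrite Yp -(_ : q a = lab a x)// -Xq ffunE.
have := label_entropy_bound h J0 J1 g0 Jlab JQ.
under eq_bigr do rewrite -QJ.
apply: le_trans; rewrite lerD2l exchange_big/=.
rewrite le_eqVlt; apply/orP; left; apply/eqP; apply: eq_bigr => p _.
rewrite -mulr_suml; congr (_ * _).
rewrite -(pr_full mD D1 (mY p)) (partX _ (measurableI _ _ mD (mY p))).
by apply: eq_bigr => q _; rewrite /J -!setIA [[set x | X x = q] `&` _]setIC.
Qed.

End join_entropy_bound.

(** * Phases and sieve densities *)

Section phases.
Local Open Scope quotient_scope.
Variables (R : realType) (K : fieldExtType rat) (b : nat -> idealr (integers K)).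
Hypothesis hb : erdos_family R b.
Local Notation O := (integers K).
Local Notation N l := (ideal_norm (b l)).
Local Notation quo l := {ideal_quot (b l)}.
Local Notation haar := (haar R b).
Implicit Types (W : {fset O}) (g : phases b).

Lemma finite_residues l : finite_set [set: quo l].
Proof. exact/finite_quotient/(erdos_nonzero hb). Qed.

Lemma countable_residues l : countable [set: (quo l : pointedType)].
Proof. exact/finite_set_countable/finite_residues. Qed.

Lemma ideal_norm_gt1 l : (1 < N l)%N.
Proof.
rewrite /ideal_norm; have fl := finite_residues l.
apply: (@leq_trans #|` [fset (0 : quo l); 1]%fset|).
  by rewrite cardfs2 eq_sym oner_eq0.
by apply: fsubset_leq_card; apply/fsubsetP => x _; rewrite in_fset_set// in_setT.
Qed.

(** [haar] is chosen by [get]; the residue rings being finite, some measure has the required law, so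
    the chosen one has it. *)
Lemma haarP : is_product_law (fun l (_ : quo l) => (N l)%:R^-1) haar.
Proof.
apply: (@getPex _ (is_product_law (fun l (_ : quo l) => (N l)%:R^-1))).
exact: (@uniform_product_law_exists R nat (fun l => quo l : pointedType) finite_residues).
Qed.

Lemma card_bool_set : #|` fset_set [set: bool]| = 2%N.
Proof.
rewrite (_ : fset_set _ = [fset true; false]%fset) ?cardfs2//.
by apply/fsetP => -[]; rewrite in_fset_set ?in_setT ?inE//; exact: finite_finset.
Qed.

Lemma coinsP : is_product_law (fun (_ : O) (_ : bool) => 2^-1) (coins R K).
Proof.
apply: (@getPex _ (is_product_law (fun (_ : O) (_ : bool) => 2^-1))).
have [|P Pl] := @uniform_product_law_exists R O (fun=> bool : pointedType).
  by move=> _; exact: finite_finset.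
by exists P => J e; rewrite Pl card_bool_set.
Qed.

Definition rotate (a : O) (g : borel (phases b)) : borel (phases b) :=
  fun l => (g l : quo l) + \pi_(quo l) a.

Lemma measurable_rotate a : measurable_fun setT (rotate a).
Proof.
apply: measurable_product => [|l e]; first exact: countable_residues.
exact: (@measurable_coordinate _ _ l [set r | (r : quo l) + \pi_(quo l) a = e]).
Qed.

HB.instance Definition _ a := @isMeasurableFun.Build _ _
  (borel (phases b)) (borel (phases b)) (rotate a) (measurable_rotate a).

(** Rotation pulls a cylinder back to a cylinder on the same coordinates, so both measures satisfy
    the same product law. *)
Lemma haar_rotate a B : measurable B -> haar (rotate a @^-1` B) = haar B.
Proof.
move=> mB.
apply: (@product_law_unique R nat (fun l => quo l : pointedType) countable_residues
  (fun l _ => (N l)%:R^-1) (distribution haar (rotate a)) haar _ haarP B mB) => J e.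
have := haarP J (fun l => (e l : quo l) - \pi_(quo l) a); rewrite /distribution /pushforward.
move=> <-; congr (haar _); apply/seteqP; split=> g /= h l lJ.
  by rewrite -h// /rotate addrK.
by rewrite /rotate h// subrK.
Qed.

Definition residue (t : O) : phases b := fun l => \pi_(quo l) t.

(** For [W] = {0} this is membership in the set V_L of integers avoiding the first L ideals; a
    general [W] asks this of the whole translate a + W. *)
Definition sieve W L (a : O) : bool :=
  `[< forall w, w \in W -> forall l, (l < L)%N -> a + w \notin b l >].

Definition avoids W L : set (borel (phases b)) :=
  [set g | forall w, w \in W -> forall l, (l < L)%N ->
    (g l : quo l) + \pi_(quo l) w != 0].

Definition avoids_all W : set (borel (phases b)) :=
  [set g | forall w, w \in W -> phi g w].

Lemma pi_neq0 l (a : O) : (\pi_(quo l) a != 0) = (a \notin b l).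
Proof. by congr negb; rewrite -[a in RHS]subr0 -ideal_quot_eq rmorph0. Qed.

Lemma avoids_residue W L t : avoids W L (residue t) <-> sieve W L t.
Proof.
split=> [h|/asboolP h w wW l lL].
  by apply/asboolP => w wW l lL; rewrite -pi_neq0 rmorphD; exact: h.
by have := h w wW l lL; rewrite -pi_neq0 rmorphD.
Qed.

Definition below L : {fset nat} := [fset l in iota 0 L]%fset.

Lemma belowE L l : (l \in below L) = (l < L)%N.
Proof. by rewrite inE mem_iota add0n. Qed.

Lemma avoids_determined W L : determined (below L) (avoids W L).
Proof.
move=> g g' gg' h w wW l lL; rewrite -gg' ?belowE//.
exact: h.
Qed.

Lemma measurable_avoids W L : measurable (avoids W L).
Proof. exact: (measurable_determined countable_residues (@avoids_determined W L)). Qed.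

Lemma avoids_allE W : avoids_all W = \bigcap_L avoids W L.
Proof.
apply/seteqP; split=> [g h L _ w wW l _|g h w wW]; first by have /asboolP := h w wW; exact.
by apply/asboolP => l; exact: (h l.+1).
Qed.

Lemma measurable_avoids_all W : measurable (avoids_all W).
Proof. by rewrite avoids_allE; apply: bigcap_measurableType => L _; exact: measurable_avoids. Qed.

(** For [W] = {0} this is the partial product D_L. The limit [dens_all W] is the Mirsky measure of
    the event of ones on [W], and 2^|W| times its kappa measure. *)
Definition dens W L : R := pr haar (avoids W L).

Definition dens_all W : R := pr haar (avoids_all W).

Lemma dens_cvg W : dens W L @[L --> \oo] --> dens_all W.
Proof.
rewrite /dens_all avoids_allE; apply: pr_cvg_decr => [L|L M LM g h w wW l lL].
  exact: measurable_avoids.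
by apply: (h w wW); exact: leq_trans lL LM.
Qed.

Lemma phi_rotate c g a : phi (rotate c g) a = phi g (c + a).
Proof.
by apply/asboolP/asboolP => h l; have := h l; rewrite /rotate rmorphD addrA.
Qed.

Lemma dens_all_translate c W : dens_all (translate c W) = dens_all W.
Proof.
rewrite /dens_all /pr -(haar_rotate c (measurable_avoids_all W)); congr (fine (haar _)).
apply/seteqP; split=> g h w.
  by move=> wW; rewrite phi_rotate; apply: h; apply/imfsetP; exists w.
by move=> /imfsetP[v /= vW ->]; rewrite -phi_rotate; exact: h.
Qed.

Lemma dens1 L : dens [fset 0]%fset L = \prod_(0 <= l < L) (1 - (N l)%:R^-1).
Proof.
pose cyl (J : {fset nat}) : set (borel (phases b)) :=
  [set g | forall l, l \in J -> g l = 0 :> quo l].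
have mcyl J : measurable (cyl J).
  exact: (measurable_cylinder (E := fun l => quo l : pointedType) countable_residues J (fun=> 0)).
(* The product law is known on cylinders only. [J] collects coordinates forced to be 0, and avoiding
   0 at coordinate L is a difference of two events of this form, one with [J] and one with L added
   to [J]. *)
suff H J : [disjoint J & below L]%fset -> pr haar (cyl J `&` avoids [fset 0]%fset L) =
    (\prod_(l <- J) (N l)%:R^-1) * \prod_(0 <= l < L) (1 - (N l)%:R^-1).
  have := H fset0; rewrite fdisjoint0X => /(_ isT); rewrite big_seq_fset0 mul1r => <-.
  by congr pr; apply/seteqP; split=> [g h|g []].
elim: L J => [|L IH] J JL.
  rewrite big_nil mulr1 (_ : _ `&` _ = cyl J).
    by apply: EFin_inj; rewrite -prE//; exact: (haarP J (fun=> 0)).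
  by apply/seteqP; split=> [g []|g h].
have LJ : L \notin J.
  by apply/negP => LJ; move/fdisjointP/(_ L LJ): JL; rewrite belowE ltnSn.
have JL' : [disjoint J & below L]%fset.
  apply/fdisjointP => l /(fdisjointP JL); rewrite !belowE.
  by apply: contra => /ltnW; rewrite ltnS.
have JL1 : [disjoint (L |` J) & below L]%fset.
  apply/fdisjointP => l; rewrite in_fset1U => /predU1P[->|lJ]; first by rewrite belowE ltnn.
  exact: (fdisjointP JL').
have h1 : pr haar (cyl J `&` avoids [fset 0]%fset L) =
    pr haar (cyl (L |` J)%fset `&` avoids [fset 0]%fset L) +
    pr haar (cyl J `&` avoids [fset 0]%fset L.+1).
  have mA : measurable (cyl J `&` avoids [fset 0]%fset L).
    by apply: measurableI => //; exact: measurable_avoids.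
  rewrite (pr_split haar mA (mcyl [fset L]%fset)); congr (_ + _); congr pr.
    apply/seteqP; split=> g.
      move=> [[hJ ha] hL]; split => // l; rewrite !inE => /predU1P[->|]; last exact: hJ.
      by apply: hL; rewrite inE.
    move=> [hJ ha]; split; last by move=> l; rewrite inE => /eqP ->; apply: hJ; rewrite !inE eqxx.
    by split => // l lJ; apply: hJ; rewrite !inE lJ orbT.
  apply/seteqP; split=> g.
    move=> [[hJ ha] hL]; split => // w w0 l; rewrite ltnS leq_eqVlt => /predU1P[->|];
      last exact: ha.
    move: w0; rewrite inE => /eqP ->; rewrite rmorph0 addr0; apply/eqP => gL.
    by apply: hL => l'; rewrite inE => /eqP ->.
  move=> [hJ ha]; split; first by split => // w w0 l lL; apply: ha => //; exact: ltnW.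
  move=> /(_ L); rewrite inE eqxx => /(_ isT) gL.
  by have := ha 0 (fset11 _) L (ltnSn _); rewrite gL rmorph0 addr0 eqxx.
move: h1; rewrite IH// IH// big_fsetU1//= big_nat_recr//=; lra.
Qed.

Lemma dens1_all : dens_all [fset 0]%fset =
  limn (fun n => \prod_(0 <= l < n) (1 - (N l)%:R^-1 : R)).
Proof.
apply/esym/cvg_lim => //; have := @dens_cvg [fset 0]%fset.
by under eq_fun do rewrite dens1.
Qed.

End phases.

Lemma near_seq (T : eqType) (r : seq T) (P : T -> nat -> Prop) :
  (forall s, s \in r -> \forall n \near \oo, P s n) ->
  \forall n \near \oo, forall s, s \in r -> P s n.
Proof.
elim: r => [_|x r IH H]; first by near=> n.
have H1 := H x (mem_head _ _).
have H2 : \forall n \near \oo, forall s, s \in r -> P s n.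
  by apply: IH => s sr; apply: H; rewrite inE sr orbT.
near=> n => s; rewrite inE => /predU1P[->|]; first by near: n.
by move: s; near: n.
Unshelve. all: by end_near. Qed.

Section folner_averages.
Variables (R : realType) (A : zmodType) (F : nat -> {fset A}).
Hypothesis FF : folner R F.

Lemma folner_gt0 n : 0 < #|` F n|%:R :> R.
Proof. by rewrite ltr0n cardfs_gt0 FF.1. Qed.

Lemma folner_near a (e : R) : 0 < e ->
  \forall n \near \oo, #|` boundary a (F n)|%:R <= e * #|` F n|%:R.
Proof.
move=> e0; have /cvgrPdist_le/(_ _ e0) := FF.2 a.
apply: filterS => n; rewrite sub0r normrN ger0_norm.
  by rewrite ler_pdivrMr// folner_gt0.
by rewrite divr_ge0.
Qed.

Lemma folner_near_seq (r : seq A) (e : R) : 0 < e ->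
  \forall n \near \oo, forall a, a \in r -> #|` boundary a (F n)|%:R <= e * #|` F n|%:R.
Proof. by move=> e0; apply: near_seq => a _; exact: folner_near. Qed.

End folner_averages.

(** * Equidistribution of sieved sets along Følner sequences *)

Section equidistribution.
Local Open Scope quotient_scope.
Variables (R : realType) (K : fieldExtType rat) (b : nat -> idealr (integers K)).
Hypothesis hb : erdos_family R b.
Local Notation O := (integers K).
Local Notation N l := (ideal_norm (b l)).
Local Notation quo l := {ideal_quot (b l)}.
Local Notation haar := (haar R b).
Implicit Types (W : {fset O}) (g : phases b).

Definition reps L : {fset O} :=
  xget fset0 [set s : {fset O} | forall r : nat -> O,
    exists2 t, t \in s & forall l, (l < L)%N -> t - r l \in b l].

Lemma repsP L (r : nat -> O) :
  exists2 t, t \in reps L & forall l, (l < L)%N -> t - r l \in b l.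
Proof.
rewrite /reps; case: xgetP => [s _|/(_ _)]; first exact.
have [s sP] := phase_reps (erdos_coprime hb) (finite_residues hb) L.
by move=> /(_ s).
Qed.

Definition represents L g t := `[< forall l, (l < L)%N -> g l = \pi_(quo l) t >].

(** The default 0 is never reached, as every phase is represented. Taking the first match makes the
    choice depend only on the first L coordinates, hence measurable. *)
Definition rep L g : O := head 0 [seq t <- reps L | represents L g t].

Lemma repP L g : rep L g \in reps L /\ represents L g (rep L g).
Proof.
have : rep L g \in [seq t <- reps L | represents L g t].
  have [t ts tg] := repsP L (fun l => repr (g l : quo l)).
  rewrite /rep; have : t \in [seq t <- reps L | represents L g t].
    rewrite mem_filter ts andbT; apply/asboolP => l lL.
    by rewrite -[LHS]reprK; apply/esym/eqP; rewrite ideal_quot_eq tg.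
  by case: [seq t <- _ | _] => // x s _; exact: mem_head.
by rewrite mem_filter => /andP[].
Qed.

Lemma rep_eq L g l : (l < L)%N -> g l = \pi_(quo l) (rep L g).
Proof. by have [_ /asboolP] := repP L g; exact. Qed.

Lemma measurable_rep L t : measurable [set g : borel (phases b) | rep L g = t].
Proof.
apply: (measurable_determined (countable_residues hb) (J := below L)) => g g' gg' /= <-.
rewrite /rep; congr head; apply: eq_filter => s.
by apply/asboolP/asboolP => h l lL; rewrite -h ?gg' ?belowE.
Qed.

Lemma avoids_rep W L c g : avoids W L (rotate c g) <-> sieve b W L (rep L g + c).
Proof.
rewrite -avoids_residue; split=> h w wW l lL; have := h w wW l lL;
  by rewrite /rotate /residue (rep_eq _ lL) rmorphD.
Qed.

(* The average over F n depends on t only through one of finitely many residues, and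
   translating a Følner set barely changes it; so it is close, uniformly in t, to its
   Haar average over t, which is dens W L. *)
Lemma sieve_average F W L e : folner R F -> 0 < e ->
  \forall n \near \oo, forall t,
    `|\sum_(c <- F n) (sieve b W L (t + c))%:R - #|` F n|%:R * dens R b W L| <=
    e * #|` F n|%:R.
Proof.
move=> FF e0; have e2 : 0 < e / 2 by rewrite divr_gt0.
near=> n => t.
have bd s : s \in reps L -> #|` boundary s (F n)|%:R <= e / 2 * #|` F n|%:R.
  by move: s; near: n; exact: folner_near_seq.
pose A s : R := \sum_(c <- F n) (sieve b W L (s + c))%:R.
have AB s : s \in reps L -> `|A s - A 0| <= e / 2 * #|` F n|%:R.
  move=> /bd; apply: le_trans; have := @sum_translate R O s (F n) (fun c => (sieve b W L c)%:R) 1.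
  rewrite mul1r /A; under [X in _ - X]eq_bigr do rewrite -[X in sieve b W L X]add0r.
  by apply => c; rewrite ger0_norm// lern1 leq_b1.
have At s s' : (forall l, (l < L)%N -> s - s' \in b l) -> A s = A s'.
  move=> ss'; apply: eq_bigr => c _; congr (_%:R); congr nat_of_bool.
  apply/asboolP/asboolP => h w wW l lL; apply: contra (h w wW l lL) => Nb.
    by rewrite (_ : s + c + w = (s' + c + w) + (s - s')); [rewrite rpredD ?ss'|ring].
  by rewrite (_ : s' + c + w = (s + c + w) - (s - s')); [rewrite rpredB ?ss'|ring].
have [s sL ts] := repsP L (fun=> t).
rewrite -/(A t) -(At s t ts).
(* By invariance, for each c in [F n] the number dens W L is also the mass of the phases whose
   rotation by c lies in [avoids W L]; splitting by representatives turns the sum over c into the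
   Haar average of the counts [A u]. *)
have dE : #|` F n|%:R * dens R b W L =
    \sum_(u <- reps L) pr haar [set g | rep L g = u] * A u.
  under eq_bigr do rewrite /A mulr_sumr.
  rewrite exchange_big/= mulr_natl -sum1_size -sumrMnr; apply: eq_bigr => c _.
  rewrite mulr1n /dens /pr -(haar_rotate hb c (measurable_avoids hb W L)) -/(pr haar _).
  have mP : measurable (@rotate K b c @^-1` @avoids K b W L : set (borel (phases b))).
    by have := measurable_rotate hb c measurableT (measurable_avoids hb W L); rewrite setTI.
  rewrite (pr_partition haar (fset_uniq (reps L)) (measurable_rep L) mP); last first.
    by move=> g _; have [] := repP L g.
  apply: eq_bigr => u _; have [h|h] := boolP (sieve b W L (u + c)).
    rewrite mulr1; congr pr; apply/seteqP; split=> g; first by move=> [].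
    by move=> /= ug; split => //; apply/avoids_rep; rewrite ug.
  rewrite mulr0 (_ : _ `&` _ = set0) ?pr0//; apply/seteqP; split => // g [/avoids_rep + /= ug].
  by rewrite ug (negbTE h).
have p1 : \sum_(u <- reps L) pr haar [set g | rep L g = u] = 1.
  rewrite -(prT haar) (pr_partition haar (fset_uniq (reps L)) (measurable_rep L) measurableT).
    by apply: eq_bigr => u _; rewrite setTI.
  by move=> g _; have [] := repP L g.
rewrite dE; apply: le_trans (_ : `|A s - A 0| + `|\sum_(u <- reps L) pr haar [set g | rep L g =
  u] * (A 0 - A u)| <= _).
  apply: le_trans (ler_normD _ _).
  suff -> : A s - A 0 + \sum_(u <- reps L) pr haar [set g | rep L g = u] * (A 0 - A u) =
     A s - \sum_(u <- reps L) pr haar [set g | rep L g = u] * A u by [].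
  under eq_bigr do rewrite mulrBr.
  by rewrite sumrB -mulr_suml p1 mul1r; ring.
rewrite [e in leRHS]splitr mulrDl lerD//; first exact: AB.
apply: le_trans (ler_norm_sum _ _ _) _.
apply: (@le_trans _ _ (\sum_(u <- reps L) pr haar [set g | rep L g = u] * (e / 2 * #|` F
  n|%:R))); last first.
  by rewrite -mulr_suml p1 mul1r.
rewrite big_seq [leRHS]big_seq; apply: ler_sum => u us.
rewrite normrM (ger0_norm (pr_ge0 _ _)).
by apply: ler_wpM2l; [exact: pr_ge0|rewrite distrC; exact: AB].
Unshelve. all: by end_near. Qed.

End equidistribution.

(** * The upper entropy bound *)

Section free_shift.
Local Open Scope quotient_scope.
Variables (R : realType) (K : fieldExtType rat) (b : nat -> idealr (integers K)).
Hypothesis hb : erdos_family R b.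
Local Notation O := (integers K).
Local Notation quo l := {ideal_quot (b l)}.
Implicit Types (x : config K) (g : phases b).

(** The residue ring is finite, so meeting fewer than [ideal_norm] classes amounts to missing one;
    [r] represents it. *)
Lemma residues_metP l x :
  (residues_met (b l) (config_supp x) < ideal_norm (b l))%N <->
  exists r : O, forall a, x a -> a - r \notin b l.
Proof.
have fl := finite_residues hb l.
pose M := [set \pi_(quo l) a | a in config_supp x].
have fM : finite_set M by apply: sub_finite_set fl.
have inM r : (r \in fset_set M) = (r \in M) by rewrite in_fset_set.
have inT r : r \in fset_set [set: quo l] by rewrite in_fset_set// in_setT.
have MT : (fset_set M `<=` fset_set [set: quo l])%fset by apply/fsubsetP => r _.
rewrite /residues_met /ideal_norm; split=> [lt|[r rP]].
  have [r rM] : exists r, r \notin fset_set M.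
    apply: contrapT => H; move: lt; rewrite ltnNge => /negP; apply.
    apply: fsubset_leq_card; apply/fsubsetP => r _; apply: contrapT => /negP rM.
    by apply: H; exists r.
  exists (repr r) => a xa; rewrite -ideal_quot_eq reprK; apply: contra rM => /eqP <-.
  by rewrite inM; apply/mem_set; exists a.
apply: fproper_ltn_card; rewrite fproperE MT/=; apply/negP.
move=> /fsubsetP/(_ (\pi_(quo l) r) (inT _)); rewrite inM => /set_mem[a xa] /eqP.
by rewrite ideal_quot_eq (negbTE (rP a xa)).
Qed.

(** The residues [r l] form a phase, and the right side says that [x] is supported in its allowed
    set. *)
Lemma free_shiftP x : free_shift b x <->
  exists r : nat -> O, forall a, x a -> forall l, a + r l \notin b l.
Proof.
split=> [h|[r rP] l].
  have /choice[r rP] l : exists r : O, forall a, x a -> a - r \notin b l.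
    exact/residues_metP/h.
  by exists (fun l => - r l) => a xa l; exact: rP.
by apply/residues_metP; exists (- r l) => a xa; rewrite opprK; exact: rP.
Qed.

Lemma free_shift_sieve L x : free_shift b x ->
  exists2 t, t \in reps b L & forall a, x a -> sieve b [fset 0]%fset L (t + a).
Proof.
move=> /free_shiftP[r rP]; have [t tL tr] := repsP hb L r.
exists t => // a xa; apply/asboolP => w; rewrite inE => /eqP -> l lL.
rewrite addr0; apply: contra (rP a xa l) => h.
by rewrite (_ : a + r l = (t + a) - (t - r l)); [rewrite rpredB// tr|ring].
Qed.

Lemma phi_free_shift g x : (forall a, x a -> phi g a) -> free_shift b x.
Proof.
move=> xg; apply/free_shiftP; exists (fun l => repr (g l : quo l)) => a /xg/asboolP h l.
have := h l; rewrite -[X in X + _]reprK -rmorphD pi_neq0.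
by rewrite addrC.
Qed.

Lemma measurable_free_shift : measurable (free_shift b : set (borel (config K))).
Proof.
rewrite (_ : free_shift b = \bigcap_l \bigcup_r \bigcap_(a in [set a : O | a - r \in b l])
    ~` [set x : borel (config K) | x a]).
  apply: bigcap_measurableType => l _.
  apply: countable_bigcupT_measurable => [|r]; first exact: countableP.
  rewrite -setC_bigcup; apply: measurableC; rewrite bigcup_mkcond.
  apply: countable_bigcupT_measurable => [|a]; first exact: countableP.
  by case: ifP => _ //; exact: measurable_coin.
apply/seteqP; split=> x h l.
  have /residues_metP[r rP] := h l.
  by move=> _; exists r => // a ar /= xa; move/negP: (rP a xa).
have [r _ rP] := h l I; apply/residues_metP; exists r => a xa.
by apply/negP => ar; exact: (rP a ar).
Qed.

Lemma free_shift_shift a x : free_shift b x -> free_shift b (config_shift a x).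
Proof.
move=> /free_shiftP[r rP]; apply/free_shiftP; exists (fun l => a + r l) => c xc l.
by rewrite addrA [c + a]addrC; exact: rP.
Qed.

End free_shift.

Lemma sum_seq_const (R : realType) (I : Type) (s : seq I) (c : R) :
  \sum_(i <- s) c = (size s)%:R * c.
Proof. by rewrite big_const_seq count_predT iter_addr_0 mulr_natl. Qed.

(** * Windows and weighted counts of patterns *)

Section windows.
Variables (R : realType) (A : zmodType).
Implicit Types (F V : {fset A}).

Definition window F V : {fset A} := [fset (c + v)%R | c in F, v in (0%R |` V)]%fset.

Lemma sub_window F V : (F `<=` window F V)%fset.
Proof.
apply/fsubsetP => c cF; apply/imfset2P; exists c => //; exists 0; rewrite ?addr0//.
by rewrite in_fset1U eqxx.
Qed.

Lemma mem_window F V c v : c \in F -> v \in V -> c + v \in window F V.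
Proof. by move=> cF vV; apply/imfset2P; exists c => //; exists v; rewrite // in_fset1U vV orbT. Qed.

Lemma card_windowD F V :
  (#|` (window F V `\` F)%fset| <= \sum_(v <- V) #|` boundary v F|)%N.
Proof.
rewrite -sum1_size big_seq.
apply: (@leq_trans (\sum_(x <- (window F V `\` F)%fset) \sum_(v <- V) (x \in boundary v F))).
  rewrite [leqRHS]big_seq; apply: leq_sum => x; rewrite inE => /andP[xF].
  move=> /imfset2P[c /= cF [v]]; rewrite /= in_fset1U => /predU1P[-> xc|vV xE].
    by rewrite xc addr0 cF in xF.
  rewrite (big_rem v)//= -[leqLHS]addn0 leq_add// lt0b.
  by rewrite !inE xF/= translateP xE addrK cF.
rewrite exchange_big; apply: leq_sum => v _.
rewrite /= (eq_bigr (fun x => if x \in boundary v F then 1 else 0)%N); last first.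
  by move=> x _; case: ifP.
rewrite -big_mkcond -big_filter sum1_size; apply: uniq_leq_size; rewrite ?filter_uniq//.
by move=> x; rewrite mem_filter => /andP[].
Qed.

Lemma window_near (F : nat -> {fset A}) V (e : R) : folner R F -> 0 < e ->
  \forall n \near \oo, #|` (window (F n) V `\` F n)%fset|%:R <= e * #|` F n|%:R.
Proof.
move=> FF e0; have e1 : 0 < e / #|` V|.+1%:R by rewrite divr_gt0.
near=> n; apply: le_trans (_ : \sum_(v <- V) #|` boundary v (F n)|%:R <= _).
  by rewrite -natr_sum ler_nat card_windowD.
apply: le_trans (_ : \sum_(v <- V) e / #|` V|.+1%:R * #|` F n|%:R <= _).
  rewrite big_seq [leRHS]big_seq; apply: ler_sum.
  by near: n; apply: folner_near_seq.
rewrite sum_seq_const mulrA ler_wpM2r//.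
by rewrite mulrCA ger_pMr// ler_pdivrMr// mul1r ler_nat.
Unshelve. all: by end_near. Qed.

End windows.

Section pattern_weights.
Variables (R : realType) (K : fieldExtType rat) (b : nat -> idealr (integers K)).
Hypothesis hb : erdos_family R b.
Local Notation O := (integers K).
Implicit Types (E F W p : {fset O}).

Definition pattern E (x : config K) : {fset O} := [fset a in E | x a]%fset.

Definition realized E : {fset {fset O}} :=
  [fset p in fpowerset E | `[< exists2 x, free_shift b x & pattern E x = p >]]%fset.

Definition sieved E L t : {fset O} := [fset a in E | sieve b [fset 0]%fset L (t + a)%R]%fset.

(* By the Chinese remainder theorem each realized pattern lies below one of the
   finitely many sieved sets. *)
Lemma realized_weight E L (h : {fset O} -> R) delta M : delta <= 1 ->
  (forall a p, `|h p - h (a |` p)%fset| <= delta) ->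
  (forall t, #|` sieved E L t|%:R * ln 2 + powerset_mean (sieved E L t) h +
     #|` sieved E L t|%:R * delta ^+ 2 <= M) ->
  \sum_(p <- realized E) expR (h p) <= #|` reps b L|%:R * expR M.
Proof.
move=> d1 hd hM.
have wt t : \sum_(p <- fpowerset (sieved E L t)) expR (h p) <= expR M.
  apply: le_trans (powerset_mgf _ d1 hd) _.
  have -> : 2 ^+ #|` sieved E L t| = expR (#|` sieved E L t|%:R * ln 2) :> R.
    by rewrite expRM_natl lnK// posrE.
  by rewrite -expRD ler_expR addrA.
apply: (@le_trans _ _ (\sum_(t <- reps b L) \sum_(p <- fpowerset (sieved E L t)) expR (h p)));
  last first.
  apply: le_trans (ler_sum _ (fun t _ => wt t)) _.
  by rewrite sum_seq_const.
apply: (@le_trans _ _ (\sum_(t <- reps b L) \sum_(p <- realized E) if p \in fpowerset (sieved E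
  L t) then expR (h p) else 0)).
  rewrite exchange_big/= big_seq [leRHS]big_seq; apply: ler_sum => p.
  rewrite !inE/= => /andP[_ /asboolP[x /(free_shift_sieve hb L)[t tL tx] <-]].
  rewrite (big_rem t)//= fpowersetE ifT ?lerDl ?sumr_ge0//.
    by move=> s _; case: ifP => // _; exact: expR_ge0.
  apply/fsubsetP => a; rewrite !inE/= => /andP[-> xa]; exact: tx.
apply: ler_sum => t _; rewrite -big_mkcond/= -big_filter.
have -> : \sum_(p <- fpowerset (sieved E L t)) expR (h p) =
  \sum_(p <- [seq p <- realized E | p \in fpowerset (sieved E L t)]) expR (h p) +
  \sum_(p <- [seq p <- fpowerset (sieved E L t) | p \notin realized E]) expR (h p).
  rewrite (bigID (mem (realized E)))/= -[X in X + _]big_filter -[X in _ + X]big_filter;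
    congr (_ + _).
  apply: perm_big; apply: uniq_perm; rewrite ?filter_uniq ?fset_uniq// => p.
  by rewrite !mem_filter andbC.
by rewrite lerDl sumr_ge0// => p _; exact: expR_ge0.
Qed.

Definition occurrences (theta : R) W (F : {fset O}) p : R :=
  theta * \sum_(c <- F) (translate c W `<=` p)%fset%:R.

(** Adding [a] affects only the translates c + W through [a], and these number at most |W|. *)
Lemma occurrences_diff theta W (F : {fset O}) a p :
  `|occurrences theta W F p - occurrences theta W F (a |` p)%fset| <= `|theta| * #|` W|%:R.
Proof.
rewrite /occurrences -mulrBr -sumrB normrM ler_wpM2l//.
apply: le_trans (ler_norm_sum _ _ _) _.
apply: (@le_trans _ _ (\sum_(c <- F) (a - c \in W)%:R)).
  apply: ler_sum => c _; have [|acW] := boolP (a - c \in W).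
    by do 2!case: (_ `<=` _)%fset; rewrite ?subrr ?subr0 ?sub0r ?normrN ?normr0 ?normr1 ?lexx
      ?ler01.
  suff -> : (translate c W `<=` a |` p)%fset = (translate c W `<=` p)%fset by rewrite subrr normr0.
  apply/fsubsetP/fsubsetP => h x xc; have := h x xc; rewrite in_fset1U; last by move=> ->;
    rewrite orbT.
  by case: eqVneq => // xa; move: xc; rewrite translateP xa (negbTE acW).
rewrite -natr_sum ler_nat (eq_bigr (fun c => if (a - c)%R \in W then 1 else 0)%N); last first.
  by move=> c _; case: ifP.
rewrite -big_mkcond/= -big_filter sum1_size -(size_map (fun c => a - c)).
apply: uniq_leq_size.
  by rewrite map_inj_uniq ?filter_uniq ?fset_uniq// => c c' /addrI/oppr_inj.
by move=> x /mapP[c]; rewrite mem_filter => /andP[acW _] ->.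
Qed.

(** Linearity together with [powerset_mean_incl]; this is the origin of the factor 2^-|W| of kappa
    on [ones W]. *)
Lemma mean_occurrences theta W (F A : {fset O}) :
  powerset_mean A (occurrences theta W F) =
  theta / 2 ^+ #|` W| * \sum_(c <- F) (translate c W `<=` A)%fset%:R.
Proof.
rewrite /powerset_mean /occurrences -mulr_sumr exchange_big/= -!mulrA; congr (_ * _).
rewrite mulr_suml mulr_sumr; apply: eq_bigr => c _.
by rewrite -/(powerset_mean A _) powerset_mean_incl card_translate mulrC.
Qed.

Lemma sieved_translate E L t c W : (forall w, w \in W -> c + w \in E) ->
  (translate c W `<=` sieved E L t)%fset = sieve b W L (t + c).
Proof.
move=> cE; apply/fsubsetP/asboolP => [h w wW l lL|h x].
  have : c + w \in sieved E L t by apply: h; rewrite translateP addrAC subrr add0r.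
  rewrite !inE/= => /andP[_ /asboolP/(_ 0 (fset11 _) l lL)].
  by rewrite addr0 addrA.
move=> /imfsetP[w /= wW ->]; rewrite !inE/= cE//=.
by apply/asboolP => z; rewrite inE => /eqP -> l lL; rewrite addr0 addrA; exact: h.
Qed.

Lemma card_sieved (E F : {fset O}) L t : (F `<=` E)%fset ->
  #|` sieved E L t|%:R <= \sum_(c <- F) (sieve b [fset 0]%fset L (t + c))%:R +
    #|` (E `\` F)%fset|%:R :> R.
Proof.
move=> FE; rewrite -natr_sum -natrD ler_nat.
rewrite (eq_bigr (fun c => if sieve b [fset 0%R]%fset L (t + c)%R then 1 else 0)%N); last first.
  by move=> c _; case: ifP.
rewrite -big_mkcond/= -big_filter sum1_size -size_cat.
apply: uniq_leq_size; first exact: fset_uniq.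
move=> x; rewrite !inE/= => /andP[xE xs].
by rewrite mem_cat mem_filter xs/= inE xE andbT orbN.
Qed.

End pattern_weights.

Section folner_size.
Variables (R : realType) (K : fieldExtType rat).
Local Notation O := (integers K).

Lemma natr_integers_inj : injective (fun n : nat => n%:R : O).
Proof.
move=> n m /(congr1 (val : O -> K)).
rewrite !(rmorph_nat (val : {rmorphism O -> K})) => h.
have : (n%:R : rat) = m%:R.
  by apply: (fmorph_inj (in_alg K)); rewrite !rmorph_nat.
by move/eqP; rewrite eqr_nat => /eqP.
Qed.

(** A set of fewer than B elements whose boundaries are below 1/(B+1) of its size has empty boundary
    for the integers 0, ..., B-1, so it contains B distinct translates of one point. The growth
    absorbs the constant ln |reps b L| in the entropy bounds. *)
Lemma folner_size (F : nat -> {fset O}) B : folner R F ->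
  \forall n \near \oo, (B <= #|` F n|)%N.
Proof.
move=> FF; have B0 : 0 < B.+1%:R^-1 :> R by rewrite invr_gt0.
near=> n; rewrite leqNgt; apply/negP => lt.
have bd a : a \in [seq i%:R : O | i <- iota 0 B] -> #|` boundary a (F n)|%:R <= B.+1%:R^-1 *
  #|` F n|%:R :> R.
  by move: a; near: n; exact: folner_near_seq.
have [c cF] : exists c, c \in F n by apply/fset0Pn; exact: FF.1.
have aF i : (i < B)%N -> i%:R + c \in F n.
  move=> iB; have : i%:R \in [seq i%:R : O | i <- iota 0 B] by apply/mapP; exists i;
    rewrite ?mem_iota.
  move=> /bd h; have : #|` boundary (i%:R : O) (F n)|%:R < 1 :> R.
    apply: le_lt_trans h _; rewrite mulrC ltr_pdivrMr// mul1r ltr_nat.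
    exact: ltn_trans lt _.
  rewrite -[1]/(1%:R) ltr_nat ltnS leqn0 cardfs_eq0 => /eqP b0.
  apply: contrapT => /negP nF; have : i%:R + c \in boundary (i%:R : O) (F n).
    by rewrite !inE nF/= translateP addrAC subrr add0r cF.
  by rewrite b0 in_fset0.
move: lt; rewrite ltnNge => /negP; apply.
rewrite -{1}(size_iota 0 B) -(size_map (fun i => (i%:R + c : O))).
apply: uniq_leq_size; last by move=> x /mapP[i]; rewrite mem_iota => iB ->; exact: aF.
by rewrite map_inj_uniq ?iota_uniq// => i j /addIr/natr_integers_inj.
Unshelve. all: by end_near. Qed.

End folner_size.

(** The penalty [g] comes first: expR g >= 1 + g at g = 2k/e makes k expR (- g) at most e/2. Then
    [eps], the tolerated label error, is chosen with g + 1 as a nonzero denominator. *)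
Lemma exists_error_parameters (R : realType) k (e : R) : 0 < e ->
  exists g eps : R, [/\ 0 <= g, 0 < eps & g * eps + k%:R * expR (- g) <= e].
Proof.
move=> e0.
have [g g0 gk] : exists2 g : R, 0 <= g & k%:R * expR (- g) <= e / 2.
  exists (2 * k%:R / e); first by rewrite !divr_ge0// ?mulr_ge0// ltW.
  rewrite expRN ler_pdivrMr ?expR_gt0//.
  apply: le_trans (ler_wpM2l _ (expR_ge1Dx _)); last by rewrite divr_ge0// ltW.
  rewrite mulrDr mulr1 -[leLHS]add0r lerD//; first by rewrite divr_ge0// ltW.
  by rewrite le_eqVlt; apply/orP; left; apply/eqP; field; exact: lt0r_neq0.
have g10 : 0 < g + 1 by rewrite ltr_wpDl.
exists g, (e / 2 / (g + 1)); split; rewrite ?divr_gt0//.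
have : g * (e / 2 / (g + 1)) <= e / 2.
  rewrite mulrCA ger_pMr ?divr_gt0// ler_pdivrMr// mul1r; lra.
move: gk; lra.
Qed.

Section entropy_weight.
Variables (R : realType) (K : fieldExtType rat) (b : nat -> idealr (integers K)).
Hypothesis hb : erdos_family R b.
Local Notation O := (integers K).
Local Notation S := (@config_shift K : O -> borel (config K) -> borel (config K)).
Implicit Types (E F W p : {fset O}).

Lemma countable_bool (i : O) : countable [set: (bool : pointedType)].
Proof. exact/finite_set_countable/finite_finset. Qed.

Lemma measurable_config_shift a : measurable_fun setT (S a).
Proof. by apply: measurable_config => c; exact: (measurable_coin (a + c)). Qed.

Definition ones W : set (borel (config K)) := [set x | forall w, w \in W -> x w].

Lemma measurable_ones W : measurable (ones W).
Proof.
apply: (measurable_determined countable_bool (J := W)) => x y xy h w wW.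
by rewrite -xy// h.
Qed.

Lemma measurable_pattern E p : measurable [set x : borel (config K) | pattern E x = p].
Proof.
apply: (measurable_determined countable_bool (J := E)) => x y xy <-.
by apply/fsetP => a; rewrite !inE/=; case: (boolP (a \in E)) => //= aE; rewrite xy.
Qed.

Lemma realized_weight_near W V (theta : R) (F : nat -> {fset O}) e :
  folner R F -> (W `<=` V)%fset -> `|theta| * #|` W|%:R <= 1 -> 0 < e ->
  \forall n \near \oo,
    \sum_(p <- realized b (window (F n) V)) expR (occurrences theta W (F n) p) <=
    expR (#|` F n|%:R * (dens_all R b [fset 0]%fset * ln 2 +
      theta / 2 ^+ #|` W| * dens_all R b W + 2 * (`|theta| * #|` W|%:R) ^+ 2 + e)).
Proof.
move=> FF WV; set delta := `|theta| * _ => delta1 e0.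
have ln20 : 0 < ln 2 :> R by rewrite ln_gt0// ltr1n.
(* Errors in units of [e1]: ln 2 three times, for the limit of the densities, the sieve average and
   the window excess; |theta| twice, for the density and the average of [W]; once 1, for ln |reps b
   L|. The factor 2 before the square comes from |E| <= 2 |F|. *)
pose C : R := 3 * ln 2 + 2 * `|theta| + 1.
have C0 : 0 < C by rewrite ltr_pwDr// addr_ge0// mulr_ge0// ltW.
have [e1 [e10 e11 e1C]] : exists e1 : R, [/\ 0 < e1, e1 <= 1 & e1 * C <= e].
  exists (Num.min 1 (e / C)); split.
  - by rewrite lt_min ltr01/= !divr_gt0.
  - by rewrite ge_min lexx.
  - by rewrite -ler_pdivlMr// ge_min lexx orbT.
have /cvgrPdist_le/(_ _ e10)[L1 _ HL1] := @dens_cvg R K b hb [fset 0]%fset.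
have /cvgrPdist_le/(_ _ e10)[L2 _ HL2] := @dens_cvg R K b hb W.
(* [L] is fixed before n, so the number of representatives stays constant as n grows. *)
pose L := maxn L1 L2.
have d1 : dens R b [fset 0]%fset L <= dens_all R b [fset 0]%fset + e1.
  by have := HL1 L (leq_maxl _ _); rewrite /= ler_norml => /andP[]; lra.
have dW : theta / 2 ^+ #|` W| * dens R b W L <= theta / 2 ^+ #|` W| * dens_all R b W + `|theta|
  * e1.
  rewrite -lerBlDl -mulrBr; apply: le_trans (ler_norm _) _.
  rewrite !normrM normfV (ger0_norm (exprn_ge0 _ _))// distrC -mulrA ler_wpM2l//.
  apply: le_trans (HL2 L (leq_maxr _ _)); rewrite ler_piMl// invf_le1 ?exprn_gt0// exprn_ege1//.
  by rewrite ler1n.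
have [B BP] : exists B : nat, ln #|` reps b L|%:R / e1 <= B%:R.
  by exists (Num.truncn (ln #|` reps b L|%:R / e1)).+1; rewrite ltW// truncnS_gt.
near=> n.
have EF : #|` (window (F n) V `\` F n)%fset|%:R <= e1 * #|` F n|%:R.
  by near: n; exact: window_near.
have s0 t : `|\sum_(c <- F n) (sieve b [fset 0]%fset L (t + c))%:R -
    #|` F n|%:R * dens R b [fset 0]%fset L| <= e1 * #|` F n|%:R.
  by move: t; near: n; exact: sieve_average.
have sW t : `|\sum_(c <- F n) (sieve b W L (t + c))%:R -
    #|` F n|%:R * dens R b W L| <= e1 * #|` F n|%:R.
  by move: t; near: n; exact: sieve_average.
have repsf : ln (#|` reps b L|%:R) <= e1 * #|` F n|%:R.
  rewrite mulrC -ler_pdivrMr//; apply: le_trans BP _; rewrite ler_nat.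
  by near: n; exact: (folner_size _ FF).
pose f : R := #|` F n|%:R; have f0 : 0 < f by exact: (folner_gt0 FF).
pose E := window (F n) V.
rewrite -/f in EF s0 sW repsf *; rewrite -/E in EF.
pose M := f * (dens R b [fset 0]%fset L + e1) * ln 2 + e1 * f * ln 2 +
   (f * (theta / 2 ^+ #|` W| * dens R b W L) + `|theta| * (e1 * f)) + 2 * f * delta ^+ 2.
have FE : (F n `<=` E)%fset by exact: sub_window.
have cardE : #|` E|%:R <= 2 * f.
  have -> : #|` E|%:R = f + #|` (E `\` F n)%fset|%:R.
    by rewrite /f -natrD -(cardfsID (F n) E) (fsetIidPr FE).
  by have := ler_wpM2r (ltW f0) e11; move: EF; lra.
have HM t : #|` sieved b E L t|%:R * ln 2 + powerset_mean (sieved b E L t) (occurrences theta W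
  (F n)) +
     #|` sieved b E L t|%:R * delta ^+ 2 <= M.
  apply: lerD; first apply: lerD.
  - rewrite -mulrDl ler_wpM2r ?(ltW ln20)//.
    apply: le_trans (card_sieved R b L t FE) _; rewrite lerD//.
    by have := s0 t; rewrite ler_norml => /andP[]; rewrite mulrDr mulrC; lra.
  - rewrite mean_occurrences.
    have -> : \sum_(c <- F n) (translate c W `<=` sieved b E L t)%fset%:R =
        \sum_(c <- F n) (sieve b W L (t + c))%:R :> R.
      apply: eq_big_seq => c cF; rewrite sieved_translate// => w wW.
      by apply: mem_window => //; exact: (fsubsetP WV).
    rewrite -lerBlDl [f * (_ * _)]mulrCA -mulrBr.
    apply: le_trans (ler_norm _) _; rewrite !normrM normfV (ger0_norm (exprn_ge0 _ _))//.
    rewrite -mulrA ler_wpM2l//; apply: le_trans (sW t).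
    by rewrite ler_piMl// invf_le1 ?exprn_gt0// exprn_ege1// ler1n.
  - rewrite ler_wpM2r ?exprn_ge0// ?mulr_ge0//; apply: le_trans cardE.
    by rewrite ler_nat fsubset_leq_card//; apply/fsubsetP => a; rewrite !inE => /andP[].
apply: le_trans (realized_weight hb delta1 (fun a p => occurrences_diff theta W (F n) a p) HM) _.
have [->|r0] := posnP #|` reps b L|; first by rewrite mul0r expR_ge0.
rewrite -[#|` reps b L|%:R]lnK ?posrE ?ltr0n// -expRD ler_expR.
apply: le_trans (lerD repsf (lexx _)) _.
have -> : e1 * f + M =
   f * ((dens R b [fset 0]%fset L + e1) * ln 2 + e1 * ln 2 + theta / 2 ^+ #|` W| * dens R b W L +
     `|theta| * e1 + 2 * delta ^+ 2 + e1) by rewrite /M; ring.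
rewrite ler_wpM2l ?(ltW f0)//.
have h1 := ler_wpM2r (ltW ln20) d1; move: e1C; rewrite /C.
by move: dW h1; rewrite -/delta; lra.
Unshelve. all: by end_near. Qed.

(** A bound on each single pattern: at level [L] it lies in a sieved set of density close to D_L. It
    controls the second moment of the Mirsky measure. *)
Lemma realized_card_near (F : nat -> {fset O}) e : folner R F -> 0 < e ->
  \forall n \near \oo, forall p, p \in realized b (F n) ->
    #|` p|%:R <= #|` F n|%:R * (dens_all R b [fset 0]%fset + e).
Proof.
move=> FF e0; have e2 : 0 < e / 2 by rewrite divr_gt0.
have /cvgrPdist_le/(_ _ e2)[L _ /(_ L (leqnn L)) HL] := @dens_cvg R K b hb [fset 0]%fset.
near=> n => p; rewrite !inE/= => /andP[_ /asboolP[x Xx <-]].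
have [t _ tx] := free_shift_sieve hb L Xx.
apply: (@le_trans _ _ (#|` sieved b (F n) L t|%:R)).
  rewrite ler_nat fsubset_leq_card//; apply/fsubsetP => a; rewrite !inE/= => /andP[-> /tx //].
apply: le_trans (card_sieved R b L t (fsubset_refl _)) _.
rewrite fsetDv cardfs0 addr0.
have : `|\sum_(c <- F n) (sieve b [fset 0]%fset L (t + c))%:R -
    #|` F n|%:R * dens R b [fset 0]%fset L| <= e / 2 * #|` F n|%:R.
  by move: t {tx}; near: n; exact: sieve_average.
have := ler_wpM2l (ler0n R #|` F n|) (_ : dens R b [fset 0]%fset L <= dens_all R b [fset
  0]%fset + e / 2).
move: HL; rewrite !ler_norml => /andP[h1 h2] /(_ _) h3 /andP[h4 h5].
have := h3 ltac:(lra); move: h5; lra.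
Unshelve. all: by end_near. Qed.

Variable nu : probability (borel (config K)) R.
Hypothesis nuX : nu (free_shift b) = 1%E.
Hypothesis nuS : invariant_measure S nu.

Lemma pr_ones_shift a W : pr nu (S a @^-1` ones W) = pr nu (ones W).
Proof. by rewrite /pr nuS//; exact: measurable_ones. Qed.

Lemma expected_occurrences theta W F E :
  (forall c w, c \in F -> w \in W -> c + w \in E) ->
  \sum_(p <- realized b E) pr nu [set x | pattern E x = p] * occurrences theta W F p =
  theta * #|` F|%:R * pr nu (ones W).
Proof.
move=> FE; under eq_bigr do rewrite /occurrences mulrCA mulr_sumr.
rewrite -mulr_sumr exchange_big/= -mulrA; congr (_ * _).
rewrite -sum_seq_const big_seq [RHS]big_seq; apply: eq_bigr => c cF.
have mS : measurable (S c @^-1` ones W).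
  by have := measurable_config_shift c measurableT (measurable_ones W); rewrite setTI.
have mX := measurable_free_shift hb.
have X1 : pr nu (free_shift b) = 1 by rewrite /pr nuX.
rewrite -(pr_ones_shift c) -(pr_full mX X1 mS).
rewrite (pr_partition nu (fset_uniq (realized b E)) (measurable_pattern E)); last first.
- move=> x [Xx _]; rewrite !inE/= fpowersetE; apply/andP; split.
    by apply/fsubsetP => a; rewrite !inE => /andP[].
  by apply/asboolP; exists x.
- exact: measurableI.
apply: eq_bigr => p _; have [h|h] := boolP (translate c W `<=` p)%fset.
  rewrite mulr1 -(pr_full mX X1 (measurable_pattern E p)); congr pr.
  apply/seteqP; split=> x [Xx xp]; last by case: Xx.
    split => //; split => // w wW; have : c + w \in p.
      by apply: (fsubsetP h); rewrite translateP addrAC subrr add0r.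
    by rewrite -xp !inE => /andP[].
rewrite mulr0 (_ : _ `&` _ = set0) ?pr0//; apply/seteqP; split => // x [[_ xW] xp].
move/negP: h; apply; apply/fsubsetP => y /imfsetP[w /= wW ->].
by rewrite -xp !inE/= FE//=; exact: xW.
Qed.

Lemma join_entropyE k (xi : borel (config K) -> 'I_k) (F : {fset O}) :
  ln 2 * join_entropy S nu xi F =
  - \sum_(q : {ffun F -> 'I_k})
      pr nu [set x | forall a : F, xi (S (val a) x) = q a] *
      ln (pr nu [set x | forall a : F, xi (S (val a) x) = q a]).
Proof.
rewrite /join_entropy mulrN mulr_sumr; congr (- _); apply: eq_bigr => q _.
have ln20 : ln 2 != 0 :> R by rewrite gt_eqF// ln_gt0// ltr1n.
by rewrite /log2 mulrCA; congr (_ * _); rewrite mulrC divfK.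
Qed.

(** Patterns on a window determine the occurrences of [W] and, up to a small error, all labels.
    Gibbs' inequality trades the law [nu] for a weighted count of realized patterns, so the right
    side depends on neither [nu] nor [xi]. *)
Lemma entropy_weight_bound k (xi : borel (config K) -> 'I_k) W (theta : R)
    (F : nat -> {fset O}) e :
  measurable_labelling xi -> folner R F -> `|theta| * #|` W|%:R <= 1 -> 0 < e ->
  \forall n \near \oo,
    ln 2 * join_entropy S nu xi (F n) + theta * #|` F n|%:R * pr nu (ones W) <=
    #|` F n|%:R * (dens_all R b [fset 0]%fset * ln 2 +
      theta / 2 ^+ #|` W| * dens_all R b W + 2 * (`|theta| * #|` W|%:R) ^+ 2 + e).
Proof.
move=> mxi FF; set delta := `|theta| * _ => delta1 e0.
have ln20 : 0 < ln 2 :> R by rewrite ln_gt0// ltr1n.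
have e4 : 0 < e / 4 by rewrite divr_gt0.
have [g [eps [g0 eps0 geps]]] := exists_error_parameters k e4.
have [J [eta [etaJ [meta petas]]]] := labelling_approx countable_bool nu mxi eps0.
pose V := (W `|` J)%fset.
near=> n.
have wt : \sum_(p <- realized b (window (F n) V)) expR (occurrences theta W (F n) p) <=
    expR (#|` F n|%:R * (dens_all R b [fset 0]%fset * ln 2 +
      theta / 2 ^+ #|` W| * dens_all R b W + 2 * delta ^+ 2 + e / 4)).
  by near: n; apply: realized_weight_near => //; exact: fsubsetUl.
pose f : R := #|` F n|%:R; have f0 : 0 < f by exact: (folner_gt0 FF).
pose E := window (F n) V; rewrite -/f -/E in wt *.
pose lab (a : F n) x := xi (S (val a) x).
(* [eta] is evaluated on the indicator of [p] shifted by [a]. Outside the window this need not agree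
   with [x], but [eta] reads only coordinates in [J]. *)
pose eta' p (a : F n) := eta (fun c : O => (val a + c)%R \in p).
have mshift a (C1 : set (borel (config K))) : measurable C1 -> measurable (S a @^-1` C1).
  by move=> mB; have := measurable_config_shift a measurableT mB; rewrite setTI.
have mlab a : measurable_labelling (lab a).
  by move=> i; exact: (mshift (val a) _ (mxi i)).
have mX := measurable_free_shift hb.
have X1 : pr nu (free_shift b) = 1 by rewrite /pr nuX.
have Xreal x : free_shift b x -> pattern E x \in realized b E.
  move=> Xx; rewrite !inE/= fpowersetE; apply/andP; split.
    by apply/fsubsetP => a; rewrite !inE => /andP[].
  by apply/asboolP; exists x.
have lab_eta a : measurable [set x | lab a x != eta' (pattern E x) a] /\
    pr nu [set x | lab a x != eta' (pattern E x) a] <= eps.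
  have -> : [set x | lab a x != eta' (pattern E x) a] = S (val a) @^-1` [set x | xi x != eta x].
    apply/seteqP; split=> x /=; rewrite /lab /eta'.
      rewrite (etaJ _ (S (val a) x))// => j jJ; rewrite !inE/=.
      by rewrite (mem_window (valP a)) ?in_fsetU ?jJ ?orbT.
    rewrite -(etaJ (fun c : O => (val a + c)%R \in pattern E x))// => j jJ; rewrite !inE/=.
    by rewrite (mem_window (valP a)) ?in_fsetU ?jJ ?orbT.
  by split; [exact: mshift|rewrite /pr nuS].
have := join_entropy_bound (occurrences theta W (F n)) mlab (measurable_pattern E) mX X1
  (fset_uniq _) Xreal g0 lab_eta.
rewrite -join_entropyE (@expected_occurrences theta W (F n) E); last first.
  by move=> c w cF wW; apply: mem_window => //; rewrite in_fsetU wW.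
move=> H; apply: le_trans H _; rewrite -cardfE -/f.
have Z0 : 0 < \sum_(p <- realized b E) expR (occurrences theta W (F n) p).
  apply: (sum_gt0_of_mass (J := fun p => pr nu (free_shift b `&` [set x | pattern E x = p]))).
    by move=> p; exact: expR_gt0.
  rewrite -X1 [RHS](pr_partition nu (fset_uniq (realized b E)) (measurable_pattern E))//.
rewrite -ler_ln ?posrE ?expR_gt0// expRK in wt; apply: le_trans (lerD wt (lexx _)) _.
by rewrite -mulrDr ler_wpM2l ?(ltW f0)//; move: geps; lra.
Unshelve. all: by end_near. Qed.

End entropy_weight.

(** * Entropies as limits along Følner sequences *)

Section folner_limit.
Variables (R : realType) (A : zmodType).
Implicit Type u : {fset A} -> R.

(* folner_lim is 0 when no limit exists, so the Ornstein-Weiss lemma can be avoided. *)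
Lemma folner_limP u :
  (forall F, folner R F -> u (F n) @[n --> \oo] --> folner_lim u) \/ folner_lim u = 0.
Proof.
have [h|h] := pselect (exists l : R, forall F, folner R F -> u (F n) @[n --> \oo] --> l).
  by left; exact: (getPex h).
by right; apply: getPN => l hl; apply: h; exists l.
Qed.

(** The sequence [F] matters: if no Følner sequence existed, every real would be a common limit. *)
Lemma folner_lim_eq u l (F : nat -> {fset A}) : folner R F ->
  (forall F, folner R F -> u (F n) @[n --> \oo] --> l) -> folner_lim u = l.
Proof.
move=> FF h; have := @getPex _ [set l : R | forall F, folner R F -> u (F n) @[n --> \oo] --> l].
move=> /(_ (ex_intro _ l h))/(_ F FF) h'.
exact: (cvg_unique _ h' (h F FF)).
Qed.

(** One sequence suffices for an upper bound; 0 <= c takes care of the default value. *)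
Lemma folner_lim_le u c (F : nat -> {fset A}) : folner R F -> 0 <= c ->
  (forall e, 0 < e -> \forall n \near \oo, u (F n) <= c + e) -> folner_lim u <= c.
Proof.
move=> FF c0 h; have [/(_ F FF) ul|->//] := folner_limP u.
apply/ler_addgt0Pr => e e0.
exact: (cvgr_to_le ul (h e e0)).
Qed.

End folner_limit.

Section integers_folner.
Variables (R : realType) (K : fieldExtType rat).

Lemma integers_folner_exists : exists F : nat -> {fset integers K}, folner R F.
Proof. exact: (folner_exists R (@choice.pickleK_inv (integers K))). Qed.

End integers_folner.

Section density_gt0.
Variables (R : realType) (K : fieldExtType rat) (b : nat -> idealr (integers K)).
Hypothesis hb : erdos_family R b.

(** Weierstrass' product inequality, from (1 - s)(1 - x) >= 1 - s - x. *)
Lemma prod_one_minus_ge (x : nat -> R) L n : (forall l, 0 <= x l <= 1) ->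
  1 - \sum_(L <= l < n) x l <= \prod_(L <= l < n) (1 - x l).
Proof.
move=> x01; have [nL|Ln] := leqP n L; first by rewrite !big_geq// subr0.
rewrite -(subnKC (ltnW Ln)); elim: (n - L)%N => [|k IH].
  by rewrite addn0 !big_geq// subr0.
rewrite addnS !big_nat_recr ?leq_addr//=.
have := x01 (L + k)%N => /andP[h0 h1].
have p1 : \prod_(L <= l < (L + k)%N) (1 - x l) <= 1.
  rewrite big_seq; apply: prodr_ile1 => l _; have /andP[? ?] := x01 l; apply/andP; lra.
have := ler_wpM2r (_ : 0 <= 1 - x (L + k)%N) IH.
move=> /(_ ltac:(lra)) h; apply: le_trans h.
have s0 : 0 <= \sum_(L <= l < (L + k)%N) x l by apply: sumr_ge0 => l _; have /andP[] := x01 l.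
nra.
Qed.

(** Summability makes a tail of the series at most 1/2, hence the tail product at least 1/2; the
    finite head [c] is positive as every norm is at least 2. *)
Lemma density_gt0 : 0 < dens_all R b [fset 0]%fset.
Proof.
pose x l : R := (ideal_norm (b l))%:R^-1.
have N1 l := ideal_norm_gt1 hb l.
have x01 l : 0 <= x l <= 2^-1.
  rewrite invr_ge0 ler0n/= lef_pV2 ?posrE ?ltr0n ?ler_nat//; exact: ltn_trans (N1 l).
have x1 l : 0 <= x l <= 1 by have /andP[? ?] := x01 l; apply/andP; lra.
have [L HL] : exists L, forall n, \sum_(L <= l < n) x l <= 2^-1.
  have x0 l : (0 <= (x l)%:E)%E by rewrite lee_fin; have /andP[] := x01 l.
  have /fine_cvgP[[L1 _ HL1] /cvgr_le/(_ 2^-1)] :=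
    @nneseries_tail_cvg R (fun l => (x l)%:E) xpredT (erdos_summable hb) (fun l _ => x0 l).
  rewrite invr_gt0 ltr0n => /(_ isT)[L2 _ HL2].
  exists (maxn L1 L2) => n; rewrite -lee_fin.
  apply: le_trans (_ : \sum_(maxn L1 L2 <= k <oo) (x k)%:E <= _)%E.
    by rewrite -sumEFin; apply: nneseries_lim_ge => k _ _; exact: x0.
  rewrite -[leLHS]fineK ?lee_fin; first exact: (HL2 _ (leq_maxr _ _)).
  exact: (HL1 _ (leq_maxl _ _)).
pose c := \prod_(0 <= l < L) (1 - x l).
have c0 : 0 < c.
  by rewrite /c; apply: prodr_gt0 => l _; have /andP[_ h] := x01 l; lra.
apply: lt_le_trans (_ : c / 2 <= _); first by rewrite divr_gt0.
apply: (cvgr_to_ge (@dens_cvg R K b hb [fset 0]%fset)).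
exists L => // n /= Ln; rewrite dens1// (big_cat_nat (leq0n L) Ln)/= -/c ler_wpM2l ?(ltW c0)//.
apply: le_trans _ (prod_one_minus_ge L n x1); have := HL n; lra.
Qed.

End density_gt0.

Section maximal_measures.
Variables (R : realType) (K : fieldExtType rat) (b : nat -> idealr (integers K)).
Hypothesis hb : erdos_family R b.
Local Notation O := (integers K).
Local Notation S := (@config_shift K : O -> borel (config K) -> borel (config K)).
Local Notation d := (dens_all R b [fset 0]%fset).
Variable nu : probability (borel (config K)) R.
Hypothesis nuX : nu (free_shift b) = 1%E.
Hypothesis nuS : invariant_measure S nu.

Lemma entropy_limit_le k (xi : borel (config K) -> 'I_k) (F : nat -> {fset O}) W theta h :
  measurable_labelling xi -> folner R F -> `|theta| * #|` W|%:R <= 1 ->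
  join_entropy S nu xi (F n) / #|` F n|%:R @[n --> \oo] --> h ->
  ln 2 * h + theta * pr nu (ones W) <=
    d * ln 2 + theta / 2 ^+ #|` W| * dens_all R b W + 2 * (`|theta| * #|` W|%:R) ^+ 2.
Proof.
move=> mxi FF theta1 hl; apply/ler_addgt0Pr => e e0.
have lim : ln 2 * (join_entropy S nu xi (F n) / #|` F n|%:R) + theta * pr nu (ones W)
    @[n --> \oo] --> ln 2 * h + theta * pr nu (ones W).
  by apply: cvgD; [apply: cvgMr|exact: cvg_cst].
apply: (cvgr_to_le lim); have := entropy_weight_bound hb nuX nuS mxi FF theta1 e0.
apply: filterS => n; have f0 := folner_gt0 FF n.
rewrite -ler_pdivrMl// => h'; apply: le_trans h'.
rewrite le_eqVlt; apply/orP; left; apply/eqP; field.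
by rewrite gt_eqF.
Qed.

Lemma labelling_entropy_le k (xi : borel (config K) -> 'I_k) :
  measurable_labelling xi -> folner_lim (fun F => join_entropy S nu xi F / #|` F|%:R) <= d.
Proof.
move=> mxi; have [F FF] := integers_folner_exists R K.
have [/(_ F FF) h|->] := folner_limP (fun F => join_entropy S nu xi F / #|` F|%:R); last first.
  exact/ltW/density_gt0.
(* At theta = 0 with empty [W] the weights are all 1 and only the number of patterns remains. *)
have := @entropy_limit_le _ _ _ fset0 0 _ mxi FF _ h.
rewrite normr0 mul0r ler01 => /(_ isT).
by rewrite !mul0r expr0n/= mulr0 !addr0 mulrC ler_pM2r// ln_gt0// ltr1n.
Qed.

Lemma ks_entropy_le : (ks_entropy S nu <= d%:E)%E.
Proof.
by apply: ge_ereal_sup => _ [k [xi mxi ->]]; rewrite lee_fin labelling_entropy_le.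
Qed.

(* The linear term in theta of the entropy bound must vanish for theta of both signs,
   as the remainder is quadratic. *)
Lemma maximal_ones : ks_entropy S nu = d%:E ->
  forall W, pr nu (ones W) = dens_all R b W / 2 ^+ #|` W|.
Proof.
move=> ksd W; have d0 := density_gt0 hb; have [F FF] := integers_folner_exists R K.
have ln20 : 0 < ln 2 :> R by rewrite ln_gt0// ltr1n.
pose x := pr nu (ones W) - dens_all R b W / 2 ^+ #|` W|.
have main theta : `|theta| * #|` W|%:R <= 1 -> theta * x <= 2 * (`|theta| * #|` W|%:R) ^+ 2.
  move=> theta1; apply/ler_addgt0Pr => e e0.
  (* The bound d / 2 keeps d - e' positive, so that a labelling of larger entropy has a genuine
     limit and not the default 0; e / ln 2 accounts for the natural logarithms. *)
  pose e' := Num.min (e / ln 2) (d / 2).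
  have e'0 : 0 < e' by rewrite lt_min !divr_gt0.
  have e'd : e' < d by rewrite gt_min; apply/orP; right; lra.
  have : ((d - e')%:E < ks_entropy S nu)%E by rewrite ksd lte_fin; lra.
  move=> /ereal_sup_gt[_ [k [xi mxi ->]]]; rewrite lte_fin.
  have [/(_ F FF) h|->] := folner_limP (fun F => join_entropy S nu xi F / #|` F|%:R); last lra.
  move=> hd; have := entropy_limit_le mxi FF theta1 h.
  have e'ln : e' * ln 2 <= e by rewrite -ler_pdivlMr// ge_min lexx.
  have : ln 2 * (d - e') < ln 2 * folner_lim (fun F => join_entropy S nu xi F / #|` F|%:R).
    by rewrite ltr_pM2l.
  rewrite /x mulrBr mulrA [theta / _ * _]mulrAC; lra.
have wm theta : 0 < theta -> theta * #|` W|%:R <= 1 -> `|x| <= 2 * theta * #|` W|%:R ^+ 2.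
  move=> t0 t1; rewrite -(ler_pM2l t0).
  have E : theta * (2 * theta * #|` W|%:R ^+ 2) = 2 * (theta * #|` W|%:R) ^+ 2 by ring.
  rewrite E; have h1 := main theta; have h2 := main (- theta).
  rewrite normrN (gtr0_norm t0) in h1 h2.
  have [x0|x0] := ger0P x; first exact: h1.
  by rewrite mulrN -mulNr; exact: h2.
suff x0 : x = 0 by apply/eqP; rewrite -subr_eq0 -/x x0.
apply/eqP; rewrite -normr_le0; apply/ler_addgt0Pr => e e0; rewrite add0r.
have w0 : 0 < #|` W|%:R + 1 :> R by rewrite ltr_wpDl.
(* The first term ensures theta |W| <= 1, the second 2 theta |W|^2 <= e; adding 1 covers empty
   [W]. *)
pose theta := Num.min (#|` W|%:R + 1)^-1 (e / 2 / (#|` W|%:R + 1) ^+ 2).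
have t0 : 0 < theta by rewrite lt_min invr_gt0 w0/= !divr_gt0// exprn_gt0.
have t1 : theta * (#|` W|%:R + 1) <= 1 by rewrite -ler_pdivlMr// div1r ge_min lexx.
have t2 : theta * (#|` W|%:R + 1) ^+ 2 <= e / 2.
  by rewrite -ler_pdivlMr ?exprn_gt0// ge_min lexx orbT.
apply: le_trans (wm theta t0 _) _.
  by apply: le_trans t1; rewrite ler_pM2l// lerDl.
have : #|` W|%:R ^+ 2 <= (#|` W|%:R + 1) ^+ 2 :> R by rewrite lerXn2r ?nnegrE ?addr_ge0// lerDl.
move=> /(ler_wpM2l (ltW t0)); lra.
Qed.

End maximal_measures.

Section uniqueness.
Variables (R : realType) (K : fieldExtType rat).
Local Notation O := (integers K).

(* The sets ones W form a pi-system generating the Borel sets. *)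
Lemma ones_unique (m1 m2 : probability (borel (config K)) R) :
  (forall W, pr m1 (ones W) = pr m2 (ones W)) ->
  forall B, measurable B -> m1 B = m2 B.
Proof.
move=> m12.
apply: (@product_measure_unique R O (fun=> bool : pointedType) (@countable_bool K) (range
  (@ones K))).
- move=> _ _ [W _ <-] [V _ <-]; exists (W `|` V)%fset => //.
  apply/seteqP; split=> [x h|x [hW hV] w].
    by split=> w wW; apply: h; rewrite in_fsetU wW ?orbT.
  by rewrite in_fsetU => /orP[]; [exact: hW|exact: hV].
- by exists fset0 => //; apply/seteqP; split=> x.
- by move=> _ [W _ <-]; exact: measurable_ones.
- have Gi i : <<s range (@ones K) >> [set x : config K | x i].
    apply: sub_sigma_algebra; exists [fset i]%fset => //.
    apply/seteqP; split=> [x h|x xi w]; first by apply: h; rewrite inE.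
    by rewrite inE => /eqP ->.
  move=> i [|]; first exact: Gi.
  rewrite (_ : [set _ | _] = setT `\` [set x : config K | x i]).
    by have [_ h _] := smallest_sigma_algebra setT (range (@ones K)); exact: h.
  apply/seteqP; split=> x /=; first by move=> xi; split => //; rewrite xi.
  by case=> _ /negP/negbTE.
- by move=> _ [W _ <-]; rewrite [LHS]prE ?[RHS]prE ?m12//; exact: measurable_ones.
Qed.

End uniqueness.

(** * The maximal measure *)

Section kappa.
Variables (R : realType) (K : fieldExtType rat) (b : nat -> idealr (integers K)).
Hypothesis hb : erdos_family R b.
Local Notation O := (integers K).
Local Notation S := (@config_shift K : O -> borel (config K) -> borel (config K)).
Local Notation d := (dens_all R b [fset 0]%fset).
Local Notation haar := (haar R b).
Local Notation coins := (coins R K).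
Local Notation kappa := (kappa R b).
Implicit Types (W J : {fset O}) (g : borel (phases b)).

Lemma measurable_config_cylinder J (e : O -> bool) :
  measurable [set w : borel (config K) | forall i, i \in J -> w i = e i].
Proof. exact: (measurable_cylinder (@countable_bool K) J e). Qed.

(** If [e] asks for a one at a position of [J] outside [A], both sides vanish. Otherwise positions
    outside [A] impose nothing, and the event is a coin cylinder on the rest of [J]. *)
Lemma coins_thinned (A : O -> bool) J (e : O -> bool) :
  pr coins [set w | forall i, i \in J -> A i && w i = e i] =
  \prod_(i <- J) (if A i then 2^-1 else (~~ e i)%:R) /\
  measurable [set w : borel (config K) | forall i, i \in J -> A i && w i = e i].
Proof.
have [[i [iJ Ai ei]]|nE] := pselect (exists i, [/\ i \in J, ~~ A i & e i]).
  rewrite (_ : [set _ | _] = set0).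
    by rewrite pr0 (big_rem i)//= (negbTE Ai) ei mul0r.
  apply/seteqP; split => // w /(_ i iJ); rewrite (negbTE Ai) ei.
  by [].
rewrite (_ : [set _ | _] = [set w | forall i, i \in [fset i in J | A i]%fset -> w i = e i]);
  last first.
  apply/seteqP; split=> w /= h i.
    by rewrite !inE/= => /andP[iJ Ai]; rewrite -h// Ai.
  move=> iJ; have [Ai|Ai] := boolP (A i); first by rewrite h// !inE iJ.
  by apply/esym/negbTE/negP => ei; apply: nE; exists i.
split; last exact: measurable_config_cylinder.
rewrite /pr [X in fine X](@coinsP R K _ _)/= -big_fset_condE/= big_mkcond/=.
apply: eq_big_seq => i iJ; case: ifP => // /negbT Ai.
by rewrite (_ : ~~ e i = true)//; apply/negP => ei; apply: nE; exists i.
Qed.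

Definition Phi_section g (w : borel (config K)) : borel (config K) := Phi (g, w).

Lemma measurable_Phi_section g : measurable_fun setT (Phi_section g).
Proof.
by apply: measurableT_comp.
Qed.

HB.instance Definition _ g := @isMeasurableFun.Build _ _
  (borel (config K)) (borel (config K)) (Phi_section g) (measurable_Phi_section g).

Lemma in_allowed g a : (a \in allowed g) = phi g a.
Proof. by apply/idP/idP; rewrite inE. Qed.

(** The image of [coins] under [Phi_section g] satisfies the law defining [kappa_phase]: this shows
    at once that the [get] succeeds and, by uniqueness, what it returns. *)
Lemma kappa_phaseE g B : measurable B ->
  kappa_phase R b g B = coins [set w | B (Phi (g, w))].
Proof.
pose m a (v : bool) : R := if a \in allowed g then 2^-1 else (~~ v)%:R.
have law : is_product_law m (distribution coins (Phi_section g)).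
  move=> J e; rewrite /distribution /pushforward.
  have [h mh] := coins_thinned (phi g) J e.
  rewrite [LHS](prE coins mh) h; congr (_%:E); apply: eq_bigr => i _.
  by rewrite /m in_allowed.
move=> mB.
apply: (product_law_unique (@countable_bool K) (m := m) (m2 := distribution coins (Phi_section
  g))) => //.
apply: (@getPex _ (is_product_law m)).
by exists (distribution coins (Phi_section g) : probability (borel (config K)) R).
Qed.

(** The product measure is the Haar integral of the coin measures of sections, and the section at
    [g] has measure [kappa_phase R b g B]. *)
Lemma kappa_disintegration B : measurable B ->
  measurable_fun [set: borel (phases b)] (kappa_phase R b ^~ B) /\
  kappa B = (\int[haar]_g kappa_phase R b g B)%E.
Proof.
move=> mB; have mPB : measurable (@Phi K b @^-1` B : set (borel (phases b) * borel (config K))).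
  by rewrite -[X in measurable X]setTI; exact: measurable_Phi.
have E g : kappa_phase R b g B = coins (xsection (@Phi K b @^-1` B) g).
  by rewrite kappa_phaseE//; congr (coins _); apply/seteqP; split=> w /=; rewrite /xsection/= inE.
split.
  apply: (eq_measurable_fun (coins \o xsection (@Phi K b @^-1` B))) => [g _|].
    by rewrite E.
  exact: measurable_fun_xsection.
by apply: eq_integral => g _; rewrite E.
Qed.

Lemma pr_prod (A1 : set (borel (phases b))) (A2 : set (borel (config K))) :
  measurable A1 -> measurable A2 ->
  pr (haar \x coins)%E (A1 `*` A2) = pr haar A1 * pr coins A2.
Proof.
move=> mA1 mA2; rewrite /pr [X in fine X]product_measure1E//.
by rewrite fineM// fin_num_measure.
Qed.

Lemma kappa_ones W : pr kappa (ones W) = dens_all R b W / 2 ^+ #|` W|.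
Proof.
have E : @Phi K b @^-1` ones W = avoids_all W `*` ones W.
  apply/seteqP; split=> [[g w] h|[g w] [/= h1 h2] i iW].
    by split=> i iW; have := h i iW; rewrite /Phi/= => /andP[].
  by rewrite /Phi/= h1// h2.
transitivity (pr (haar \x coins)%E (avoids_all W `*` ones W)); first by rewrite /pr -E.
rewrite pr_prod; [|exact: (measurable_avoids_all hb)|exact: measurable_ones].
congr (_ * _); have := @coinsP R K W (fun=> true); rewrite /pr => -> /=.
by rewrite big_const_seq count_predT iter_mulr_1 exprVn.
Qed.

Lemma Phi_free_shift gw : free_shift b (@Phi K b gw).
Proof. by apply: (phi_free_shift hb (g := gw.1)) => a /andP[]. Qed.

Lemma kappa_free_shift : kappa (free_shift b) = 1%E.
Proof.
have E : @Phi K b @^-1` free_shift b = setT.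
  by apply/seteqP; split => // gw _; exact: Phi_free_shift.
transitivity ((haar \x coins)%E (@Phi K b @^-1` free_shift b)) => //.
by rewrite E probability_setT.
Qed.

Definition borel_shift (a : O) : borel (config K) -> borel (config K) := S a.

HB.instance Definition _ a := @isMeasurableFun.Build _ _
  (borel (config K)) (borel (config K)) (borel_shift a) (measurable_config_shift a).

Lemma shift_ones a W : S a @^-1` ones W = ones (translate a W).
Proof.
apply/seteqP; split=> x h w.
  by move=> /imfsetP[v /= vW ->]; exact: h.
by move=> wW; apply: h; apply/imfsetP; exists w.
Qed.

(** It is enough to test the sets [ones W], where invariance is that of [dens_all] under
    translation. *)
Lemma kappa_invariant : invariant_measure S kappa.
Proof.
move=> a B mB.
apply: (@ones_unique R K (distribution kappa (borel_shift a)) kappa _ B mB) => W.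
transitivity (pr kappa (ones (translate a W))); first by rewrite -shift_ones.
by rewrite !kappa_ones dens_all_translate// card_translate.
Qed.

End kappa.

Section kappa_entropy.
Variables (R : realType) (K : fieldExtType rat) (b : nat -> idealr (integers K)).
Hypothesis hb : erdos_family R b.
Local Notation O := (integers K).
Local Notation S := (@config_shift K : O -> borel (config K) -> borel (config K)).
Local Notation d := (dens_all R b [fset 0]%fset).
Local Notation haar := (haar R b).
Local Notation coins := (coins R K).
Local Notation kappa := (kappa R b).
Implicit Types (g : borel (phases b)).

Definition coord (x : borel (config K)) : 'I_2 := if x 0 then ord_max else ord0.

Lemma coord_shift a x (j : 'I_2) : coord (S a x) = j <-> x a = (j == ord_max).
Proof.
rewrite /coord /config_shift addr0.
case: (x a); split; [by move=> <-|by move=> /esym/eqP ->|by move=> <-|].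
by case: j => -[|[|//]] i //= _; exact: val_inj.
Qed.

Lemma measurable_coord : measurable_labelling coord.
Proof.
move=> j; rewrite (_ : _ @^-1` _ = [set x | x 0 = (j == ord_max)]).
  exact: (measurable_coordinate (E := fun=> bool : pointedType) (i := 0) [set v | v = (j ==
    ord_max)]).
have S0 (x : config K) : S 0 x = x by apply/funext => c; rewrite /config_shift add0r.
apply/seteqP; split=> x /= h; first by apply/coord_shift; rewrite S0.
by rewrite -(S0 x); exact/coord_shift.
Qed.

Variable F : {fset O}.

Definition allowed_pattern g : {ffun F -> bool} := [ffun a => phi g (val a)].

Definition weight (A : {ffun F -> bool}) : R := pr haar [set g | allowed_pattern g = A].

Lemma measurable_allowed a : measurable [set g : borel (phases b) | phi g a].
Proof.
by have := @measurable_phi K b measurableT _ (measurable_coin a); rewrite setTI.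
Qed.

Lemma measurable_allowed_pattern A : measurable [set g | allowed_pattern g = A].
Proof.
rewrite (_ : [set _ | _] = \bigcap_(a in [set: F]) [set g | phi g (val a) = A a]).
  apply: fin_bigcap_measurable => // a _; case: (A a); first exact: measurable_allowed.
  rewrite (_ : [set _ | _] = ~` [set g | phi g (val a)]).
    exact: measurableC (measurable_allowed (val a)).
  by apply/seteqP; split=> g /=; [move=> ->|move/negP/negbTE].
apply/seteqP; split=> g /=; first by move=> <- a _; rewrite ffunE.
by move=> h; apply/ffunP => a; rewrite ffunE; exact: h.
Qed.

Lemma weight_ge0 A : 0 <= weight A. Proof. exact: pr_ge0. Qed.

Lemma sum_weight : \sum_A weight A = 1.
Proof.
rewrite -(prT haar) (pr_partition haar (index_enum_uniq _) measurable_allowed_pattern measurableT).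
  by apply: eq_bigr => A _; rewrite setTI.
by move=> g _; rewrite mem_index_enum.
Qed.

Lemma weight_count : \sum_A weight A * (\sum_a (A a)%:R) = #|` F|%:R * d.
Proof.
under eq_bigr do rewrite mulr_sumr.
rewrite exchange_big/= -sum_seq_const big_seq_fsetE/=; apply: eq_bigr => a _.
rewrite -(dens_all_translate hb (val a)) /dens_all.
have -> : @avoids_all K b (translate (val a) [fset 0]%fset) = [set g | phi g (val a)].
  apply/seteqP; split=> g /=.
    by apply; rewrite translateP subrr inE.
  by move=> ga w; rewrite translateP inE subr_eq0 => /eqP ->.
rewrite (pr_partition haar (index_enum_uniq _) measurable_allowed_pattern (measurable_allowed
  _)); last first.
  by move=> g _; rewrite mem_index_enum.
apply: eq_bigr => A _; have [Aa|Aa] := boolP (A a).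
  rewrite mulr1 /weight; congr pr; apply/seteqP; split=> g /=; last by case.
  by move=> gA; split => //; move: Aa; rewrite -gA ffunE.
rewrite mulr0 (_ : _ `&` _ = set0) ?pr0//; apply/seteqP; split => // g [/= ga gA].
by move: Aa; rewrite -gA ffunE ga.
Qed.

(** The Haar mean of the number of allowed positions in [F] is |F| d, so not all phases fall short
    of it. Patterns attained by no phase have weight 0. *)
Lemma exists_dense_phase : exists g, #|` F|%:R * d <= (\sum_(a <- F) phi g a)%:R :> R.
Proof.
apply: contrapT => H.
have lt g : (\sum_(a <- F) phi g a)%:R < #|` F|%:R * d :> R.
  by rewrite ltNge; apply/negP => h; apply: H; exists g.
have s0 : \sum_A weight A * (#|` F|%:R * d - \sum_a (A a)%:R) = 0.
  under eq_bigr do rewrite mulrBr.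
  by rewrite sumrB weight_count -mulr_suml sum_weight mul1r subrr.
have t0 A : 0 <= weight A * (#|` F|%:R * d - \sum_a (A a)%:R) /\
    (weight A * (#|` F|%:R * d - \sum_a (A a)%:R) = 0 -> weight A = 0).
  have [[g gA]|nA] := pselect (exists g, allowed_pattern g = A); last first.
    rewrite /weight (_ : [set _ | _] = set0) ?pr0 ?mul0r//.
    by apply/seteqP; split => // g gA; apply: nA; exists g.
  have := lt g; rewrite natr_sum big_seq_fsetE/= -subr_gt0.
  have -> : \sum_(a : F) (phi g (val a))%:R = \sum_a (A a)%:R :> R.
    by apply: eq_bigr => a _; rewrite -gA ffunE.
  move=> p; split; first by rewrite mulr_ge0 ?weight_ge0// ltW.
  by move=> /eqP; rewrite mulf_eq0 (gt_eqF p) orbF => /eqP.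
have w0 A : weight A = 0.
  by apply: (t0 A).2; apply: (psumr_eq0P _ s0) => // A' _; exact: (t0 A').1.
have := sum_weight; rewrite big1 => [/esym/eqP|A _]; last exact: w0.
by rewrite oner_eq0.
Qed.

Definition thinned_weight (A : {ffun F -> bool}) (q : {ffun F -> 'I_2}) : R :=
  \prod_a (if A a then 2^-1 else (q a != ord_max)%:R).

Lemma kappa_mixture (q : {ffun F -> 'I_2}) :
  pr kappa [set x | forall a : F, coord (S (val a) x) = q a] =
  \sum_A weight A * thinned_weight A q.
Proof.
set C := [set x | _].
have CE : C = [set x | forall a : F, x (val a) = (q a == ord_max)].
  by apply/seteqP; split=> x h a; have := h a; move=> /coord_shift.
have mC : measurable (C : set (borel (config K))).
  rewrite CE (_ : [set _ | _] = \bigcap_(a in [set: F]) [set x | x (val a) = (q a == ord_max)]).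
    apply: fin_bigcap_measurable => // a _.
    exact: (measurable_coordinate (E := fun=> bool : pointedType) (i := val a) [set v | v = (q
      a == ord_max)]).
  by apply/seteqP; split=> x h; [move=> a _; exact: h|move=> a; exact: h].
have mPC : measurable (@Phi K b @^-1` C : set (borel (phases b) * borel (config K))).
  by rewrite -[X in measurable X]setTI; exact: measurable_Phi.
transitivity (pr (haar \x coins)%E (@Phi K b @^-1` C)) => //.
have mY A : measurable [set gw : borel (phases b) * borel (config K) | allowed_pattern gw.1 = A].
  rewrite (_ : [set _ | _] = [set g | allowed_pattern g = A] `*` setT).
    by apply: measurableX => //; exact: measurable_allowed_pattern.
  by apply/seteqP; split=> [[g w]|[g w] []].
rewrite (pr_partition _ (index_enum_uniq _) mY mPC); last first.
  by move=> g _; rewrite mem_index_enum.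
apply: eq_bigr => A _.
pose A' (c : O) := if insub c is Some a then A a else false.
pose e (c : O) := if insub c is Some a then q a == ord_max else false.
have [h mh] := coins_thinned R A' F e.
have -> : thinned_weight A q = pr coins [set w | forall i, i \in F -> A' i && w i = e i].
  rewrite h big_seq_fsetE/=; apply: eq_bigr => a _.
  by rewrite /A' /e valK.
rewrite -pr_prod//; last exact: measurable_allowed_pattern.
congr pr; apply/seteqP; split=> [[g w] [/= gC gA]|[g w] [/= gA wC]].
  split=> //= c cF; rewrite /A' /e (insubT (fun c => c \in F) cF)/=.
  have := gC [` cF]%fset; move=> /coord_shift; rewrite /Phi/= => <-.
  by rewrite -gA ffunE.
split=> //= a; apply/coord_shift; have := wC _ (valP a).
by rewrite /A' /e /Phi/= valK -gA ffunE.
Qed.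

Lemma thinned_weight_sum A : \sum_q thinned_weight A q = 1.
Proof.
rewrite /thinned_weight -(bigA_distr_bigA (fun a j => if A a then 2^-1 else (j != ord_max)%:R)).
rewrite big1// => a _; rewrite big_ord_recr big_ord1/=; case: (A a).
  by lra.
by rewrite addr0.
Qed.

(** Given the allowed set [A], all labellings of positive weight have the same weight 2^-|A|. *)
Lemma thinned_weight_ln A q : thinned_weight A q * ln (thinned_weight A q) =
  thinned_weight A q * - ((\sum_a (A a)%:R) * ln 2).
Proof.
have [->|n0] := eqVneq (thinned_weight A q) 0; first by rewrite !mul0r.
congr (_ * _).
have -> : thinned_weight A q = expR (- ((\sum_a (A a)%:R) * ln 2)).
  rewrite -mulNr -sumrN mulr_suml expR_sum; apply: eq_bigr => a _.
  have [Aa|Aa] := boolP (A a); first by rewrite mulN1r expRN lnK// posrE.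
  rewrite oppr0 mul0r expR0; case: eqVneq => //= qa.
  move: n0; rewrite /thinned_weight (bigD1 a)//= (negbTE Aa) qa eqxx mul0r.
  by rewrite eqxx.
by rewrite expRK.
Qed.

(** Concavity: a mixture has at least the mean entropy of its components. Fair coins on [A] have
    entropy |A|, whose mean is |F| d, so no error term appears. *)
Lemma kappa_entropy_ge : #|` F|%:R * d <= join_entropy S kappa coord F.
Proof.
have ln20 : 0 < ln 2 :> R by rewrite ln_gt0// ltr1n.
rewrite -(ler_pM2l ln20) join_entropyE lerNr.
have t0 A q : 0 <= thinned_weight A q.
  by apply: prodr_ge0 => a _; case: ifP; rewrite ?invr_ge0.
apply: le_trans (mixture_entropy weight_ge0 t0 sum_weight thinned_weight_sum kappa_mixture) _.
under eq_bigr => A _ do [under eq_bigr => q _ do rewrite thinned_weight_ln;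
  rewrite -mulr_suml thinned_weight_sum mul1r mulrN mulrA].
by rewrite sumrN -mulr_suml weight_count mulrC lexx.
Qed.

End kappa_entropy.

(** * Topological entropy *)

Section open_determined.
Variables (I : countType) (E : I -> pointedType).

Lemma cylinder_open (s : seq I) (x : discrete_product E) :
  open [set y : discrete_product E | forall i, i \in s -> y i = x i].
Proof.
elim: s => [|i s IH].
  rewrite (_ : [set _ | _] = setT); first exact: openT.
  by apply/seteqP; split.
rewrite (_ : [set _ | _] = [set y | y i = x i] `&` [set y | forall j, j \in s -> y j = x j]).
  by apply: openI => //; exact: (open_coordinate (E := E) (i := i) [set e | e = x i]).
apply/seteqP; split=> [y h|y [hi hs] j].
  by split=> [|j js] /=; apply: h; rewrite inE ?eqxx ?js ?orbT.
by rewrite inE => /predU1P[->|/hs].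
Qed.

Lemma determined_open (J : {fset I}) (C : set (discrete_product E)) : determined J C -> open C.
Proof.
move=> dC; rewrite (_ : C = \bigcup_(x in C) [set y | forall i, i \in (J : seq I) -> y i = x i]).
  by apply: bigcup_open => x _; exact: cylinder_open.
apply/seteqP; split=> [x Cx|y [x Cx xy]]; first by exists x.
by apply: dC Cx => i iJ; apply/esym/xy.
Qed.

End open_determined.

Section topological_entropy.
Variables (R : realType) (K : fieldExtType rat) (b : nat -> idealr (integers K)).
Hypothesis hb : erdos_family R b.
Local Notation O := (integers K).
Local Notation S := (@config_shift K).
Local Notation X := (free_shift b).
Local Notation d := (dens_all R b [fset 0]%fset).
Implicit Types (x y : config K).

Lemma config_compact : compact [set: config K].
Proof.
have bool_compact : compact [set: discrete_topology bool].
  by apply: finite_compact; exact: (@finite_finset bool).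
have := @tychonoff O (fun _ => discrete_topology bool) _ (fun=> bool_compact).
by congr (compact _); apply/seteqP; split.
Qed.

(** For each of finitely many residue representatives [r], [x] has a one at some [a r] congruent to
    [r]; these ones alone keep [y] out of [X]. *)
Lemma free_shift_closed x : ~ X x ->
  exists J : {fset O}, forall y, agree (E := fun=> bool : pointedType) J x y -> ~ X y.
Proof.
move=> nX; have [l nl] : exists l, ~ (residues_met (b l) (config_supp x) < ideal_norm (b l))%N.
  by apply: contrapT => H; apply: nX => l; apply: contrapT => h; apply: H; exists l.
have [s sP] := ideal_reps (finite_residues hb) l.
have /choice[a aP] r : exists a : O, x a /\ a - r \in b l.
  apply: contrapT => H; apply: nl; apply/(residues_metP hb); exists r => a xa.
  by apply/negP => ar; apply: H; exists a.
exists [fset a r | r in s]%fset => y xy /(_ l)/(residues_metP hb)[r rP].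
have [t ts tr] := sP r; have [xa at'] := aP t.
have : a t - r \notin b l by apply: rP; rewrite -xy// in_imfset.
have -> : a t - r = (a t - t) + (t - r) by rewrite addrA subrK.
by rewrite rpredD.
Qed.

Lemma lebesgue_window k (U : 'I_k -> set (config K)) : open_cover X U ->
  exists J : {fset O}, forall x, X x ->
    exists i, forall y, agree (E := fun=> bool : pointedType) J x y -> U i y.
Proof.
move=> [oU XU].
pose f (J : {fset O}) : set (config K) := [set x |
  (exists i, forall y, agree (E := fun=> bool : pointedType) J x y -> U i y) \/
  (forall y, agree (E := fun=> bool : pointedType) J x y -> ~ X y)].
have of_ J : open (f J).
  apply: (determined_open (E := fun=> bool : pointedType) (J := J)) => x y xy.
  have h z : agree (E := fun=> bool : pointedType) J y z -> agree (E := fun=> bool :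
    pointedType) J x z.
    by move=> yz i iJ; rewrite xy// yz.
  by case=> [[i xi]|nX]; [left; exists i => z /h/xi|right=> z /h/nX].
have := config_compact; rewrite compact_cover => /(_ {fset O} setT f (fun J _ => of_ J)).
case=> [x _|D _ Df].
  have [Xx|nX] := pselect (X x).
    have [i _ Ux] := XU x Xx; have [J JU] := open_agree (oU i) Ux.
    by exists J => //; left; exists i.
  by have [J JX] := free_shift_closed nX; exists J => //; right.
exists (\bigcup_(J <- D) J)%fset => x Xx; have [J JD [[i xi]|nX]] := Df x I.
  exists i => y xy; apply: xi => a aJ; apply: xy.
  by apply/bigfcupP; exists J => //; rewrite andbT.
by exfalso; apply: (nX x).
Qed.

(** A pattern on the window of [F] and [J] fixes, for each a in [F], a member of the cover
    containing the shift by a; one element of the join per realized pattern is enough. *)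
Lemma realized_cover k (U : 'I_k -> set (config K)) (F J : {fset O}) :
  (forall x, X x ->
    exists i, forall y, agree (E := fun=> bool : pointedType) J x y -> U i y) ->
  exists D : {fset set (config K)}, [/\ [set` D] `<=` cover_join S U F,
    X `<=` \bigcup_(V in [set` D]) V &
    (#|` D| <= #|` realized b (window F J)|)%N].
Proof.
move=> JU; pose E := window F J.
have /choice[f fP] (p : {fset O}) : exists q : O -> 'I_k, p \in realized b E ->
    exists x, [/\ X x, pattern E x = p &
      forall a y, agree (E := fun=> bool : pointedType) J (S a x) y -> U (q a) y].
  have [|np] := boolP (p \in realized b E); last first.
    (* The zero configuration only shows that ['I_k] is inhabited, for a default value. *)
    have X0 : X (fun=> false) by apply/(free_shiftP hb); exists (fun=> 0).
    by have [i _] := JU _ X0; exists (fun=> i).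
  rewrite !inE/= => /andP[_ /asboolP[x Xx xp]].
  have /choice[q qP] a := JU _ (free_shift_shift hb a Xx).
  by exists q => _; exists x.
pose V p := \bigcap_(a in [set` F]) (S a @^-1` U (f p a)).
exists [fset V p | p in realized b E]%fset; split.
- by move=> _ /imfsetP[p /= pE ->]; exists (f p).
- move=> y Xy; have yE : pattern E y \in realized b E.
    rewrite !inE/= fpowersetE; apply/andP; split.
      by apply/fsubsetP => a; rewrite !inE => /andP[].
    by apply/asboolP; exists y.
  exists (V (pattern E y)); first by apply/imfsetP; exists (pattern E y).
  have [x [Xx xy qU]] := fP _ yE; move=> a /= aF; apply: qU => j jJ.
  have : (a + j \in pattern E x) = (a + j \in pattern E y) by rewrite xy.
  by rewrite !inE/= mem_window.
- exact: leq_imfset_card.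
Qed.

Lemma cover_number_le (C : set (set (config K))) (D : {fset set (config K)}) :
  [set` D] `<=` C -> X `<=` \bigcup_(V in [set` D]) V -> cover_number R X C <= #|` D|%:R.
Proof.
move=> DC DX; apply: ge_inf; last by exists D.
by exists 0 => _ [D' _ <-].
Qed.

(** A covering subfamily must exist, as the infimum of an empty set carries no information. *)
Lemma cover_number_ge (C : set (set (config K))) c :
  (exists D : {fset set (config K)}, [set` D] `<=` C /\ X `<=` \bigcup_(V in [set` D]) V) ->
  (forall D : {fset set (config K)}, [set` D] `<=` C ->
     X `<=` \bigcup_(V in [set` D]) V -> c <= #|` D|%:R) ->
  c <= cover_number R X C.
Proof.
move=> [D [DC DX]] h; apply: lb_le_inf; first by exists #|` D|%:R, D.
by move=> _ [D' [? ?] <-]; exact: h.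
Qed.

Lemma log2_le (x y : R) : x <= y -> 1 <= y -> log2 x <= log2 y.
Proof.
move=> xy y1; rewrite /log2 ler_pM2r ?invr_gt0 ?ln_gt0 ?ltr1n//.
have [x0|x0] := leP x 0; first by rewrite ln0// ln_ge0.
by rewrite ler_ln// posrE (lt_le_trans x0).
Qed.

Lemma cover_entropy_near k (U : 'I_k -> set (config K)) (F : nat -> {fset O}) e :
  open_cover X U -> folner R F -> 0 < e ->
  \forall n \near \oo,
    log2 (cover_number R X (cover_join S U (F n))) / #|` F n|%:R <= d + e.
Proof.
move=> oU FF e0; have [J JU] := lebesgue_window oU.
have ln20 : 0 < ln 2 :> R by rewrite ln_gt0// ltr1n.
have e2 : 0 < e * ln 2 by rewrite mulr_gt0.
have := @realized_weight_near R K b hb fset0 J 0 F _ FF (fsub0set _) _ e2.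
rewrite normr0 mul0r ler01 => /(_ isT); apply: filterS => n.
have f0 := folner_gt0 FF n.
under eq_bigr do rewrite /occurrences mul0r expR0.
rewrite sum_seq_const mulr1 !mul0r expr0n/= mulr0 !addr0 -mulrDl => h.
have [D [DC DX Dr]] := realized_cover (F n) JU; rewrite -(ler_nat R) in Dr.
rewrite ler_pdivrMr// [leRHS]mulrC.
have {h Dr} cle := le_trans (cover_number_le DC DX) (le_trans Dr h).
apply: le_trans (log2_le cle _) _.
  rewrite -[leLHS]expR0 ler_expR; apply: mulr_ge0 => //; apply/ltW/mulr_gt0 => //.
  by apply: addr_gt0 => //; exact: density_gt0.
by rewrite /log2 expRK mulrA mulfK// gt_eqF.
Qed.

Lemma cover_entropy_le k (U : 'I_k -> set (config K)) : open_cover X U ->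
  folner_lim (fun F => log2 (cover_number R X (cover_join S U F)) / #|` F|%:R) <= d.
Proof.
move=> oU; have [F FF] := integers_folner_exists R K.
apply: (folner_lim_le FF); first exact/ltW/density_gt0.
by move=> e e0; exact: cover_entropy_near.
Qed.

Definition coord_cover (i : 'I_2) : set (config K) := [set x | coord x = i].

Lemma coord_open_cover : open_cover X coord_cover.
Proof.
split=> [i|x _]; last by exists (coord x).
apply: (determined_open (E := fun=> bool : pointedType) (J := [fset 0]%fset)) => x y xy.
by rewrite /coord_cover/= /coord xy// inE.
Qed.

(** The subsets of the allowed positions [A] of a dense phase give 2^|A| points of [X], and an
    element of the join, which fixes all coordinates in [F], contains at most one of them. *)
Lemma coord_cover_number (F : {fset O}) :
  #|` F|%:R * d <= log2 (cover_number R X (cover_join S coord_cover F)).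
Proof.
have [g gd] := exists_dense_phase hb F; apply: le_trans gd _.
pose A : {fset O} := [fset a in F | phi g a]%fset.
have -> : (\sum_(a <- F) phi g a)%N = #|` A|.
  rewrite -sum1_size -big_fset_condE.
  by rewrite [RHS]big_mkcond; apply: eq_bigr => a _; case: (phi g a).
have cA : 2 ^+ #|` A| <= cover_number R X (cover_join S coord_cover F).
  have [J JU] := lebesgue_window coord_open_cover.
  have [D0 [DC0 DX0 _]] := realized_cover F JU.
  apply: cover_number_ge; first by exists D0.
  move=> D DC DX; rewrite -natrX ler_nat -card_fpowerset.
  pose x (p : {fset O}) : config K := fun a => a \in p.
  have Xx p : p \in fpowerset A -> X (x p).
    rewrite fpowersetE => /fsubsetP pA; apply: (phi_free_shift hb (g := g)) => a /pA.
    by rewrite !inE => /andP[].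
  have /choice[V VP] p : exists V, p \in fpowerset A -> V \in D /\ V (x p).
    have [pA|_] := boolP (p \in fpowerset A); last by exists set0.
    by have [V VD Vx] := DX _ (Xx p pA); exists V.
  have Vinj : {in fpowerset A &, injective V}.
    move=> p p' pA p'A Vpp'; have [VD Vx] := VP p pA; have [_ Vx'] := VP p' p'A.
    have [q _ qV] := DC _ VD; rewrite -qV in Vpp' Vx; rewrite -Vpp' in Vx'.
    apply/fsetP => a; have [aF|aF] := boolP (a \in F).
      have /coord_shift h := Vx a aF; have /coord_shift h' := Vx' a aF.
      by rewrite -[LHS]/(x p a) h -[RHS]/(x p' a) h'.
    have notin r : r \in fpowerset A -> (a \in r) = false.
      rewrite fpowersetE => /fsubsetP rA; apply/negP => /rA.
      by rewrite !inE (negbTE aF).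
    by rewrite !notin.
  rewrite -(size_map V); apply: uniq_leq_size.
    by rewrite map_inj_in_uniq ?fset_uniq.
  by move=> _ /mapP[p pA ->]; exact: (VP p pA).1.
have ln20 : 0 < ln 2 :> R by rewrite ln_gt0// ltr1n.
have p0 : 0 < 2 ^+ #|` A| :> R by rewrite exprn_gt0.
rewrite /log2 ler_pdivlMr// mulr_natl -lnXn// ler_ln ?posrE//.
exact: lt_le_trans p0 cA.
Qed.

Lemma coord_cover_limit (F : nat -> {fset O}) : folner R F ->
  log2 (cover_number R X (cover_join S coord_cover (F n))) / #|` F n|%:R @[n --> \oo] --> d.
Proof.
move=> FF; apply/cvgrPdist_le => e e0.
have := cover_entropy_near coord_open_cover FF e0; apply: filterS => n h.
have f0 := folner_gt0 FF n.
have : d <= log2 (cover_number R X (cover_join S coord_cover (F n))) / #|` F n|%:R.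
  by rewrite ler_pdivlMr// mulrC coord_cover_number.
by rewrite ler_norml => ?; apply/andP; split; lra.
Qed.

Lemma topological_entropy_free_shift : topological_entropy R S X = d%:E.
Proof.
apply/eqP; rewrite eq_le; apply/andP; split.
  apply: ge_ereal_sup => _ [k [U oU ->]].
  by rewrite lee_fin cover_entropy_le.
apply: ereal_sup_ubound; exists 2%N, coord_cover; first exact: coord_open_cover.
have [F FF] := integers_folner_exists R K.
by congr (_%:E); apply/esym; apply: (folner_lim_eq FF) => G GG; exact: coord_cover_limit.
Qed.

End topological_entropy.

Section kappa_maximal.
Variables (R : realType) (K : fieldExtType rat) (b : nat -> idealr (integers K)).
Hypothesis hb : erdos_family R b.
Local Notation O := (integers K).
Local Notation S := (@config_shift K : O -> borel (config K) -> borel (config K)).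
Local Notation d := (dens_all R b [fset 0]%fset).
Local Notation haar := (haar R b).
Local Notation kappa := (kappa R b).
Local Notation mirsky := (mirsky R b).

(** Convergence holds along every Følner sequence, as [folner_lim] demands: the lower bound is exact
    on each finite set, the upper one asymptotic. *)
Lemma kappa_coord_limit (F : nat -> {fset O}) : folner R F ->
  join_entropy S kappa (@coord K) (F n) / #|` F n|%:R @[n --> \oo] --> d.
Proof.
move=> FF; apply/cvgrPdist_le => e e0.
have ln20 : 0 < ln 2 :> R by rewrite ln_gt0// ltr1n.
have e2 : 0 < e * ln 2 by rewrite mulr_gt0.
have := @entropy_weight_bound R K b hb kappa (kappa_free_shift hb) (kappa_invariant hb)
  _ _ fset0 0 F _ (@measurable_coord K) FF _ e2.
rewrite normr0 mul0r ler01 => /(_ isT); apply: filterS => n.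
have f0 := folner_gt0 FF n; rewrite !mul0r expr0n/= mulr0 !addr0 -mulrDl => h.
have h1 : d <= join_entropy S kappa (@coord K) (F n) / #|` F n|%:R.
  by rewrite ler_pdivlMr// mulrC kappa_entropy_ge.
have h2 : join_entropy S kappa (@coord K) (F n) / #|` F n|%:R <= d + e.
  by rewrite ler_pdivrMr// -(ler_pM2l ln20); move: h; lra.
by rewrite ler_norml; apply/andP; split; lra.
Qed.

Lemma kappa_ks_entropy : ks_entropy S kappa = d%:E.
Proof.
apply/eqP; rewrite eq_le (ks_entropy_le hb (kappa_free_shift hb) (kappa_invariant hb))/=.
apply: ereal_sup_ubound; exists 2%N, (@coord K); first exact: measurable_coord.
have [F FF] := integers_folner_exists R K.
by congr (_%:E); apply/esym; apply: (folner_lim_eq FF) => G GG; exact: kappa_coord_limit.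
Qed.

Lemma rotate_residue L a (g : phases b) :
  agree (E := fun l => {ideal_quot (b l)} : pointedType) (below L)
    (rotate a g) (residue b (rep L g + a)).
Proof.
by move=> l; rewrite belowE => lL; rewrite /rotate /residue (rep_eq hb _ lL) rmorphD.
Qed.

(* Modulo the first L ideals a phase takes finitely many values, and each of them
   determines the approximating labels on all of F n. *)
Lemma mirsky_entropy_near k (xi : borel (config K) -> 'I_k) (F : nat -> {fset O}) e :
  measurable_labelling xi -> folner R F -> 0 < e ->
  \forall n \near \oo, join_entropy S mirsky xi (F n) / #|` F n|%:R <= e.
Proof.
move=> mxi FF e0; have ln20 : 0 < ln 2 :> R by rewrite ln_gt0// ltr1n.
have e2 : 0 < e * ln 2 / 2 by rewrite divr_gt0// mulr_gt0.
have [g [eps [g0 eps0 geps]]] := exists_error_parameters k e2.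
pose zeta : borel (phases b) -> 'I_k := xi \o @phi K b.
have mzeta : measurable_labelling zeta.
  by move=> i; have := @measurable_phi K b measurableT _ (mxi i); rewrite setTI.
have [J [eta [etaJ [meta petas]]]] := labelling_approx (countable_residues hb) haar mzeta eps0.
have [L JL] : exists L, (J `<=` below L)%fset.
  exists (\max_(l <- J) l).+1; apply/fsubsetP => l lJ; rewrite belowE ltnS.
  by rewrite (bigD1_seq l)//= leq_maxl.
have [B BP] : exists B : nat, ln #|` reps b L|%:R / (e * ln 2 / 2) <= B%:R.
  by exists (Num.truncn (ln #|` reps b L|%:R / (e * ln 2 / 2))).+1; rewrite ltW// truncnS_gt.
near=> n.
have fB : ln #|` reps b L|%:R <= e * ln 2 / 2 * #|` F n|%:R.
  rewrite mulrC -ler_pdivrMr//; apply: le_trans BP _; rewrite ler_nat.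
  by near: n; exact: (folner_size _ FF).
have f0 := folner_gt0 FF n.
pose lab (a : F n) (x : borel (phases b)) := zeta (rotate (val a) x).
pose eta' t (a : F n) := eta (residue b (t + val a)).
have mrot a (C : set (borel (phases b))) : measurable C -> measurable (rotate a @^-1` C).
  by move=> mC; have := measurable_rotate hb a measurableT mC; rewrite setTI.
have mlab a : measurable_labelling (lab a).
  by move=> i; exact: (mrot (val a) _ (mzeta i)).
have lab_eta a : measurable [set x | lab a x != eta' (rep L x) a] /\
    pr haar [set x | lab a x != eta' (rep L x) a] <= eps.
  have -> : [set x | lab a x != eta' (rep L x) a] = rotate (val a) @^-1` [set x | zeta x != eta x].
    have E x : eta' (rep L x) a = eta (rotate (val a) x).
      by apply/esym/etaJ; apply: agreeW JL _; exact: rotate_residue.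
    by apply/seteqP; split=> x /=; rewrite /lab E.
  by split; [exact: mrot|rewrite /pr haar_rotate].
have repsin x : [set: borel (phases b)] x -> rep L x \in reps b L.
  by move=> _; have [] := repP hb L x.
(* The finite datum is now the representative [rep L x], with [h] = 0: the weights sum to |reps b
   L|, a constant, so the entropy is negligible against |F n|. *)
have := @join_entropy_bound _ _ _ haar _ k lab _ (@rep K b L) (reps b L) setT eta' (fun=> 0) g eps
  mlab (measurable_rep hb L) measurableT (prT haar) (fset_uniq _) repsin g0 lab_eta.
rewrite [X in - _ + X]big1 ?addr0; last by move=> t _; rewrite mulr0.
under [X in ln X]eq_bigr do rewrite expR0.
rewrite sum_seq_const mulr1 -cardfE.
have -> : - \sum_(q : {ffun F n -> 'I_k}) pr haar [set x | forall a, lab a x = q a] *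
      ln (pr haar [set x | forall a, lab a x = q a]) = ln 2 * join_entropy S mirsky xi (F n).
  rewrite join_entropyE; congr (- _); apply: eq_bigr => q _.
  have E x a : lab a x = xi (S (val a) (phi x)).
    by congr xi; apply/funext => c; rewrite phi_rotate.
  suff -> : pr haar [set x | forall a, lab a x = q a] =
      pr mirsky [set x | forall a : F n, xi (S (val a) x) = q a] by [].
  by congr (fine (haar _)); apply/seteqP; split=> x h a; have := h a; rewrite E.
move=> H; rewrite ler_pdivrMr// -(ler_pM2l ln20); apply: le_trans H _.
have := ler_wpM2l (ltW f0) geps; move: fB; lra.
Unshelve. all: by end_near. Qed.

Lemma mirsky_ks_entropy : ks_entropy S mirsky = 0%E.
Proof.
have [F FF] := integers_folner_exists R K.
apply/eqP; rewrite eq_le; apply/andP; split.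
  apply: ge_ereal_sup => _ [k [xi mxi ->]]; rewrite lee_fin.
  apply: (folner_lim_le FF) => // e e0; have := mirsky_entropy_near mxi FF e0.
  by apply: filterS => n; rewrite add0r.
apply: ereal_sup_ubound; exists 1%N, (fun=> ord0).
  by move=> i; rewrite preimage_cst; case: ifP => _; [exact: measurableT|exact: measurable0].
congr (_%:E); apply/esym; apply: (folner_lim_eq FF) => G GG.
rewrite (_ : (fun n => _) = fun=> 0); first exact: cvg_cst.
apply/funext => n; rewrite /join_entropy big1 ?oppr0 ?mul0r// => q _.
rewrite (_ : [set _ | _] = setT); first by rewrite probability_setT/= /log2 ln1 mul0r mulr0.
by apply/seteqP; split => // x _ a; rewrite (ord1 (q a)).
Qed.

End kappa_maximal.

(** * Mutual singularity *)

Section singularity_criterion.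
Context d (T : measurableType d) (R : realType) (mu nu : probability T R).

(** Borel-Cantelli: take sets with errors 2^-(n+1) and their limit superior. It is [mu]-null by
    summability, and of full [nu]-mass since each tail union contains sets of mass arbitrarily near
    1. *)
Lemma mutually_singular_of_separation :
  (forall e, 0 < e -> exists B, [/\ measurable B, pr mu B <= e & pr nu (~` B) <= e]) ->
  mutually_singular mu nu.
Proof.
move=> sep.
have /choice[B BP] n : exists B, [/\ measurable B, pr mu B <= 1 / (2 ^ n.+1)%:R &
    pr nu (~` B) <= 1 / (2 ^ n.+1)%:R].
  by apply: sep; rewrite divr_gt0// ltr0n expn_gt0.
have mB n : measurable (B n) by have [] := BP n.
have mU n : measurable (\bigcup_(k in [set k | (n <= k)%N]) B k) by exact: bigcup_measurable.
have mL : measurable (lim_sup_set B) by exact: bigcap_measurableType.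
exists (lim_sup_set B); split => //.
  apply: lim_sup_set_cvg0 => //.
  apply: (@le_lt_trans _ _ (\sum_(0 <= n <oo) (1 / (2 ^ n.+1)%:R)%:E)%E).
    by apply: lee_nneseries => n //= _; rewrite (prE mu (mB n)) lee_fin; have [] := BP n.
  by apply: le_lt_trans (epsilon_trick0 xpredT ler01) (ltry 1).
rewrite probability_setC// prE//; suff -> : pr nu (lim_sup_set B) = 1 by rewrite subee.
have dec n p : (n <= p)%N -> \bigcup_(k in [set k | (p <= k)%N]) B k `<=` \bigcup_(k in [set k
  | (n <= k)%N]) B k.
  by move=> np x [k /= pk Bx]; exists k => //=; exact: leq_trans np pk.
have := @pr_cvg_decr _ _ _ nu _ mU dec.
have U1 n : pr nu (\bigcup_(k in [set k | (n <= k)%N]) B k) = 1.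
  apply/eqP; rewrite eq_le pr_le1//=; apply/ler_addgt0Pr => e e0.
  have [m mP] : exists m, 1 / (2 ^ m.+1)%:R <= e.
    exists (Num.truncn e^-1); rewrite ler_pdivrMr ?ltr0n ?expn_gt0// mulrC -ler_pdivrMr// div1r.
    apply: le_trans (ltW (truncnS_gt _)) _; rewrite ler_nat ltnW// ltn_expl//.
  set k := maxn n m.
  have kP : 1 / (2 ^ k.+1)%:R <= e.
    apply: le_trans mP; rewrite !div1r lef_pV2 ?posrE ?ltr0n ?expn_gt0// ler_nat leq_exp2l//.
    by rewrite ltnS leq_maxr.
  have [_ _ h] := BP k; rewrite prC// in h.
  have : pr nu (B k) <= pr nu (\bigcup_(k in [set k | (n <= k)%N]) B k).
    by apply: le_pr => // x Bx; exists k => //=; exact: leq_maxl.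
  move: h kP; lra.
under eq_fun do rewrite U1.
by move=> /(cvg_unique _ (cvg_cst _)) => <-.
Qed.

End singularity_criterion.

(** * Moments of the number of ones in a finite set *)

Section pattern_moments.
Variables (R : realType) (K : fieldExtType rat).
Local Notation O := (integers K).
Variable mu : probability (borel (config K)) R.
Variable F : {fset O}.
Implicit Types (p W : {fset O}).

Local Notation q p := (pr mu [set x | pattern F x = p]).

Lemma pattern_mean_incl W : (W `<=` F)%fset ->
  \sum_(p <- fpowerset F) q p * (W `<=` p)%fset%:R = pr mu (ones W).
Proof.
move=> WF.
rewrite (pr_partition mu (fset_uniq (fpowerset F)) (measurable_pattern F) (measurable_ones W));
  last first.
  by move=> x _; rewrite fpowersetE; apply/fsubsetP => a; rewrite !inE => /andP[].
apply: eq_bigr => p _; have [h|h] := boolP (W `<=` p)%fset.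
  rewrite mulr1; congr pr; apply/seteqP; split=> x /=; last by case.
  by move=> xp; split=> // w wW; have := fsubsetP h w wW; rewrite -xp !inE => /andP[].
rewrite mulr0 (_ : _ `&` _ = set0) ?pr0//; apply/seteqP; split => // x [xW xp].
move/negP: h; apply; apply/fsubsetP => w wW; rewrite -xp !inE/= (fsubsetP WF)//=.
exact: xW.
Qed.

Lemma card_indicator p : (p `<=` F)%fset -> #|` p|%:R = \sum_(a <- F) ([fset a] `<=` p)%fset%:R
  :> R.
Proof.
move=> pF; rewrite -natr_sum; congr (_%:R).
have pE : p = [fset a in F | a \in p]%fset.
  by apply/fsetP => a; rewrite !inE/= andb_idl// => /(fsubsetP pF).
rewrite [in LHS]pE -sum1_size -big_fset_condE [LHS]big_mkcond/=.
by apply: eq_bigr => a _; rewrite fsub1set; case: (a \in p).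
Qed.

Lemma pattern_mean_card :
  \sum_(p <- fpowerset F) q p * #|` p|%:R = \sum_(a <- F) pr mu (ones [fset a]%fset).
Proof.
rewrite big_seq (eq_bigr (fun p => \sum_(a <- F) q p * ([fset a] `<=` p)%fset%:R)); last first.
  by move=> p; rewrite fpowersetE => pF; rewrite (card_indicator pF) mulr_sumr.
rewrite -big_seq exchange_big/= [LHS]big_seq [RHS]big_seq; apply: eq_bigr => a aF.
by rewrite pattern_mean_incl// fsub1set.
Qed.

Lemma pattern_mean_card2 :
  \sum_(p <- fpowerset F) q p * #|` p|%:R ^+ 2 =
  \sum_(a <- F) \sum_(c <- F) pr mu (ones [fset a; c]%fset).
Proof.
rewrite big_seq (eq_bigr (fun p => \sum_(a <- F) \sum_(c <- F) q p * ([fset a;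
  c] `<=` p)%fset%:R)); last first.
  move=> p; rewrite fpowersetE => pF; rewrite (card_indicator pF) expr2 mulr_suml mulr_sumr.
  apply: eq_bigr => a _; rewrite !mulr_sumr; apply: eq_bigr => c _.
  by rewrite fsubUset -natrM mulnb.
rewrite -big_seq exchange_big/= [LHS]big_seq [RHS]big_seq; apply: eq_bigr => a aF.
rewrite exchange_big/= [LHS]big_seq [RHS]big_seq; apply: eq_bigr => c cF.
by rewrite pattern_mean_incl// fsubUset !fsub1set aF.
Qed.

Lemma measurable_pattern_pred (B : pred {fset O}) :
  measurable [set x : borel (config K) | B (pattern F x)].
Proof.
apply: (measurable_determined (@countable_bool K) (J := F)) => x y xy /=.
suff -> : pattern F x = pattern F y by [].
by apply/fsetP => a; rewrite !inE/=; case: (boolP (a \in F)) => //= aF; rewrite xy.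
Qed.

(** Chebyshev's inequality for |p|, with the second moment about [c] expanded into one-point and
    two-point masses. *)
Lemma pattern_chebyshev (B : pred {fset O}) c eta : 0 < eta ->
  (forall p, B p -> eta <= `|#|` p|%:R - c|) ->
  pr mu [set x | B (pattern F x)] <=
    (\sum_(a <- F) \sum_(a' <- F) pr mu (ones [fset a; a']%fset)
     - 2 * c * (\sum_(a <- F) pr mu (ones [fset a]%fset)) + c ^+ 2) / eta ^+ 2.
Proof.
move=> eta0 Bc; have mB := measurable_pattern_pred B.
have inF x : pattern F x \in fpowerset F.
  by rewrite fpowersetE; apply/fsubsetP => a; rewrite !inE => /andP[].
rewrite -pattern_mean_card2 -pattern_mean_card.
have q1 : \sum_(p <- fpowerset F) q p = 1.
  rewrite -(prT mu) (pr_partition mu (fset_uniq (fpowerset F)) (measurable_pattern F)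
    measurableT)//.
  by apply: eq_bigr => p _; rewrite setTI.
have -> : \sum_(p <- fpowerset F) q p * #|` p|%:R ^+ 2
     - 2 * c * (\sum_(p <- fpowerset F) q p * #|` p|%:R) + c ^+ 2 =
   \sum_(p <- fpowerset F) q p * (#|` p|%:R - c) ^+ 2.
  have cE : c ^+ 2 = \sum_(p <- fpowerset F) q p * c ^+ 2 by rewrite -mulr_suml q1 mul1r.
  rewrite [in LHS]cE mulr_sumr -sumrB -big_split/=.
  by apply: eq_bigr => p _; ring.
rewrite (pr_partition mu (fset_uniq (fpowerset F)) (measurable_pattern F) mB)// mulr_suml.
apply: ler_sum => p _; have [Bp|Bp] := boolP (B p); last first.
  have -> : [set x | B (pattern F x)] `&` [set x | pattern F x = p] = set0.
    by apply/seteqP; split => // x [/= Bx xp]; move: Bp; rewrite -xp Bx.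
  by rewrite pr0 divr_ge0 ?sqr_ge0// mulr_ge0 ?sqr_ge0 ?pr_ge0.
apply: (@le_trans _ _ (q p)).
  apply: le_pr; [|exact: measurable_pattern|by move=> x []].
  by apply: measurableI => //; exact: measurable_pattern.
rewrite ler_pdivlMr ?exprn_gt0// ler_wpM2l ?pr_ge0//.
rewrite -[leRHS](real_normK (num_real _)) lerXn2r ?nnegrE ?(ltW eta0) ?normr_ge0//.
exact: Bc.
Qed.

End pattern_moments.

Section separation.
Variables (R : realType) (K : fieldExtType rat) (b : nat -> idealr (integers K)).
Hypothesis hb : erdos_family R b.
Local Notation O := (integers K).
Local Notation d := (dens_all R b [fset 0]%fset).
Local Notation kappa := (kappa R b).
Local Notation mirsky := (mirsky R b).

Lemma mirsky_ones W : pr mirsky (ones W) = dens_all R b W.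
Proof. by []. Qed.

Lemma dens_singleton (a : O) : dens_all R b [fset a]%fset = d.
Proof.
rewrite -[RHS](dens_all_translate hb a); congr dens_all.
by apply/fsetP => c; rewrite translateP !in_fset1 subr_eq0.
Qed.

Lemma mirsky_free_shift : mirsky (free_shift b) = 1%E.
Proof.
have E : @phi K b @^-1` free_shift b = setT.
  by apply/seteqP; split => // g _; exact: (phi_free_shift hb (g := g)).
transitivity (haar R b (@phi K b @^-1` free_shift b)) => //.
by rewrite E probability_setT.
Qed.

(** A pathwise bound in place of pair correlations: almost every pattern is realized, hence has at
    most [c] ones. *)
Lemma mirsky_second_moment (F : {fset O}) c : 0 <= c ->
  (forall p, p \in realized b F -> #|` p|%:R <= c) ->
  \sum_(a <- F) \sum_(a' <- F) pr mirsky (ones [fset a; a']%fset) <= c ^+ 2.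
Proof.
move=> c0 hc; rewrite -pattern_mean_card2.
apply: (@le_trans _ _ (\sum_(p <- fpowerset F) pr mirsky [set x | pattern F x = p] * c ^+ 2)).
  rewrite big_seq [leRHS]big_seq; apply: ler_sum => p pF.
  have [pR|pR] := boolP (p \in realized b F).
    by rewrite ler_wpM2l ?pr_ge0// lerXn2r ?nnegrE// hc.
  suff -> : pr mirsky [set x | pattern F x = p] = 0 by rewrite !mul0r.
  rewrite -(pr_full (measurable_free_shift hb) (_ : pr mirsky _ = 1) (measurable_pattern F p)).
    rewrite (_ : _ `&` _ = set0) ?pr0//; apply/seteqP; split => // x [Xx xp].
    by case/negP: pR; rewrite !inE/= pF; apply/asboolP; exists x.
  by rewrite /pr mirsky_free_shift.
rewrite -mulr_suml ler_piMl ?sqr_ge0//.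
rewrite -(prT mirsky) (pr_partition mirsky (fset_uniq (fpowerset F)) (measurable_pattern F)
  measurableT).
  by rewrite le_eqVlt; apply/orP; left; apply/eqP; apply: eq_bigr => p _; rewrite setTI.
by move=> x _; rewrite fpowersetE; apply/fsubsetP => a; rewrite !inE => /andP[].
Qed.

(** Two distinct allowed positions carry two independent coins, whence 1/4; the diagonal terms are
    at most 1 each. *)
Lemma kappa_second_moment (F : {fset O}) :
  \sum_(a <- F) \sum_(a' <- F) pr kappa (ones [fset a; a']%fset) <=
  (\sum_(a <- F) \sum_(a' <- F) pr mirsky (ones [fset a; a']%fset)) / 4 + #|` F|%:R.
Proof.
rewrite -[#|` F|%:R]mulr1 -sum_seq_const mulr_suml -big_split/=.
rewrite big_seq [leRHS]big_seq; apply: ler_sum => a aF.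
have h1 : pr kappa (ones [fset a; a]%fset) <= 1 by apply: pr_le1; exact: measurable_ones.
have h2 : \sum_(c <- rem a F) pr kappa (ones [fset a; c]%fset) <=
    (\sum_(c <- rem a F) pr mirsky (ones [fset a; c]%fset)) / 4.
  rewrite mulr_suml big_seq [leRHS]big_seq; apply: ler_sum => c cF.
  have ac : a != c by apply: contraTneq cF => <-; rewrite mem_rem_uniqF ?fset_uniq.
  by rewrite mirsky_ones kappa_ones// cardfs2 ac -natrX.
have h3 := pr_ge0 mirsky (ones [fset a; a]%fset).
rewrite (big_rem a)//= [X in _ <= X / _ + _](big_rem a)//=.
move: h1 h2 h3; lra.
Qed.

Lemma kappa_mirsky_singular : mutually_singular kappa mirsky.
Proof.
apply: mutually_singular_of_separation => e e0.
have d0 := density_gt0 hb.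
have d1 : d <= 1 by apply: pr_le1; exact: (measurable_avoids_all hb).
(* [z] bounds both the density error and 1/|F n|. The second moments about d f / 2 and d f are at
   most 7/4 z f^2 and 3 z f^2; division by (d f / 4)^2 asks for 48 z <= e d^2, and 64 leaves room. z
   <= 1 gives 2 d z + z^2 <= 3 z. *)
pose z := Num.min 1 (e * d ^+ 2 / 64).
have z0 : 0 < z by rewrite lt_min ltr01 divr_gt0// mulr_gt0// exprn_gt0.
have z1 : z <= 1 by rewrite ge_min lexx.
have ze : 64 * z <= e * d ^+ 2.
  by rewrite mulrC -ler_pdivlMr// ge_min lexx orbT.
have [F FF] := integers_folner_exists R K.
have [n [hreal hsize]] : exists n,
    (forall p, p \in realized b (F n) -> #|` p|%:R <= #|` F n|%:R * (d + z)) /\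
    z^-1 <= #|` F n|%:R.
  near \oo => n; exists n; split; first by near: n; exact: realized_card_near.
  apply: le_trans (ltW (truncnS_gt _)) _; rewrite ler_nat.
  by near: n; exact: (folner_size _ FF).
set f : R := #|` F n|%:R in hreal hsize *.
have f0 : 0 < f by exact: (folner_gt0 FF).
have fz : f <= z * f ^+ 2.
  by rewrite expr2 mulrA ler_peMl ?(ltW f0)// -ler_pdivrMl// mulr1.
(* The threshold is midway between the means d f / 2 and d f, at distance d f / 4 from each. *)
pose B : pred {fset O} := fun p => 3 / 4 * (d * f) <= #|` p|%:R.
have eta0 : 0 < d * f / 4 by rewrite divr_gt0// mulr_gt0.
have m1 : \sum_(a <- F n) pr mirsky (ones [fset a]%fset) = d * f.
  by under eq_bigr do rewrite mirsky_ones dens_singleton; rewrite sum_seq_const mulrC.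
have k1 : \sum_(a <- F n) pr kappa (ones [fset a]%fset) = d * f / 2.
  under eq_bigr do rewrite kappa_ones// dens_singleton cardfs1.
  by rewrite sum_seq_const mulrC mulrAC.
have M2 : \sum_(a <- F n) \sum_(a' <- F n) pr mirsky (ones [fset a; a']%fset) <=
    (f * (d + z)) ^+ 2.
  by apply: mirsky_second_moment => //; rewrite mulr_ge0 ?(ltW f0)// addr_ge0// ltW.
have K2 := kappa_second_moment (F n); rewrite -/f in K2.
have f2 : 0 < f ^+ 2 by rewrite exprn_gt0.
have zz : (f * (d + z)) ^+ 2 <= (d * f) ^+ 2 + 3 * z * f ^+ 2.
  have -> : (f * (d + z)) ^+ 2 = (d * f) ^+ 2 + (2 * d * z + z * z) * f ^+ 2 by ring.
  rewrite lerD2l ler_wpM2r ?(ltW f2)//; nra.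
have etaE : (d * f / 4) ^+ 2 = d ^+ 2 / 16 * f ^+ 2 by field.
have dd : 0 < d ^+ 2 by rewrite exprn_gt0.
exists [set x | B (pattern (F n) x)]; split.
- exact: measurable_pattern_pred.
- apply: le_trans (@pattern_chebyshev R K kappa (F n) B (d * f / 2) _ eta0 _) _.
    by move=> p Bp; apply: le_trans (ler_norm _); move: Bp; rewrite /B; lra.
  rewrite k1 ler_pdivrMr ?exprn_gt0// etaE.
  have : 64 * z * f ^+ 2 <= e * d ^+ 2 * f ^+ 2 by rewrite ler_wpM2r// ltW.
  move: K2 M2 zz fz; lra.
- have -> : ~` [set x | B (pattern (F n) x)] = [set x | (predC B) (pattern (F n) x)].
    by apply/seteqP; split=> x /= /negP.
  apply: le_trans (@pattern_chebyshev R K mirsky (F n) (predC B) (d * f) _ eta0 _) _.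
    move=> p /=; rewrite /B -ltNge distrC => Bp; apply: le_trans (ler_norm _).
    by move: Bp; lra.
  rewrite m1 ler_pdivrMr ?exprn_gt0// etaE.
  have : 64 * z * f ^+ 2 <= e * d ^+ 2 * f ^+ 2 by rewrite ler_wpM2r// ltW.
  move: M2 zz; lra.
Unshelve. all: by end_near. Qed.

End separation.

Theorem theorem1p3 (R : realType) (K : fieldExtType rat)
    (b : nat -> idealr (integers K)) (hb : erdos_family R b) :
  [/\ maximal_entropy (T := config K) (@config_shift K) (free_shift b) (kappa R b),
      (forall nu : probability (borel (config K)) R,
         maximal_entropy (T := config K) (@config_shift K) (free_shift b) nu ->
         forall B : set (borel (config K)),
           measurable B -> nu B = kappa R b B) &
      (forall B : set (borel (config K)), measurable B ->
         measurable_fun [set: borel (phases b)] (kappa_phase R b ^~ B) /\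
         kappa R b B = (\int[haar R b]_g kappa_phase R b g B)%E)] /\
  [/\ ks_entropy (T := borel (config K)) (@config_shift K) (kappa R b) =
        topological_entropy R (T := config K) (@config_shift K) (free_shift b),
      topological_entropy R (T := config K) (@config_shift K) (free_shift b) =
        (limn (fun n => \prod_(0 <= l < n)
                          (1 - (ideal_norm (b l))%:R^-1 : R)))%:E,
      mutually_singular (kappa R b) (mirsky R b) &
      ks_entropy (T := borel (config K)) (@config_shift K) (mirsky R b) = 0%E].
Proof.
have htop := topological_entropy_free_shift hb.
split; split.
- split; [exact: kappa_free_shift|exact: kappa_invariant|].
  by rewrite htop; exact: kappa_ks_entropy.
- move=> nu [nuX nuS nuh] B mB; apply: ones_unique mB => W.
  rewrite kappa_ones//; apply: (maximal_ones hb nuX nuS).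
  by rewrite nuh htop.
- exact: kappa_disintegration.
- by rewrite htop; exact: kappa_ks_entropy.
- by rewrite htop dens1_all.
- exact: kappa_mirsky_singular.
- exact: mirsky_ks_entropy.
Qed.
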